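(* Let $p\in(\tfrac{10}{3},6]$, $c>0$, and assume that $\gamma<0$ and $a<0$. Then the functional $F$ has no critical point on $S(c)$.
   Context: $H^1(\mathbb{R}^3)$ is the usual Sobolev space of real-valued functions. For $u\in H^1(\mathbb{R}^3)$, $$F(u)=\frac12\int_{\mathbb{R}^3}|\nabla u|^2dx-\frac{\gamma}{4}\int_{\mathbb{R}^3}\int_{\mathbb{R}^3}\frac{|u(x)|^2|u(y)|^2}{|x-y|}\,dx\,dy-\frac{a}{p}\int_{\mathbb{R}^3}|u|^pdx .$$ For $c>0$, $S(c)=\{u\in H^1(\mathbb{R}^3):\|u\|_{L^2(\mathbb{R}^3)}^2=c\}$. A critical point of $F$ on $S(c)$ is a critical point of the restriction of $F$ to the $C^1$-submanifold $S(c)$ of $H^1(\mathbb{R}^3)$; equivalently, a $u\in S(c)$ which, for some Lagrange multiplier $\lambda\in\mathbb{R}$, is a weak solution of $-\Delta u+\lambda u-\gamma(|x|^{-1}*|u|^2)u-a|u|^{p-2}u=0$ in $\mathbb{R}^3$. *)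

(* Defs.v *)
From HB Require Import structures.
From mathcomp Require Import all_boot all_order all_algebra.
From mathcomp Require Import all_classical all_reals all_analysis.

Set Implicit Arguments.
Unset Strict Implicit.
Unset Printing Implicit Defensive.

Import Order.TTheory GRing.Theory Num.Theory.
Import numFieldNormedType.Exports.

Local Open Scope classical_set_scope.
Local Open Scope ring_scope.

(* Functions of H^1 are represented by Borel functions; every notion below only
   depends on the almost-everywhere class of the representative. *)

(* measurableTypeR R is R with the Borel sigma-algebra on which lebesgue_measure
   is defined. *)
Definition leb3 (R : realType) :
    {measure set (measurableTypeR R * measurableTypeR R * measurableTypeR R) ->
       \bar R} :=
  ((@lebesgue_measure R \x @lebesgue_measure R) \x @lebesgue_measure R)%E.
Arguments leb3 R : clear implicits.

(* The library norm of a product space is the sup norm, hence the need for the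
   Euclidean norm. *)
Definition enorm3 (R : realType) (x : R * R * R) : R :=
  Num.sqrt (x.1.1 ^+ 2 + x.1.2 ^+ 2 + x.2 ^+ 2).

Definition e3 (R : realType) (i : 'I_3) : R * R * R :=
  ((i == 0 :> nat)%:R, (i == 1 :> nat)%:R, (i == 2 :> nat)%:R).

Definition partial (R : realType) (i : 'I_3) (f : R * R * R -> R) :
    R * R * R -> R :=
  fun x => 'D_(e3 R i) f x.

Definition smooth (R : realType) (f : R * R * R -> R) : Prop :=
  forall s : seq 'I_3,
    continuous (foldr (@partial R) f s) /\
    forall (i : 'I_3) (x : R * R * R), derivable (foldr (@partial R) f s) x (e3 R i).

Definition test_function (R : realType) (phi : R * R * R -> R) : Prop :=
  smooth phi /\ compact (closure [set x | phi x != 0]).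

Definition L2 (R : realType) : set (R * R * R -> R) :=
  [set u | u \in Lfun (leb3 R) 2%:E].

Definition weak_partial (R : realType) (i : 'I_3) (u g : R * R * R -> R) : Prop :=
  forall phi : R * R * R -> R, test_function phi ->
    \int[leb3 R]_x (u x * partial i phi x) = - \int[leb3 R]_x (g x * phi x).

Definition H1 (R : realType) : set (R * R * R -> R) :=
  [set u | L2 u /\ forall i : 'I_3, exists g, L2 g /\ weak_partial i u g].

(* A choice of the i-th weak partial derivative, unique almost everywhere when
   u is in H^1. *)
Definition wgrad (R : realType) (i : 'I_3) (u : R * R * R -> R) : R * R * R -> R :=
  xget (fun=> 0) [set g | L2 g /\ weak_partial i u g].

Definition energy (R : realType) (p gamma a : R) (u : R * R * R -> R) : R :=
  2^-1 * \int[leb3 R]_x (\sum_(i < 3) wgrad i u x ^+ 2)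
  - gamma / 4 * fine (\int[leb3 R]_x \int[leb3 R]_y
      (`|u x| ^+ 2 * `|u y| ^+ 2 / enorm3 (x - y))%:E)%E
  - a / p * \int[leb3 R]_x (`|u x| `^ p).

Definition L2_sphere (R : realType) (c : R) : set (R * R * R -> R) :=
  [set u | H1 u /\ \int[leb3 R]_x (`|u x| ^+ 2) = c].

(* T_u S(c), where S(c) is L2_sphere c: the kernel in H^1 of the differential
   v |-> 2 <u, v>_{L^2} of the constraint w |-> ||w||_{L^2}^2. *)
Definition tangent_space (R : realType) (u : R * R * R -> R) : set (R * R * R -> R) :=
  [set v | H1 v /\ \int[leb3 R]_x (u x * v x) = 0].

(* The differential of the restriction of G to S(c) at u is the restriction of
   G'(u) to T_u S(c); for G of class C^1 on H^1, G'(u) v is the derivative of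
   t |-> G (u + t v) at t = 0. *)
Definition critical_point_on_sphere (R : realType) (G : (R * R * R -> R) -> R) (c : R)
    (u : R * R * R -> R) : Prop :=
  L2_sphere c u /\
  forall v : R * R * R -> R, tangent_space u v ->
    is_derive (0 : R) (1 : R) (fun t : R => G (fun x => u x + t * v x)) 0.

(* Main.v *)
(* Suppose u is critical. Stretch space along the first axis near the origin: with
   nu = 1 + t / (1 + (s / r)^2) and Phi' = nu^2, put v (Phi y1, y2, y3) =
   u y / nu y1. Then v has the same mass as u; since Phi expands distances and
   nu >= 1, the Coulomb and the L^p terms do not increase, while the Dirichlet
   integral drops by at least k t with k = ||d_1 u||_2^2 / 8, once r is large; k > 0
   because u <> 0 is square integrable. Since Phi - id is bounded by O(t),
   ||u - v||_2 = O(t), so <u, v> = c + O(t^2) and th v with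
   th = c / <u, v> = 1 + O(t^2) lies in the affine tangent space u + T_u S(c).
   For gamma, a < 0 every term of F is convex along the segment from u to th v, so
   the derivative of F at u in the direction th v - u is at most O(t^2) - k t / 2,
   which is negative for small t. *)
Require Import Defs.
From HB Require Import structures.
From mathcomp Require Import all_boot all_order all_algebra.
From mathcomp Require Import all_classical all_reals all_analysis.
From mathcomp Require Import measurable_realfun ring lra.
Set Implicit Arguments.
Unset Strict Implicit.
Unset Printing Implicit Defensive.
Import Order.TTheory GRing.Theory Num.Theory.
Import numFieldNormedType.Exports.
Local Open Scope classical_set_scope.
Local Open Scope ring_scope.

(** * Smooth functions of one variable *)

(** The dilations s^(3/2) u (s x) would give the same signs, but their velocity 3/2 u + x . grad u
    need not be square integrable for u in H^1: the distance to u need not be O(t), and returning to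
    u + T_u S(c) could cost as much as is gained. Cutting the dilation off bounds the displacement.
    The price is the term nu' u in the first partial derivative, of size t / r, which is why r is
    taken large before t is taken small. Criticality enters only through the value 0 of the
    derivative in one tangent direction; convexity bounds the difference quotients from one side,
    which is enough for a contradiction. The bound ||u - v||_2 = O(t) has to come from weak
    derivatives alone. The stretching is therefore carried over to the test functions, and a du
    Bois-Reymond lemma brings the resulting identity back to u. Convexity of the Coulomb term comes
    from writing 1 / |x - y| as an integral of products of Gaussians. *)

Fixpoint ndiff (R : realType) (n : nat) (f : R -> R) : Prop :=
  if n is m.+1 then
    exists f' : R -> R, (forall x : R, is_derive x 1 f (f' x)) /\ ndiff m f'
  else True.

Definition smooth1 (R : realType) (f : R -> R) : Prop := forall n, ndiff n f.

Section smooth1.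
Context {R : realType}.
Implicit Types f g h : R -> R.

(** Each level [n] of [smooth1] provides a derivative of its own; by uniqueness of derivatives they
    coincide, so one [f'] serves all levels. *)
Lemma smooth1_derive f : smooth1 f ->
  exists f' : R -> R, (forall x : R, is_derive x 1 f (f' x)) /\ smooth1 f'.
Proof.
move=> sf; have [f' [df _]] := sf 1%N; exists f'; split => // n.
have [f'' [df' nf'']] := sf n.+1.
rewrite (_ : f' = f'')//; apply/funext => x.
have h1 := df x; have h2 := df' x.
by rewrite -(@derive_val _ _ _ _ _ _ _ h1) -(@derive_val _ _ _ _ _ _ _ h2).
Qed.

Lemma smooth1_primitive f f' : (forall x : R, is_derive x 1 f (f' x)) ->
  smooth1 f' -> smooth1 f.
Proof. by move=> df sf' [//|n]; exists f'. Qed.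

Lemma ndiffS n f : ndiff n.+1 f -> ndiff n f.
Proof.
elim: n f => [//|n IH] f [f' [df nf']].
by exists f'; split => //; exact: IH.
Qed.

Lemma ndiff_cst n (c : R) : ndiff n (cst c).
Proof.
elim: n c => [//|n IH] c; exists (cst 0); split => [x|]; last exact: IH.
exact: is_derive_cst.
Qed.

Lemma ndiffD n f g : ndiff n f -> ndiff n g -> ndiff n (fun x => f x + g x).
Proof.
elim: n f g => [//|n IH] f g [f' [df nf]] [g' [dg ng]].
exists (fun x => f' x + g' x); split; last exact: IH.
by move=> x; exact: is_deriveD.
Qed.

Lemma ndiffM n f g : ndiff n f -> ndiff n g -> ndiff n (fun x => f x * g x).
Proof.
elim: n f g => [//|n IH] f g nf ng.
have [f' [df nf']] := nf; have [g' [dg ng']] := ng.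
exists (fun x => f x * g' x + g x * f' x); split.
  by move=> x; exact: is_deriveM.
by apply: ndiffD; apply: IH => //; exact: ndiffS.
Qed.

Lemma ndiff_comp n f g : ndiff n f -> ndiff n g -> ndiff n (fun x => f (g x)).
Proof.
elim: n f g => [//|n IH] f g nf ng.
have [f' [df nf']] := nf; have [g' [dg ng']] := ng.
exists (fun x => f' (g x) * g' x); split.
  by move=> x; exact: is_derive1_comp.
by apply: ndiffM => //; apply: IH => //; exact: ndiffS.
Qed.

Lemma ndiffV n f : (forall x, f x != 0) -> ndiff n f ->
  ndiff n (fun x => (f x)^-1).
Proof.
move=> f0; elim: n => [//|n IH] nf; have [f' [df nf']] := nf.
exists (fun x => (-1) * (((f x)^-1 * (f x)^-1) * f' x)); split.
  move=> x; have h := df x.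
  have := is_deriveV (f0 x) h; move=> {}h; apply: is_derive_eq; rewrite /GRing.scale/=.
  by rewrite expr2 invfM mulrA mulN1r mulNr.
apply: ndiffM; first exact: ndiff_cst.
have {}IH := IH (ndiffS nf).
by apply: ndiffM => //; exact: ndiffM.
Qed.

Lemma smooth1_cst (c : R) : smooth1 (fun=> c).
Proof. by move=> n; exact: ndiff_cst. Qed.

Lemma smooth1_id : smooth1 (fun x : R => x).
Proof.
apply: (smooth1_primitive (f' := fun=> 1)); exact: smooth1_cst.
Qed.

Lemma smooth1D f g : smooth1 f -> smooth1 g -> smooth1 (fun x => f x + g x).
Proof. by move=> sf sg n; exact: ndiffD. Qed.

Lemma smooth1M f g : smooth1 f -> smooth1 g -> smooth1 (fun x => f x * g x).
Proof. by move=> sf sg n; exact: ndiffM. Qed.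

Lemma smooth1_comp f g : smooth1 f -> smooth1 g -> smooth1 (fun x => f (g x)).
Proof. by move=> sf sg n; exact: ndiff_comp. Qed.

Lemma smooth1V f : (forall x, f x != 0) -> smooth1 f ->
  smooth1 (fun x => (f x)^-1).
Proof. by move=> f0 sf n; exact: ndiffV. Qed.

Lemma smooth1_continuous f : smooth1 f -> continuous f.
Proof.
move=> sf x; have [f' [df _]] := smooth1_derive sf.
by have := df x => h; apply: differentiable_continuous; apply/derivable1_diffP; exact: ex_derive.
Qed.

Lemma smooth1_measurable f : smooth1 f -> measurable_fun setT f.
Proof. by move=> sf; apply: continuous_measurable_fun; exact: smooth1_continuous. Qed.

End smooth1.

(** * Bump functions and smooth approximations of indicators *)

Section flat_function.
Context {R : realType}.

(* Letting a polynomial in 1/x multiply exp (-1/x) makes the family stable under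
   differentiation. *)
Definition flat (p : {poly R}) (x : R) : R :=
  if 0 < x then p.[x^-1] * expR (- x^-1) else 0.

Lemma expR_ge_expr (n : nat) (y : R) : 0 <= y -> y ^+ n <= n`!%:R * expR y.
Proof.
move=> y0; case: n => [|n].
  by rewrite expr0 fact0 mul1r -expR0 ler_expR.
have := expR_ge1Dxn n y0; rewrite -ler_pdivrMl ?ltr0n ?fact_gt0//.
by rewrite mulrC; apply: le_trans; rewrite lerDr.
Qed.

(** Used at y = 1 / h: the factor y^2 makes [flat p h] of order h^2 near 0, so that its difference
    quotient at 0 tends to 0. *)
Lemma horner_expRN_bounded (p : {poly R}) :
  exists2 C, 0 <= C & forall y, 0 <= y -> `|p.[y]| * y ^+ 2 * expR (- y) <= C.
Proof.
elim/poly_ind: p => [|p c [C C0 hC]].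
  by exists 0 => // y _; rewrite horner0 normr0 !mul0r.
(* The exponent has to be general: removing a factor X from the polynomial raises the power of y by
   one. *)
suff aux : forall (p : {poly R}) n, exists2 C, 0 <= C &
    forall y, 0 <= y -> `|p.[y]| * y ^+ n * expR (- y) <= C by exact: aux.
move=> {p c C C0 hC} p; elim/poly_ind: p => [|p c IH] n.
  by exists 0 => // y _; rewrite horner0 normr0 !mul0r.
have [C C0 hC] := IH n.+1.
exists (C + `|c| * n`!%:R); first by rewrite addr_ge0// mulr_ge0.
move=> y y0; rewrite !hornerE.
apply: (@le_trans _ _ ((`|p.[y]| * y + `|c|) * y ^+ n * expR (- y))).
  rewrite ler_wpM2r ?expR_ge0// ler_wpM2r ?exprn_ge0//.
  by rewrite (le_trans (ler_normD _ _))// normrM (ger0_norm y0).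
rewrite mulrDl mulrDl lerD//.
  by rewrite -(mulrA _ y) -exprS hC.
rewrite -mulrA ler_wpM2l// expRN ler_pdivrMr ?expR_gt0//.
exact: expR_ge_expr.
Qed.

(** With y = 1 / x one has y' = - y^2, so p(y) exp (- y) has derivative y^2 (p(y) - p'(y)) exp (-
    y), again of the form [flat]. *)
Lemma is_derive_flat (p : {poly R}) (x : R) :
  is_derive x 1 (flat p) (flat ('X^2 * (p - p^`())) x).
Proof.
have [x0|x0|->] := ltgtP x 0.
- rewrite {2}/flat ltNge (ltW x0)/=.
  apply: (@near_eq_is_derive _ _ _ (cst 0)).
  near=> y; rewrite /flat ifF//; apply/negbTE; rewrite -leNgt ltW//.
  by near: y; exact: lt_nbhsl.
- rewrite {2}/flat x0/=.
  have near_flat : \near x, p.[x^-1] * expR (- x^-1) = flat p x.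
    near=> y; rewrite /flat ifT//; near: y; exact: lt_nbhsr.
  have dV : is_derive x 1 (fun y => y^-1) (- x ^- 2).
    have xn0 : x != 0 by rewrite gt_eqF.
    have := is_deriveV xn0 (is_derive_id x (1 : R)) => h.
    by apply: is_derive_eq; rewrite /GRing.scale/= mulr1.
  have dN : is_derive x 1 (fun y => - y^-1) (x ^- 2).
    by apply: is_derive_eq; rewrite opprK.
  have d1 := @is_derive1_comp R (horner p) (fun y => y^-1) x _ _ (is_derive_poly p x^-1) dV.
  have d2 := @is_derive1_comp R expR (fun y => - y^-1) x _ _ (is_derive_expR (- x^-1)) dN.
  apply: (near_eq_is_derive near_flat).
  have := is_deriveM d1 d2 => h; apply: is_derive_eq.
  rewrite /GRing.scale/= hornerM hornerXn hornerD hornerN -exprVn; ring.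
- rewrite {2}/flat ltxx; have [C C0 hC] := horner_expRN_bounded p.
  suff h : h^-1 *: (flat p (h *: 1 + 0) - flat p 0) @[h --> 0^'] --> (0 : R).
    by split; [apply/cvg_ex; exists 0|exact/cvg_lim].
  apply/cvgr0Pnorm_le => e e0; near=> h.
  rewrite /flat ltxx subr0 addr0 /GRing.scale/= mulr1.
  case: ifPn => [hp|_]; last by rewrite mulr0 normr0 ltW.
  apply: ltW.
  rewrite !normrM (ger0_norm (expR_ge0 _)) (@ger0_norm _ h^-1) ?invr_ge0 1?ltW//.
  apply: (@le_lt_trans _ _ (C * h)).
    rewrite -ler_pdivrMr//; apply: le_trans (hC h^-1 _); last by rewrite invr_ge0 ltW.
    rewrite le_eqVlt; apply/orP; left; apply/eqP; ring.
  (* [C] may be 0, whereas [C + 1] can be divided by. *)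
  apply: (@le_lt_trans _ _ ((C + 1) * h)).
    by rewrite ler_wpM2r ?ltW// ltrDl.
  rewrite mulrC -ltr_pdivlMr ?ltr_wpDl//.
  have : `|h| < e / (C + 1).
    by near: h; apply: dnbhs0_lt; rewrite divr_gt0// ltr_wpDl.
  by rewrite gtr0_norm.
Unshelve. all: by end_near. Qed.

Lemma smooth1_flat (p : {poly R}) : smooth1 (flat p).
Proof.
move=> n; elim: n p => [//|n IH] p; exists (flat ('X^2 * (p - p^`()))).
by split => // x; exact: is_derive_flat.
Qed.

End flat_function.

Section bump.
Context {R : realType}.

Definition bump (a b x : R) : R := flat 1 (x - a) * flat 1 (b - x).

Lemma flat1_ge0 (x : R) : 0 <= flat 1 x.
Proof. by rewrite /flat; case: ifP => // _; rewrite !hornerE expR_ge0. Qed.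

Lemma flat1_gt0 (x : R) : (0 < flat 1 x) = (0 < x).
Proof. by rewrite /flat; case: ifP => [_|_]; rewrite ?ltxx// !hornerE expR_gt0. Qed.

Lemma smooth1_bump (a b : R) : smooth1 (bump a b).
Proof.
apply: smooth1M; apply: (smooth1_comp (smooth1_flat 1)).
  by apply: smooth1D; [exact: smooth1_id|exact: smooth1_cst].
apply: (@smooth1D R (fun=> b) (fun x => - x)); first exact: smooth1_cst.
rewrite (_ : (fun x : R => - x) = (fun x => (-1) * x)); last by apply/funext => x; rewrite mulN1r.
by apply: smooth1M; [exact: smooth1_cst|exact: smooth1_id].
Qed.

Lemma bump_ge0 (a b x : R) : 0 <= bump a b x.
Proof. by rewrite mulr_ge0// flat1_ge0. Qed.

Lemma bump_gt0 (a b x : R) : (0 < bump a b x) = (a < x < b).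
Proof.
rewrite /bump; apply/idP/idP => [h|/andP[ax xb]]; last first.
  by rewrite mulr_gt0// flat1_gt0 subr_gt0.
have := flat1_ge0 (x - a); rewrite le_eqVlt => /orP[/eqP e|].
  by rewrite -e mul0r ltxx in h.
rewrite flat1_gt0 subr_gt0 => ->/=.
have := flat1_ge0 (b - x); rewrite le_eqVlt => /orP[/eqP e|].
  by rewrite -e mulr0 ltxx in h.
by rewrite flat1_gt0 subr_gt0.
Qed.

(** A smooth approximation of the indicator of ]a, b[ with values in [0, 1]: as n grows it tends to
    1 where [bump a b] is positive and it is 0 elsewhere, as dominated convergence requires. *)
Definition bump_approx (a b : R) (n : nat) (x : R) : R :=
  bump a b x / (bump a b x + n.+1%:R^-1).

Lemma bump_den_gt0 (a b : R) n x : 0 < bump a b x + n.+1%:R^-1.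
Proof. by rewrite ltr_wpDl ?bump_ge0// invr_gt0. Qed.

Lemma smooth1_bump_approx (a b : R) n : smooth1 (bump_approx a b n).
Proof.
apply: smooth1M; first exact: smooth1_bump.
apply: smooth1V; first by move=> x; rewrite gt_eqF// bump_den_gt0.
by apply: smooth1D; [exact: smooth1_bump|exact: smooth1_cst].
Qed.

Lemma bump_approx_ge0 (a b : R) n x : 0 <= bump_approx a b n x.
Proof. by rewrite divr_ge0 ?bump_ge0// ltW// bump_den_gt0. Qed.

Lemma bump_approx_le1 (a b : R) n x : `|bump_approx a b n x| <= 1.
Proof.
rewrite ger0_norm ?bump_approx_ge0//.
by rewrite ler_pdivrMr ?bump_den_gt0// mul1r lerDl invr_ge0.
Qed.

Lemma bump_approx_cvg (a b x : R) :
  bump_approx a b n x @[n --> \oo] --> (\1_(`]a, b[%classic) x : R).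
Proof.
rewrite indicE; have [h|h] := boolP (x \in `]a, b[%classic).
  have bx : 0 < bump a b x.
    by move: h; rewrite inE/= in_itv/= bump_gt0.
  have -> : (true%:R : R) = bump a b x / (bump a b x + 0).
    by rewrite addr0 divff// gt_eqF.
  apply: cvgM; first exact: cvg_cst.
  apply: cvgV; first by rewrite addr0 gt_eqF.
  apply: cvgD; first exact: cvg_cst.
  exact: cvg_harmonic.
have -> : (bump_approx a b)^~ x = cst 0; last exact: cvg_cst.
apply/funext => n; rewrite /bump_approx.
have -> : bump a b x = 0; last by rewrite mul0r.
apply/eqP; rewrite eq_le bump_ge0 andbT leNgt bump_gt0.
by move: h; rewrite notin_setE/= in_itv/= => /negP.
Qed.

End bump.

(** * Smooth functions of three variables *)

Section smooth3.
Context {R : realType}.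
Implicit Types f g : R * R * R -> R.

(** [smooth] quantifies over all iterated partial derivatives; an invariant stable under [partial]
    replaces the induction on their order. *)
Lemma smooth_coind (P : (R * R * R -> R) -> Prop) :
  (forall f, P f -> continuous f) ->
  (forall f i x, P f -> derivable f x (e3 R i)) ->
  (forall f i, P f -> P (partial i f)) ->
  forall f, P f -> smooth f.
Proof.
move=> Pc Pd Pp f Pf s; have {}Pf : P (foldr (@partial R) f s).
  by elim: s => [//|i s IH] /=; exact: Pp.
by split; [exact: Pc|move=> i x; exact: Pd].
Qed.

Lemma smooth_partial f i : smooth f -> smooth (partial i f).
Proof. by move=> sf s; have := sf (rcons s i); rewrite -cats1 foldr_cat. Qed.

Lemma smooth_continuous f : smooth f -> continuous f.
Proof. by move=> sf; have [] := sf [::]. Qed.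

Lemma smooth_derivable f i x : smooth f -> derivable f x (e3 R i).
Proof. by move=> sf; have [_] := sf [::]; exact. Qed.

Lemma smooth_is_derive f i x : smooth f ->
  is_derive x (e3 R i) f (partial i f x).
Proof. by move=> sf; apply: DeriveDef => //; exact: smooth_derivable. Qed.

Definition slice (i : 'I_3) (x : R * R * R) (s : R) : R * R * R :=
  if i == 0 :> nat then (s, x.1.2, x.2)
  else if i == 1 :> nat then (x.1.1, s, x.2) else (x.1.1, x.1.2, s).

Definition coord (i : 'I_3) (x : R * R * R) : R :=
  if i == 0 :> nat then x.1.1 else if i == 1 :> nat then x.1.2 else x.2.

Lemma slice_coord i x : slice i x (coord i x) = x.
Proof. by case: x => -[x y] z; case: i => -[|[|[|//]]]. Qed.

Lemma e3_slice i x h : h *: e3 R i + x = slice i x (h + coord i x).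
Proof.
case: x => -[x y] z; rewrite /slice /coord /e3.
case: i => -[|[|[|//]]] /= _.
all: apply: injective_projections => /=; try (apply: injective_projections => /=);
  rewrite /GRing.scale/= ?mulr1 ?mulr0 ?add0r//.
Qed.

(** The two difference quotients are the same function of h, so partial derivatives inherit the
    one-variable rules. *)
Lemma is_derive_slice f i x (d : R) :
  is_derive x (e3 R i) f d <->
  is_derive (coord i x) (1 : R) (fun s => f (slice i x s)) d.
Proof.
have E : (fun h : R => h^-1 *: (f (h *: e3 R i + x) - f x)) =
   (fun h => h^-1 *: (f (slice i x (h *: 1 + coord i x)) - f (slice i x (coord i x)))).
  by apply/funext => h; rewrite e3_slice slice_coord /GRing.scale/= mulr1.
split=> -[h1 h2]; split.
- by move: h1; rewrite /derivable E.
- by move: h2; rewrite /derive E.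
- by rewrite /derivable E.
- by rewrite /derive E.
Qed.

Lemma continuous_pair3 (T : topologicalType) (a b c : T -> R) :
  continuous a -> continuous b -> continuous c ->
  continuous (fun x => (a x, b x, c x)).
Proof.
move=> ca cb cc x.
have h : (fun x => (a x, b x)) @ x --> (a x, b x).
  exact: (@cvg_pair _ _ _ _ (nbhs (a x)) (nbhs (b x)) _ _ _ a b (ca x) (cb x)).
exact: (@cvg_pair _ _ _ _ (nbhs (a x, b x)) (nbhs (c x)) _ _ _ (fun x => (a x, b x)) c h (cc x)).
Qed.

Let c0 : continuous (fun x : R * R * R => x.1.1).
Proof.
by move=> x; apply: (@continuous_comp (R * R * R)%type (R * R)%type R fst fst); exact: cvg_fst.
Qed.

Let c1 : continuous (fun x : R * R * R => x.1.2).
Proof.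
move=> x; apply: (@continuous_comp (R * R * R)%type (R * R)%type R fst snd).
  exact: cvg_fst.
exact: cvg_snd.
Qed.

Let c2 : continuous (fun x : R * R * R => x.2).
Proof. by move=> x; exact: cvg_snd. Qed.

Lemma continuous_coord i : continuous (coord i).
Proof. by case: i => -[|[|[|//]]] ?; [exact: c0|exact: c1|exact: c2]. Qed.

(** Tensor products are enough as test functions because boxes generate the sigma-algebra, and they
    can be integrated or differentiated in one coordinate alone. *)
Definition prod3 (b : 'I_3 -> R -> R) (x : R * R * R) : R :=
  \prod_(i < 3) b i (coord i x).

Lemma continuous_prod3 b : (forall i, smooth1 (b i)) -> continuous (prod3 b).
Proof.
move=> sb x; rewrite /prod3.
rewrite (_ : (fun x0 : R * R * R => _) = \prod_(i < 3) (fun y => b i (coord i y))); last first.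
  by apply/funext => y; rewrite fct_prodE.
elim/big_ind : _ => [|f g|i _].
- exact: cvg_cst.
- by move=> cf cg; exact: cvgM.
- apply: (@continuous_comp _ _ _ (coord i) (b i)); first exact: continuous_coord.
  exact: smooth1_continuous.
Qed.

Lemma prod3_slice (b : 'I_3 -> R -> R) i x s :
  prod3 b (slice i x s) = (\prod_(j < 3 | j != i) b j (coord j x)) * b i s.
Proof.
rewrite /prod3 (bigD1 i)//= mulrC; congr (_ * _).
  apply: eq_bigr => j /eqP ji; congr (b j _).
  move: i j ji => -[[|[|[|//]]] ?] -[[|[|[|//]]] ?]//=.
  - by move=> h; exfalso; apply: h; exact: val_inj.
  - by move=> h; exfalso; apply: h; exact: val_inj.
  - by move=> h; exfalso; apply: h; exact: val_inj.
by congr (b i _); move: i => -[[|[|[|//]]] ?].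
Qed.

Definition upd3 (b : 'I_3 -> R -> R) (i : 'I_3) (d : R -> R) : 'I_3 -> R -> R :=
  fun j => if j == i then d else b j.

Lemma prod3_upd b i d x :
  prod3 (upd3 b i d) x = (\prod_(j < 3 | j != i) b j (coord j x)) * d (coord i x).
Proof.
rewrite -{1}(slice_coord i x) prod3_slice /upd3 eqxx; congr (_ * _).
by apply: eq_bigr => j /negbTE ->.
Qed.

Lemma is_derive_prod3 b i (d : R -> R) x :
  (forall s : R, is_derive s (1 : R) (b i) (d s)) ->
  is_derive x (e3 R i) (prod3 b) (prod3 (upd3 b i d) x).
Proof.
move=> db; apply/is_derive_slice; rewrite prod3_upd.
under eq_fun do rewrite prod3_slice.
by have h := db (coord i x); exact: is_deriveZ.
Qed.

Lemma smooth_prod3 b : (forall i, smooth1 (b i)) -> smooth (prod3 b).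
Proof.
move=> sb; apply: (smooth_coind (P := fun f => exists2 b, forall i, smooth1 (b i) & f = prod3 b)) => [f|f i x|f i|].
- by move=> [{}b {}sb ->]; exact: continuous_prod3.
- move=> [{}b {}sb ->]; have [d [db _]] := smooth1_derive (sb i).
  by have := is_derive_prod3 x db => -[].
- move=> [{}b {}sb ->]; have [d [db sd]] := smooth1_derive (sb i).
  exists (upd3 b i d); first by move=> j; rewrite /upd3; case: eqP.
  apply/funext => x; rewrite /partial.
  by have := is_derive_prod3 x db => -[].
- by exists b.
Qed.

(** * Composition with a stretching of the first axis *)

Section stretch.
Variables (Phi dPhi : R -> R).
Hypothesis sPhi : smooth1 Phi.
Hypothesis dPhiE : forall s : R, is_derive s (1 : R) Phi (dPhi s).
Hypothesis sdPhi : smooth1 dPhi.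

Definition stretch (x : R * R * R) : R * R * R := (Phi x.1.1, x.1.2, x.2).

Lemma continuous_stretch : continuous stretch.
Proof.
apply: continuous_pair3 => // x.
by apply: (@continuous_comp _ _ _ (fun x : R * R * R => x.1.1) Phi); [exact: c0|exact: smooth1_continuous].
Qed.

(** The chain-rule factor of [stretch] in direction [i]. *)
Let wt i := if (i : 'I_3) == 0 :> nat then dPhi else fun=> 1.

Lemma is_derive_stretch (m dm : R -> R) f i x :
  (forall s : R, is_derive s (1 : R) m (dm s)) -> smooth f ->
  is_derive x (e3 R i) (fun y => m y.1.1 * f (stretch y))
    ((if i == 0 :> nat then dm x.1.1 * f (stretch x) else 0) +
     m x.1.1 * wt i x.1.1 * partial i f (stretch x)).
Proof.
move=> mdm sf; apply/is_derive_slice.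
have := smooth_is_derive i (stretch x) sf => /is_derive_slice.
rewrite /wt /slice /coord; case: ifP => i0 /=.
  move=> df.
  have h1 := @is_derive1_comp R (fun s => f (s, x.1.2, x.2)) Phi x.1.1 _ _ df (dPhiE x.1.1).
  have h2 := mdm x.1.1.
  have h3 := is_deriveM h2 h1; apply: is_derive_eq.
  by rewrite /GRing.scale/= /comp/=; ring.
case: ifP => i1 df; rewrite add0r mulr1.
  exact: (is_deriveZ (f := fun s => f (Phi x.1.1, s, x.2)) (m x.1.1)).
exact: (is_deriveZ (f := fun s => f (Phi x.1.1, x.1.2, s)) (m x.1.1)).
Qed.

(** Differentiating m (f o stretch) yields a sum of two functions of this shape; closing under
    addition gives the invariant for [smooth_coind]. *)
Inductive stretch_span : (R * R * R -> R) -> Prop :=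
| stretch_mul m f : smooth1 m -> smooth f ->
    stretch_span (fun y => m y.1.1 * f (stretch y))
| stretch_add g h : stretch_span g -> stretch_span h ->
    stretch_span (fun y => g y + h y).

Let swt i : smooth1 (wt i).
Proof. by rewrite /wt; case: ifP => _ //; exact: smooth1_cst. Qed.

Let span_derive f i : stretch_span f ->
  exists2 f', (forall x, is_derive x (e3 R i) f (f' x)) & stretch_span f'.
Proof.
elim => {f} [m f sm sf|g h _ [g' dg sg] _ [h' dh sh]]; last first.
  by exists (fun x => g' x + h' x); [move=> x; exact: is_deriveD|exact: stretch_add].
have [dm [mdm sdm]] := smooth1_derive sm.
eexists; first by move=> x; exact: (is_derive_stretch i x mdm sf).
apply: (@stretch_add (fun x => if i == 0 :> nat then dm x.1.1 * f (stretch x) else 0)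
  (fun x => m x.1.1 * wt i x.1.1 * partial i f (stretch x))).
  case: (i == 0 :> nat); first exact: (stretch_mul sdm sf).
  rewrite (_ : (fun=> 0) = (fun y : R * R * R => (fun=> 0) y.1.1 * f (stretch y))).
    exact: (stretch_mul (@smooth1_cst R 0) sf).
  by apply/funext => y; rewrite mul0r.
apply: (@stretch_mul (fun s => m s * wt i s)); first exact: smooth1M.
exact: smooth_partial.
Qed.

Lemma smooth_stretch m f : smooth1 m -> smooth f ->
  smooth (fun y => m y.1.1 * f (stretch y)).
Proof.
move=> sm sf; apply: (smooth_coind (P := stretch_span)) => [g|g i x|g i|]; last exact: (stretch_mul sm sf).
- elim => {g} [{sm sf f}m f sm sf|g h _ cg _ ch] x.
    apply: cvgM; last first.
      by apply: (@continuous_comp _ _ _ stretch f); [exact: continuous_stretch|exact: smooth_continuous].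
    by apply: (@continuous_comp _ _ _ (fun x : R * R * R => x.1.1) m); [exact: c0|exact: smooth1_continuous].
  by apply: cvgD; [exact: cg|exact: ch].
- by move/(span_derive i) => [g' /(_ x)[]].
- move=> /(span_derive i)[g' dg sg']; rewrite (_ : partial i g = g')//.
  by apply/funext => x; have [] := dg x.
Qed.

Lemma partial_stretch (m dm : R -> R) f i x :
  (forall s : R, is_derive s (1 : R) m (dm s)) -> smooth f ->
  partial i (fun y => m y.1.1 * f (stretch y)) x =
    (if i == 0 :> nat then dm x.1.1 * f (stretch x) else 0) +
     m x.1.1 * wt i x.1.1 * partial i f (stretch x).
Proof.
move=> mdm sf; have h := is_derive_stretch i x mdm sf.
exact: (@derive_val _ _ _ _ _ _ _ h).
Qed.

End stretch.

Definition box (N : R) : set (R * R * R) :=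
  (`[- N, N] `*` `[- N, N]) `*` `[- N, N].

Lemma compact_box N : compact (box N).
Proof.
apply: compact_setX; last exact: segment_compact.
by apply: compact_setX; exact: segment_compact.
Qed.

Lemma compact_subset_box (K : set (R * R * R)) : compact K ->
  exists2 N, 0 <= N & K `<=` box N.
Proof.
move=> cK.
have B i : exists M, forall x, K x -> `|coord i x| <= M.
  have : compact (coord i @` K).
    apply: continuous_compact => //; apply: continuous_subspaceT.
    exact: continuous_coord.
  move=> /compact_bounded[M [_ MK]]; exists (M + 1) => x Kx.
  by apply: (MK (M + 1)); [rewrite ltrDl|exists x].
have [M0 h0] := B ord0; have [M1 h1] := B (Ordinal (isT : 1 < 3)%N).
have [M2 h2] := B (Ordinal (isT : 2 < 3)%N).
exists (`|M0| + `|M1| + `|M2|); first by rewrite !addr_ge0.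
move=> x Kx; have := h0 _ Kx; have := h1 _ Kx; have := h2 _ Kx.
rewrite /coord/= => k2 k1 k0.
have := ler_norm M0; have := ler_norm M1; have := ler_norm M2.
have := normr_ge0 M0; have := normr_ge0 M1; have := normr_ge0 M2.
move=> a0 a1 a2 a3 a4 a5.
split; first split; rewrite /= in_itv/= -ler_norml; lra.
Qed.

(** Vanishing outside a box is easier to follow through a stretching than compactness of the closure
    of the support. *)
Lemma test_functionP f : test_function f <->
  smooth f /\ exists2 N, 0 <= N & forall x, ~ box N x -> f x = 0.
Proof.
split=> -[sf]; last first.
  move=> [N N0 fN]; split => //; apply: (subclosed_compact _ (@compact_box N)).
    exact: closed_closure.
  rewrite closureE; apply: smallest_sub.
    apply: compact_closed; last exact: compact_box.
    exact: norm_hausdorff.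
  move=> x /=; apply: contraPP => /fN ->; by rewrite eqxx.
move=> /compact_subset_box[N N0 fN]; split => //; exists N => // x nx.
apply/eqP/negPn/negP => fx; apply: nx; apply: fN; exact: subset_closure.
Qed.

End smooth3.

(** * Measurability and change of variables *)

Notation T3 R := (measurableTypeR R * measurableTypeR R * measurableTypeR R)%type.

(** A preimage is the countable union of the fibres of [g] over those [i] whose value [F i] is
    allowed. *)
Lemma measurable_fun_countable d d' (T : measurableType d) (S : measurableType d')
    (I : countType) (g : T -> I) (F : I -> S) :
  (forall i, measurable (g @^-1` [set i])) -> measurable_fun setT (fun x => F (g x)).
Proof.
move=> mg _ B mB; rewrite setTI.
have -> : (fun x => F (g x)) @^-1` B =
   \bigcup_n (if unpickle n is Some i then
     (if F i \in B then g @^-1` [set i] else set0) else set0).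
  apply/seteqP; split => x /=.
    move=> h; exists (pickle (g x)) => //; rewrite pickleK /= ifT//.
    exact/mem_set.
  by move=> [n _]; case: (unpickle n) => [i|//]; case: ifPn => // /set_mem h ->.
apply: bigcupT_measurable => n; case: (unpickle n) => [i|//].
by case: ifP.
Qed.

(* T3 R carries the product of the one-dimensional Borel sigma-algebras; a
   continuous function is measurable for it as the pointwise limit of its values
   at grid points. *)
Section continuous_measurable3.
Context {R : realType}.

Let rho n (s : R) : int := Num.floor (n.+1%:R * s).

Let mrho n k : measurable (rho n @^-1` [set k] : set (measurableTypeR R)).
Proof.
rewrite (_ : _ @^-1` _ = `[k%:~R / n.+1%:R, (k + 1)%:~R / n.+1%:R[%classic)//.
apply/seteqP; split => s /=.
  move=> <-; rewrite in_itv/= ler_pdivrMr// ltr_pdivlMr// mulrC.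
  by rewrite floor_itv.
rewrite in_itv/= ler_pdivrMr// ltr_pdivlMr// mulrC => h; exact: floor_def.
Qed.

Let rho_cvg (s : R) : (rho n s)%:~R / n.+1%:R @[n --> \oo] --> s.
Proof.
apply: (@squeeze_cvgr _ _ _ _ (fun n => s - n.+1%:R^-1) (fun=> s)).
- near=> n; apply/andP; split.
    rewrite ler_pdivlMr// mulrBl mulVf ?pnatr_eq0// lerBlDr mulrC.
    have := floor_itv (n.+1%:R * s); rewrite -/(rho n s) => /andP[_].
    by rewrite intrD => /ltW.
  by rewrite ler_pdivrMr// mulrC; have := floor_itv (n.+1%:R * s); case/andP.
- rewrite -[X in _ --> X]subr0; apply: cvgB; first exact: cvg_cst.
  exact: cvg_harmonic.
- exact: cvg_cst.
Unshelve. all: by end_near. Qed.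

Lemma continuous_measurable3 (f : R * R * R -> R) : continuous f ->
  measurable_fun [set: T3 R] f.
Proof.
move=> cf; pose h n (x : R * R * R) := f ((rho n x.1.1)%:~R / n.+1%:R,
  (rho n x.1.2)%:~R / n.+1%:R, (rho n x.2)%:~R / n.+1%:R).
apply: (@measurable_fun_cvg _ (T3 R) R setT h) => [n|x _].
  apply: (@measurable_fun_countable _ _ (T3 R) (measurableTypeR R) (int * int * int)%type
    (fun x => (rho n x.1.1, rho n x.1.2, rho n x.2))
    (fun k => f (k.1.1%:~R / n.+1%:R, k.1.2%:~R / n.+1%:R, k.2%:~R / n.+1%:R))).
  move=> [[i j] k].
  rewrite (_ : _ @^-1` _ = ((rho n @^-1` [set i]) `*` (rho n @^-1` [set j])) `*` (rho n @^-1` [set k])).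
    by apply: measurableX => //; exact: measurableX.
  apply/seteqP; split => -[[x y] z] /=; first by case=> <- <- <-.
  by move=> [[-> ->] ->].
apply: (@cvg_comp _ _ _ (fun n => ((rho n x.1.1)%:~R / n.+1%:R,
  (rho n x.1.2)%:~R / n.+1%:R, (rho n x.2)%:~R / n.+1%:R)) f _ (nbhs x)); last exact: cf.
case: x => -[x y] z /=.
have h1 : ((rho n x)%:~R / n.+1%:R, (rho n y)%:~R / n.+1%:R) @[n --> \oo] --> (x, y).
  exact: (@cvg_pair _ _ _ _ (nbhs x) (nbhs y) _ _ _ _ _ (@rho_cvg x) (@rho_cvg y)).
exact: (@cvg_pair _ _ _ _ (nbhs (x, y)) (nbhs z) _ _ _ _ _ h1 (@rho_cvg z)).
Qed.

End continuous_measurable3.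

(** The proofs [mw] and [w0] are arguments so that the measure structure below can be declared on
    this name. *)
Definition mdensity d (T : measurableType d) (R : realType)
    (mu : {measure set T -> \bar R}) (w : T -> R)
    (mw : measurable_fun setT w) (w0 : forall x, 0 <= w x) (A : set T) : \bar R :=
  (\int[mu]_(x in A) (w x)%:E)%E.

Section density.
Local Open Scope ereal_scope.
Context d (T : measurableType d) (R : realType).
Variables (mu nu : {measure set T -> \bar R}) (w : T -> R).
Hypothesis mw : measurable_fun setT w.
Hypothesis w0 : forall x, (0 <= w x)%R.

Local Notation nu' := (mdensity mu mw w0).

Let mdensity0 : nu' set0 = 0.
Proof. by rewrite /mdensity integral_set0. Qed.

Let mdensity_ge0 A : 0 <= nu' A.
Proof. by apply: integral_ge0 => x _; rewrite lee_fin. Qed.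

Let mdensity_sigma_additive : semi_sigma_additive nu'.
Proof.
move=> F mF tF mUF; rewrite /mdensity ge0_integral_bigcup//; last 2 first.
- by apply/measurable_EFinP; exact: measurable_funTS.
- by move=> x _; rewrite lee_fin.
by apply: is_cvg_ereal_nneg_natsum_cond => n _ _; exact: mdensity_ge0.
Qed.

HB.instance Definition _ := isMeasure.Build _ _ _ nu'
  mdensity0 mdensity_ge0 mdensity_sigma_additive.

Import HBNNSimple.

Hypothesis nuE : forall A, measurable A -> nu A = nu' A.

(** Indicators satisfy it by [nuE], simple functions by linearity, and the rest by monotone
    convergence. *)
Lemma ge0_integral_density (f : T -> \bar R) : (forall x, 0 <= f x) ->
  measurable_fun setT f ->
  \int[nu]_x f x = \int[mu]_x (f x * (w x)%:E).
Proof.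
move=> f0 mf; pose h := nnsfun_approx measurableT mf; pose E := [set: T].
have -> : \int[nu]_x f x = limn (fun n => \int[nu]_x (h n x)%:E).
  have fE x : f x = limn (fun n => (h n x)%:E).
    by apply/esym/cvg_lim => //; exact: cvg_nnsfun_approx.
  under eq_integral do rewrite fE.
  apply: monotone_convergence => //.
  - by move=> n; apply/measurable_EFinP.
  - by move=> n x Ex //=; rewrite lee_fin.
  - by move=> x Ex a b ab; rewrite lee_fin; exact/lefP/nd_nnsfun_approx.
have -> : \int[mu]_x (f x * (w x)%:E) =
    limn (fun n => \int[mu]_x ((h n x)%:E * (w x)%:E)).
  have fg x : f x * (w x)%:E = limn (fun n => (h n x)%:E * (w x)%:E).
    apply/esym/cvg_lim => //; apply: cvgeZr => //; exact: cvg_nnsfun_approx.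
  under eq_integral do rewrite fg.
  apply: monotone_convergence => [//| | |].
  - by move=> n; apply/emeasurable_funM; apply/measurable_EFinP.
  - by move=> n x Ex /=; rewrite mule_ge0 ?lee_fin.
  - by move=> x Ex a b ab/=; rewrite lee_wpmul2r ?lee_fin//; exact/lefP/nd_nnsfun_approx.
apply: congr_lim; apply/funext => n.
transitivity (\int[nu]_x
   (\sum_(y \in range (h n)) (y * \1_(h n @^-1` [set y]) x)%:E)).
  by apply: eq_integral => t tE; rewrite /= fimfunE -fsumEFin.
have indich m r : measurable_fun setT (fun x => (r * \1_(h m @^-1` [set r]) x)%:E).
  by apply: (measurable_comp measurableT) => //; exact: measurable_funM.
rewrite ge0_integral_fsum//; last by move=> m y Ey; exact: nnfun_muleindic_ge0.
transitivity (\int[mu]_x (\sum_(y \in range (h n))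
    (y * \1_(h n @^-1` [set y]) x)%:E * (w x)%:E)); last first.
  apply: eq_integral => x xE.
  rewrite -ge0_mule_fsuml => [|y]; last exact: nnfun_muleindic_ge0.
  by rewrite fsumEFin // -(fimfunE _ x).
rewrite ge0_integral_fsum//; last 2 first.
  - by move=> y; apply: emeasurable_funM => //; exact/measurable_EFinP.
  - move=> m y Ey; apply: mule_ge0; last by rewrite lee_fin.
    exact: nnfun_muleindic_ge0.
apply: eq_fsbigr => r rhn.
under [LHS]eq_integral do rewrite EFinM.
rewrite integralZl_indic_nnsfun => //.
under [RHS]eq_integral do rewrite EFinM -muleA.
rewrite ge0_integralZl//.
- congr (_ * _); rewrite integral_indic// setIT nuE// /mdensity integral_mkcond.
  apply: eq_integral => x _; rewrite patchE indicE.
  by case: ifPn => _; rewrite ?mul1e ?mul0e.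
- by apply: emeasurable_funM; exact/measurable_EFinP.
- by move=> t Et; rewrite mule_ge0 ?lee_fin.
- by move: rhn; rewrite inE => -[t _ <-]; rewrite lee_fin.
Qed.

End density.

(** * Sigma-finite products and Tonelli in three variables *)

Section product_sigma_finite.
Local Open Scope ereal_scope.
Context d1 d2 (T1 : measurableType d1) (T2 : measurableType d2) (R : realType).
Variable m1 : {sigma_finite_measure set T1 -> \bar R}.
Variable m2 : {sigma_finite_measure set T2 -> \bar R}.

Lemma product_measure_sigma_finite : sigma_finite setT (m1 \x m2).
Proof.
have [F TF Foo] := sigma_finiteT m1; have [G TG Goo] := sigma_finiteT m2.
pose H n := if unpickle n is Some ij then F ij.1 `*` G ij.2 else set0.
exists H => [|n].
  apply/esym; rewrite -subTset => -[x y] _.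
  have [i _ Fx] : (\bigcup_i F i) x by rewrite -TF.
  have [j _ Gy] : (\bigcup_j G j) y by rewrite -TG.
  by exists (pickle (i, j)) => //; rewrite /H pickleK.
rewrite /H; case: (unpickle n) => [[i j]|]; last by rewrite measure0.
have [mF Fi] := Foo i; have [mG Gj] := Goo j; split; first exact: measurableX.
by rewrite product_measure1E// lte_mul_pinfty// ge0_fin_numE.
Qed.


(** A name on which sigma-finiteness can be declared, so that products can be iterated. *)
Definition sfprod : set (T1 * T2) -> \bar R := (m1 \x m2).

HB.instance Definition _ := Measure.on sfprod.

HB.instance Definition _ := Measure_isSigmaFinite.Build _ _ _ sfprod
  product_measure_sigma_finite.

End product_sigma_finite.

Section leb3_integral.
Context {R : realType}.
Local Notation mu := (@lebesgue_measure R).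
Local Open Scope ereal_scope.

Definition leb2 : {sigma_finite_measure set (measurableTypeR R * measurableTypeR R)%type -> \bar R} :=
  sfprod mu mu.

(** Convertible with [leb3 R], but carrying the sigma-finiteness that Tonelli asks for. *)
Definition sfleb3 : {sigma_finite_measure set (T3 R) -> \bar R} := sfprod leb2 mu.

Lemma ge0_integral_leb3 (f : T3 R -> \bar R) : (forall x, 0 <= f x) ->
  measurable_fun setT f ->
  \int[leb3 R]_x f x = \int[mu]_z \int[mu]_y \int[mu]_x f (x, y, z).
Proof.
move=> f0 mf.
transitivity (\int[mu]_z \int[leb2]_xy f (xy, z)).
  exact: (@fubini_tonelli2 _ _ _ _ R leb2 mu f mf f0).
apply: eq_integral => z _.
apply: (@fubini_tonelli2 _ _ _ _ R mu mu (fun xy => f (xy, z))) => [|x]; last exact: f0.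
by apply: measurableT_comp mf _; exact: measurable_pair2.
Qed.

End leb3_integral.

(** * Change of variables along the first axis *)

Section change_of_variables.
Context {R : realType}.
Local Notation mu := (@lebesgue_measure R).
Variables (Phi phi dPhi : R -> R).
Hypothesis PhiD : forall x : R, is_derive x (1 : R) Phi (dPhi x).
Hypothesis dPhi_continuous : continuous dPhi.
Hypothesis dPhi_ge0 : forall x, 0 <= dPhi x.
Hypothesis Phi_mono : {mono Phi : x y / x <= y}.
Hypothesis PhiK : cancel Phi phi.
Hypothesis phiK : cancel phi Phi.

Let phi_mono : {mono phi : x y / x <= y}.
Proof. by move=> x y; rewrite -Phi_mono !phiK. Qed.

Let measurable_phi : measurable_fun [set: measurableTypeR R] (phi : R -> measurableTypeR R).
Proof. by apply: nondecreasing_measurable => // x y xy; rewrite phi_mono. Qed.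

Let measurable_dPhi : measurable_fun [set: measurableTypeR R] dPhi.
Proof. exact: continuous_measurable_fun. Qed.

Let measurable_Phi : measurable_fun [set: measurableTypeR R] (Phi : R -> measurableTypeR R).
Proof. by apply: nondecreasing_measurable => // x y xy; rewrite Phi_mono. Qed.

Local Open Scope ereal_scope.

Let phi1 : measurableTypeR R -> measurableTypeR R := phi.

Let nu : {measure set (measurableTypeR R) -> \bar R}.
Proof. by refine (pushforward mu phi1); exact: measurable_phi. Defined.

(** Both measures give ]a, b] the mass Phi b - Phi a, one by monotonicity of [Phi], the other by the
    fundamental theorem of calculus; these intervals form a generating pi-system. *)
Let nuE (A : set (measurableTypeR R)) : measurable A ->
  nu A = mdensity mu measurable_dPhi dPhi_ge0 A.
Proof.
move=> mA.
apply: (@measure_unique _ R (measurableTypeR R) (@ocitv R) (fun n => `](- n%:R)%R, n%:R]%classic)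
   _ _ _ _ nu (mdensity mu measurable_dPhi dPhi_ge0)) => //.
- exact: ocitvI.
- by move=> n; exists ((- n%:R)%R, n%:R).
- rewrite -subTset => x _; exists (Num.bound `|x|%R) => //=.
  have := archi_boundP (normr_ge0 x); rewrite ltr_norml in_itv/= => /andP[-> h].
  exact: ltW.
- move=> X /ocitvP[->|[[a b]/= ab ->]]; first by rewrite !measure0.
  rewrite /nu/= /pushforward (_ : phi @^-1` _ = `](Phi a), (Phi b)]%classic); last first.
    apply/seteqP; split => x /=; rewrite !in_itv/=.
      by move=> /andP[h1 h2]; rewrite -(phiK x) !Phi_mono (leW_mono Phi_mono) h1.
    by rewrite -{1 2}(phiK x) Phi_mono (leW_mono Phi_mono).
  rewrite lebesgue_measure_itv/= lte_fin (leW_mono Phi_mono) ab.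
  rewrite /mdensity integral_itv_obnd_cbnd; last first.
    by apply/measurable_EFinP; apply: measurable_funTS.
  rewrite (@continuous_FTC2 _ dPhi Phi)//.
  + exact: continuous_subspaceT.
  + have cPhi : continuous Phi.
      move=> x; apply: differentiable_continuous; apply/derivable1_diffP.
      by have [] := PhiD x.
    split => [x _||]; first by have [] := PhiD x.
    * by apply: cvg_at_right_filter; exact: cPhi.
    * by apply: cvg_at_left_filter; exact: cPhi.
  + by move=> x _; rewrite derive1E; have [] := PhiD x.
- move=> n; rewrite /nu/= /pushforward (_ : phi @^-1` _ = `](Phi (- n%:R)%R), (Phi n%:R)]%classic); last first.
    apply/seteqP; split => x /=; rewrite !in_itv/=.
      by move=> /andP[h1 h2]; rewrite -(phiK x) !Phi_mono (leW_mono Phi_mono) h1.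
    by rewrite -{1 2}(phiK x) Phi_mono (leW_mono Phi_mono).
  rewrite lebesgue_measure_itv/=; case: ifPn => _; last by rewrite ltry.
  by rewrite -EFinB ltry.
Qed.

Lemma ge0_integral_subst (f : R -> \bar R) : (forall x, 0 <= f x) ->
  measurable_fun [set: measurableTypeR R] f ->
  \int[mu]_x f (phi x) = \int[mu]_y (f y * (dPhi y)%:E).
Proof.
move=> f0 mf; rewrite -(@ge0_integral_density _ _ _ mu nu _ measurable_dPhi dPhi_ge0 nuE)//.
by rewrite /nu ge0_integral_pushforward.
Qed.

Definition unstretch (x : R * R * R) : R * R * R := (phi x.1.1, x.1.2, x.2).

Lemma measurable_unstretch : measurable_fun [set: T3 R] (unstretch : T3 R -> T3 R).
Proof.
apply: measurable_fun_pair; last exact: measurable_snd.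
apply: measurable_fun_pair.
  by apply: measurableT_comp; [exact: measurable_phi|exact: measurableT_comp].
exact: measurableT_comp.
Qed.

Lemma measurable_stretch : measurable_fun [set: T3 R] (stretch Phi : T3 R -> T3 R).
Proof.
apply: measurable_fun_pair; last exact: measurable_snd.
apply: measurable_fun_pair.
  by apply: measurableT_comp; [exact: measurable_Phi|exact: measurableT_comp].
exact: measurableT_comp.
Qed.

Lemma measurable_jac : measurable_fun [set: T3 R] (fun y => dPhi y.1.1).
Proof. by apply: measurableT_comp; [exact: measurable_dPhi|exact: measurableT_comp]. Qed.

Lemma ge0_integral_unstretch (f : T3 R -> \bar R) : (forall x, 0 <= f x) ->
  measurable_fun setT f ->
  \int[leb3 R]_x f (unstretch x) = \int[leb3 R]_y (f y * (dPhi y.1.1)%:E).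
Proof.
move=> f0 mf.
have mfu : measurable_fun [set: T3 R] (fun x => f (unstretch x)).
  by apply: measurableT_comp mf _; exact: measurable_unstretch.
have mfj : measurable_fun [set: T3 R] (fun y => f y * (dPhi y.1.1)%:E).
  by apply: emeasurable_funM => //; apply/measurable_EFinP; exact: measurable_jac.
have fj0 y : 0 <= f y * (dPhi y.1.1)%:E by rewrite mule_ge0// lee_fin.
rewrite (ge0_integral_leb3 (fun x => f0 (unstretch x)) mfu) (ge0_integral_leb3 fj0 mfj).
apply: eq_integral => z _; apply: eq_integral => y _.
rewrite (ge0_integral_subst (f := fun x => f (x, y, z)))//.
apply: measurableT_comp mf _ => /=.
by apply: measurable_fun_pair => //; exact: measurable_fun_pair.
Qed.

Lemma ge0_integral_stretch (f : T3 R -> \bar R) : (forall x, 0 <= f x) ->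
  measurable_fun setT f ->
  \int[leb3 R]_x f x = \int[leb3 R]_y (f (stretch Phi y) * (dPhi y.1.1)%:E).
Proof.
move=> f0 mf; rewrite -(ge0_integral_unstretch (f := fun y => f (stretch Phi y)))//.
  by apply: eq_integral => -[[x y] z] _; rewrite /stretch /unstretch/= phiK.
by apply: measurableT_comp mf _; exact: measurable_stretch.
Qed.

Lemma integrable_stretch (f : T3 R -> R) : measurable_fun setT f ->
  (leb3 R).-integrable setT (EFin \o f) <->
  (leb3 R).-integrable setT (EFin \o (fun y => (f (stretch Phi y) * dPhi y.1.1)%R)).
Proof.
move=> mf; have mg : measurable_fun [set: T3 R] (fun y => (f (stretch Phi y) * dPhi y.1.1)%R).
  apply: measurable_funM; last exact: measurable_jac.
  by apply: measurableT_comp mf _; exact: measurable_stretch.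
have E : \int[leb3 R]_x `|(f x)%:E| =
   \int[leb3 R]_y `|(f (stretch Phi y) * dPhi y.1.1)%:E|.
  rewrite ge0_integral_stretch//; last by apply: measurableT_comp => //; exact/measurable_EFinP.
  by apply: eq_integral => y _; rewrite /= -EFinM normrM (ger0_norm (dPhi_ge0 _)).
split=> /integrableP[_ h]; apply/integrableP; split; try exact/measurable_EFinP.
  by rewrite -E.
by rewrite E.
Qed.

Lemma Rintegral_stretch (f : T3 R -> R) : measurable_fun setT f ->
  (\int[leb3 R]_x f x = \int[leb3 R]_y (f (stretch Phi y) * dPhi y.1.1))%R.
Proof.
move=> mf; rewrite /Rintegral; congr fine.
have mEf : measurable_fun [set: T3 R] (EFin \o f) by exact/measurable_EFinP.
rewrite integralE [RHS]integralE; congr (_ - _).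
  rewrite ge0_integral_stretch//; last exact: measurable_funepos.
  apply: eq_integral => y _; rewrite !funeposE/=.
  by rewrite -!EFin_max -EFinM maxr_pMl// mul0r.
rewrite ge0_integral_stretch//; last exact: measurable_funeneg.
apply: eq_integral => y _; rewrite !funenegE/=.
by rewrite -!EFin_max -EFinM maxr_pMl// mul0r mulNr.
Qed.

End change_of_variables.

(** * Square-integrable functions and the du Bois-Reymond lemma *)

Section pi_system.
Local Open Scope ereal_scope.
Context d (T : measurableType d) (R : realType) (mu : {measure set T -> \bar R}).

(** The positive and negative parts of [H] on [E] are densities of two measures, finite by
    integrability. Their images under [pr] agree on the pi-system [G], hence everywhere. The map
    [pr] allows the sets in one coordinate to be generalized while the others stay fixed in [E]. *)
Lemma integral_pi_system_eq0 d' (Y : measurableType d') (pr : T -> Y)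
    (G : set (set Y)) (g : (set Y)^nat) (H : T -> R) (E : set T) :
  measurable_fun setT pr -> measurable E ->
  measurable = <<s G >> -> setI_closed G -> (forall i, G (g i)) ->
  \bigcup_k g k = setT ->
  mu.-integrable setT (EFin \o H) ->
  (forall A, G A -> \int[mu]_(x in E `&` pr @^-1` A) (H x)%:E = 0) ->
  forall A, measurable A -> \int[mu]_(x in E `&` pr @^-1` A) (H x)%:E = 0.
Proof.
move=> mpr mE mG GI Gg gT iH H0.
have mH : measurable_fun setT H by apply/measurable_EFinP; exact: measurable_int iH.
have mpre A : measurable A -> measurable (pr @^-1` A).
  by move=> mA; rewrite -[X in measurable X]setTI; exact: mpr.
pose Hp := (H \_ E)^\+%R; pose Hn := (H \_ E)^\-%R.
have mHE : measurable_fun setT (H \_ E).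
  by apply/measurable_restrict => //; rewrite setTI; exact: measurable_funTS.
have iHE : mu.-integrable setT (EFin \o (H \_ E)).
  rewrite -restrict_EFin; apply/integrable_restrict => //.
  by rewrite setTI; exact: integrableS iH.
have mHp : measurable_fun setT Hp by exact: measurable_funrpos.
have mHn : measurable_fun setT Hn by exact: measurable_funrneg.
have Hp0 x : (0 <= Hp x)%R by exact: funrpos_ge0.
have Hn0 x : (0 <= Hn x)%R by exact: funrneg_ge0.
pose nu1 : {measure set Y -> \bar R} := ltac:(refine (pushforward (mdensity mu mHp Hp0) pr); exact: mpr).
pose nu2 : {measure set Y -> \bar R} := ltac:(refine (pushforward (mdensity mu mHn Hn0) pr); exact: mpr).
have fin1 A : measurable A -> nu1 A \is a fin_num.
  move=> mA; apply: integrable_fin_num; first exact: mpre.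
  by apply: integrableS (integrable_funrpos measurableT iHE) => //; exact: mpre.
have fin2 A : measurable A -> nu2 A \is a fin_num.
  move=> mA; apply: integrable_fin_num; first exact: mpre.
  by apply: integrableS (integrable_funrneg measurableT iHE) => //; exact: mpre.
have key A : measurable A -> \int[mu]_(x in E `&` pr @^-1` A) (H x)%:E = nu1 A - nu2 A.
  move=> mA; rewrite setIC integral_mkcondr.
  rewrite integralE; congr (_ - _); apply: eq_integral => x _.
    by rewrite funeposE -/(EFin \o H) restrict_EFin/= /Hp/= /funrpos EFin_max.
  by rewrite funenegE -/(EFin \o H) restrict_EFin/= /Hn/= /funrneg EFin_max.
move=> A mA; rewrite key//.
suff -> : nu1 A = nu2 A by rewrite subee ?fin2.
apply: (measure_unique G g mG GI Gg gT) => //.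
  move=> B GB; have mB : measurable B by rewrite mG; exact: sub_gen_smallest.
  by have := H0 _ GB; rewrite key// -{2}(subeK (nu1 B) (fin2 _ mB)) => ->; rewrite add0e.
move=> k; have mB : measurable (g k) by rewrite mG; apply: sub_gen_smallest.
by have := fin1 _ mB; rewrite fin_numE => /andP[_ h]; rewrite ltey.
Qed.

End pi_system.

Section L2.
Context {R : realType}.
Local Notation mu3 := (leb3 R).
Implicit Types f g u : R * R * R -> R.

Lemma L2_measurable f : L2 f -> measurable_fun [set: T3 R] f.
Proof. by rewrite /L2/= inE => /andP[]; rewrite inE. Qed.

Lemma L2_sqr f : L2 f -> mu3.-integrable setT (EFin \o (fun x => f x ^+ 2)).
Proof. exact: Lfun2_integrable_sqr. Qed.

Lemma L2M f g : L2 f -> L2 g -> mu3.-integrable setT (EFin \o (fun x => f x * g x)).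
Proof. by move=> Lf Lg; apply/Lfun1_integrable; exact: Lfun2_mul_Lfun1. Qed.

Lemma L2_intro f : measurable_fun [set: T3 R] f ->
  (\int[mu3]_x (f x ^+ 2)%:E < +oo)%E -> L2 f.
Proof.
move=> mf foo; rewrite /L2/= inE; apply/andP; split; first by rewrite inE.
rewrite inE/= /finite_norm unlock /Lnorm.
apply: poweR_lty; apply: le_lt_trans foo; rewrite le_eqVlt; apply/orP; left.
apply/eqP; apply: eq_integral => x _ /=.
by rewrite powR_mulrn// real_normK// num_real.
Qed.

Lemma L2D f g : L2 f -> L2 g -> L2 (fun x => f x + g x).
Proof.
move=> Lf Lg; have mf := L2_measurable Lf; have mg := L2_measurable Lg.
apply: L2_intro; first exact: measurable_funD.
have /integrableP[_] := integrableZl measurableT 2 (integrableD measurableT (L2_sqr Lf) (L2_sqr Lg)).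
apply: le_lt_trans; apply: ge0_le_integral => //.
- by move=> x _; rewrite lee_fin sqr_ge0.
- by apply/measurable_EFinP; apply: measurable_funX; exact: measurable_funD.
- apply: measurableT_comp => //; apply: emeasurable_funM => //; apply: emeasurable_funD; apply/measurable_EFinP; exact: measurable_funX.
- move=> x _ /=; rewrite lee_fin; apply: le_trans (ler_norm _).
  rewrite -subr_ge0 (_ : _ - _ = (f x - g x) ^+ 2) ?sqr_ge0//; ring.
Qed.

Lemma L2Z (k : R) f : L2 f -> L2 (fun x => k * f x).
Proof.
move=> Lf; have mf := L2_measurable Lf; apply: L2_intro.
  exact: measurable_funM.
have /integrableP[_] := integrableZl measurableT (k ^+ 2) (L2_sqr Lf).
apply: le_lt_trans; apply: ge0_le_integral => //.
- by move=> x _; rewrite lee_fin sqr_ge0.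
- by apply/measurable_EFinP; apply: measurable_funX; exact: measurable_funM.
- apply: measurableT_comp => //; apply: emeasurable_funM => //; apply/measurable_EFinP; exact: measurable_funX.
- by move=> x _ /=; rewrite lee_fin exprMn ler_norm.
Qed.

Lemma L2_boundedM f (m : R * R * R -> R) K : measurable_fun [set: T3 R] m ->
  (forall x, `|m x| <= K) -> L2 f -> L2 (fun x => m x * f x).
Proof.
move=> mm mK Lf; have mf := L2_measurable Lf; apply: L2_intro.
  exact: measurable_funM.
have /integrableP[_] := L2_sqr (L2Z K Lf); apply: le_lt_trans.
apply: ge0_le_integral => //.
- by move=> x _; rewrite lee_fin sqr_ge0.
- by apply/measurable_EFinP; apply: measurable_funX; exact: measurable_funM.
- apply: measurableT_comp => //; apply/measurable_EFinP; apply: measurable_funX.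
  exact: measurable_funM.
- move=> x _ /=; rewrite lee_fin ger0_norm ?sqr_ge0// !exprMn ler_wpM2r ?sqr_ge0//.
  by rewrite -(real_normK (num_real (m x))) lerXn2r// nnegrE (le_trans (normr_ge0 (m x))).
Qed.

Lemma L2_bounded_support f N K : measurable_fun [set: T3 R] f ->
  (forall x, ~ box N x -> f x = 0) -> (forall x, `|f x| <= K) -> L2 f.
Proof.
move=> mf fN fK; apply: L2_intro => //.
have mbox : measurable (box N : set (T3 R)).
  by apply: measurableX => //; exact: measurableX.
apply: (@le_lt_trans _ _ (\int[mu3]_x ((K ^+ 2)%:E * (\1_(box N) x)%:E))%E).
  apply: ge0_le_integral => //.
  - by move=> x _; rewrite lee_fin sqr_ge0.
  - by apply/measurable_EFinP; exact: measurable_funX.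
  - apply: emeasurable_funM => //; apply/measurable_EFinP; exact: measurable_indic.
  - move=> x _; rewrite indicE; case: (boolP (x \in box N)) => [_|].
      rewrite mule1 lee_fin -(real_normK (num_real (f x))) lerXn2r// nnegrE//.
      exact: le_trans (fK x).
    by rewrite notin_setE => /fN ->; rewrite expr0n mule0.
have mb1 : measurable_fun [set: T3 R] (fun x => (\1_(box N) x)%:E : \bar R).
  by apply/measurable_EFinP; exact: measurable_indic.
have b10 x : [set: T3 R] x -> (0 <= (\1_(box N) x)%:E :> \bar R)%E by rewrite lee_fin.
have K0 : (0 <= (K ^+ 2)%:E)%E by rewrite lee_fin sqr_ge0.
rewrite (@ge0_integralZl _ _ _ mu3 _ measurableT _ mb1 (K ^+ 2)%:E b10 K0) integral_indic// setIT lte_mul_pinfty ?lee_fin ?sqr_ge0//.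
have -> : mu3 (box N) = (lebesgue_measure (`[(- N)%R, N]%classic : set R) * lebesgue_measure (`[(- N)%R, N]%classic : set R) *
    lebesgue_measure (`[(- N)%R, N]%classic : set R))%E.
  transitivity (leb2 ((`[(- N)%R, N]%classic : set (measurableTypeR R)) `*` `[(- N)%R, N]%classic) * lebesgue_measure (`[(- N)%R, N]%classic : set R))%E.
    by apply: product_measure1E => //; exact: measurableX.
  by congr (_ * _)%E; exact: product_measure1E.
by rewrite lebesgue_measure_itv/=; case: ifP => _; rewrite ?mule0 ?ltry// -!EFinB -!EFinM ltry.
Qed.

Lemma test_function_bounded f : test_function f -> exists K, forall x, `|f x| <= K.
Proof.
move=> tf; have [sf [N N0 fN]] := (test_functionP f).1 tf.
have : compact (f @` box N).
  apply: continuous_compact; last exact: compact_box.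
  by apply: continuous_subspaceT; exact: smooth_continuous.
move=> /compact_bounded[M [_ MK]]; exists (`|M| + 1) => x.
have [bx|/fN ->] := pselect (box N x); last by rewrite normr0 addr_ge0.
by apply: (MK (`|M| + 1)); [rewrite (le_lt_trans (ler_norm _))// ltrDl|exists x].
Qed.

Lemma test_function_L2 f : test_function f -> L2 f.
Proof.
move=> tf; have [sf [N N0 fN]] := (test_functionP f).1 tf.
have [K fK] := test_function_bounded tf.
apply: (L2_bounded_support _ fN fK).
by apply: continuous_measurable3; exact: smooth_continuous.
Qed.

Lemma test_function_partial i f : test_function f -> test_function (partial i f).
Proof.
move=> tf; have [sf [N N0 fN]] := (test_functionP f).1 tf.
apply/test_functionP; split; first exact: smooth_partial.
exists N => // x nbx.
have fx0 : \near x, cst 0 x = f x.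
  have : open (~` (box N)).
    apply: closed_openC; apply: compact_closed; last exact: compact_box.
    exact: norm_hausdorff.
  move=> /(_ _ nbx); by apply: filterS => y /fN ->.
by have [] := near_eq_is_derive fx0 (is_derive_cst 0 x (e3 R i)).
Qed.

Lemma test_function_prod3 (b : 'I_3 -> R -> R) N : 0 <= N ->
  (forall i, smooth1 (b i)) -> (forall i s, N < `|s| -> b i s = 0) ->
  test_function (prod3 b).
Proof.
move=> N0 sb bN; apply/test_functionP; split; first exact: smooth_prod3.
exists N => // x; apply: contra_notP => /eqP; rewrite /prod3 => /prodf_neq0 h.
have {}h i : `|coord i x| <= N.
  by rewrite leNgt; apply/negP => /bN e; have := h i isT; rewrite e eqxx.
have := h ord0; have := h (Ordinal (isT : 1 < 3)%N); have := h (Ordinal (isT : 2 < 3)%N).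
by rewrite /coord/= => k2 k1 k0; split; first split; rewrite /= in_itv/= -ler_norml.
Qed.

End L2.

(** * The du Bois-Reymond lemma *)

Section du_bois_reymond.
Context {R : realType}.
Local Notation mu3 := (leb3 R).

(** Nonnegativity of the factors is what lets Tonelli be applied in [shift_integral_prod3]. *)
Definition product_test (b : 'I_3 -> R -> R) : Prop :=
  [/\ forall i, smooth1 (b i), forall i s, 0 <= b i s &
    exists2 N, 0 <= N & forall i s, N < `|s| -> b i s = 0].

(** Smooth approximations of indicators show that [G] has integral 0 over every open box. The
    pi-system lemma extends this to all measurable sets, which forces [G] to vanish almost
    everywhere. As [G] is integrable, the factors [b] need no bounded support here. *)
Let integrable_eq0 (G : R * R * R -> R) : mu3.-integrable setT (EFin \o G) ->
  (forall b : 'I_3 -> R -> R, (forall i, smooth1 (b i)) -> (forall i s, 0 <= b i s) ->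
    \int[mu3]_x (G x * prod3 b x) = 0) ->
  {ae mu3, forall x, G x = 0}.
Proof.
move=> iG G0.
have mG : measurable_fun [set: T3 R] G by apply/measurable_EFinP; exact: measurable_int iG.
pose oitv : set (set (measurableTypeR R)) := [set A | exists a b, A = `]a, b[%classic].
have cylE (A B C : set R) : (A `*` B) `*` C = [set x : T3 R | [/\ A x.1.1, B x.1.2 & C x.2]].
  by apply/seteqP; split => -[[x y] z] /=; [move=> [[]]|move=> []].
have step0 (A B C : set R) : oitv A -> oitv B -> oitv C ->
    (\int[mu3]_(x in (A `*` B) `*` C) (G x)%:E = 0)%E.
  move=> [a0 [b0 ->]] [a1 [b1 ->]] [a2 [b2 ->]].
  pose a (i : 'I_3) := if i == 0 :> nat then a0 else if i == 1 :> nat then a1 else a2.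
  pose b (i : 'I_3) := if i == 0 :> nat then b0 else if i == 1 :> nat then b1 else b2.
  pose bn n (i : 'I_3) := bump_approx (a i) (b i) n.
  have sb n i : smooth1 (bn n i) by exact: smooth1_bump_approx.
  pose F x := G x * \prod_(i < 3) \1_(`]a i, b i[%classic) (coord i x).
  have cF x : G x * prod3 (bn n) x @[n --> \oo] --> F x.
    apply: cvgM; first exact: cvg_cst.
    rewrite /prod3 !big_ord_recl big_ord0.
    under eq_fun do rewrite !big_ord_recl big_ord0.
    by do 3 (apply: cvgM; first exact: bump_approx_cvg); exact: cvg_cst.
  have mGb n : measurable_fun [set: T3 R] (fun x => G x * prod3 (bn n) x).
    apply: measurable_funM => //; apply: continuous_measurable3.
    exact: continuous_prod3.
  have mF : measurable_fun [set: T3 R] F by apply: (measurable_fun_cvg mGb) => x _; exact: cF.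
  have ff : {ae mu3, forall x, [set: T3 R] x -> (G x * prod3 (bn n) x)%:E @[n --> \oo] --> (F x)%:E}.
    apply: aeW => x _; apply/fine_cvgP; split; first exact: nearW.
    exact: cF.
  have fg : {ae mu3, forall x n, [set: T3 R] x -> (`|(G x * prod3 (bn n) x)%:E| <= `|G x|%:E)%E}.
    apply: aeW => x n _; rewrite /= lee_fin normrM ler_piMr//.
    rewrite /prod3 normr_prod; apply: prodr_ile1 => k _; rewrite normr_ge0/=.
    exact: bump_approx_le1.
  have mE n : measurable_fun [set: T3 R] (fun x => (G x * prod3 (bn n) x)%:E).
    exact/measurable_EFinP.
  have mEF : measurable_fun [set: T3 R] (EFin \o F) by exact/measurable_EFinP.
  have [_ _] := @dominated_convergence _ (T3 R) R mu3 setT measurableT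
    (fun n x => (G x * prod3 (bn n) x)%:E) (EFin \o F) (abse \o (EFin \o G))
    mE mEF ff (integrable_abse iG) fg.
  have -> : [sequence (\int[mu3]_x (G x * prod3 (bn n) x)%:E)%E]_n = cst 0%E.
    apply/funext => n /=.
    have iGb : mu3.-integrable setT (EFin \o (fun x => G x * prod3 (bn n) x)).
      apply: (@le_integrable _ (T3 R) R mu3 setT measurableT _ (EFin \o G)) => // [|x _ /=].
        exact/measurable_EFinP.
      rewrite lee_fin.
      rewrite normrM ler_piMr// /prod3 normr_prod; apply: prodr_ile1 => k _; rewrite normr_ge0/=.
      exact: bump_approx_le1.
    by rewrite -[LHS]fineK ?(integrable_fin_num measurableT iGb)//; congr EFin; apply: G0 => // i s; exact: bump_approx_ge0.
  move=> /(cvg_lim (@ereal_hausdorff R)); rewrite lim_cst// => h0.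
  rewrite integral_mkcond h0; apply: eq_integral => x _.
  transitivity (F x)%:E => //; rewrite patchE /F !big_ord_recl big_ord0 mulr1/=.
  have -> : (x \in (`]a0, b0[ `*` `]a1, b1[) `*` `]a2, b2[) =
     [&& coord ord0 x \in `]a0, b0[%classic, x.1.2 \in `]a1, b1[%classic & x.2 \in `]a2, b2[%classic].
    by apply/idP/idP => [/set_mem[[/mem_set -> /mem_set ->] /mem_set ->]//|/and3P[/set_mem ? /set_mem ? /set_mem ?]]; apply/mem_set.
  rewrite !indicE /coord/= /a /b/=.
  by do 3 case: (_ \in _); rewrite /= ?mulr1 ?mulr0 ?mul0r.
have E0 (A B C : set R) : oitv A -> oitv B -> oitv C ->
    (\int[mu3]_(x in (A `*` B) `*` C) (G x)%:E = 0)%E by exact: step0.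
have mI : measurable = <<s oitv>> by exact: RGenOpens.measurableE.
have II : setI_closed oitv.
  move=> _ _ [a [b ->]] [c [d ->]]; exists (Num.max a c), (Num.min b d).
  apply/seteqP; split => x /=; rewrite !in_itv/= gt_max lt_min.
    by move=> [/andP[-> ->] /andP[-> ->]].
  by move=> /andP[/andP[-> ->] /andP[-> ->]].
pose J n : set (measurableTypeR R) := `](- n%:R), n%:R[%classic.
have IJ n : oitv (J n) by exists (- n%:R), n%:R.
have JT : \bigcup_n J n = setT.
  rewrite -subTset => x _; exists (Num.bound `|x|) => //=.
  by have := archi_boundP (normr_ge0 x); rewrite ltr_norml /J/= in_itv.
have ImI (A : set R) : oitv A -> measurable (A : set (measurableTypeR R)).
  by rewrite mI; exact: sub_gen_smallest.
(* From here on one factor at a time passes from open intervals to Borel sets. *)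
have step1 (A : set (measurableTypeR R)) B C : measurable A -> oitv B -> oitv C ->
    (\int[mu3]_(x in (A `*` B) `*` C) (G x)%:E = 0)%E.
  move=> mA IB IC.
  have E A' : (A' `*` B) `*` C = ((setT `*` B) `*` C) `&` (fun x : T3 R => x.1.1) @^-1` A'.
    by rewrite !cylE; apply/seteqP; split => x /=; [case|case=> -[]].
  rewrite E; apply: (integral_pi_system_eq0 (G := oitv) (g := J)) => //.
  - exact: measurableT_comp.
  - by apply: measurableX; [apply: measurableX => //|]; exact: ImI.
  - by move=> A' IA'; rewrite -E; exact: E0.
have step2 (A B : set (measurableTypeR R)) C : measurable A -> measurable B -> oitv C ->
    (\int[mu3]_(x in (A `*` B) `*` C) (G x)%:E = 0)%E.
  move=> mA mB IC.
  have E B' : (A `*` B') `*` C = ((A `*` setT) `*` C) `&` (fun x : T3 R => x.1.2) @^-1` B'.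
    by rewrite !cylE; apply/seteqP; split => x /=; [case|case=> -[]].
  rewrite E; apply: (integral_pi_system_eq0 (G := oitv) (g := J)) => //.
  - exact: measurableT_comp.
  - by apply: measurableX; [apply: measurableX => //|exact: ImI].
  - by move=> B' IB'; rewrite -E; exact: step1.
have step3 (A B C : set (measurableTypeR R)) : measurable A -> measurable B -> measurable C ->
    (\int[mu3]_(x in (A `*` B) `*` C) (G x)%:E = 0)%E.
  move=> mA mB mC.
  have E C' : (A `*` B) `*` C' = ((A `*` B) `*` setT) `&` (fun x : T3 R => x.2) @^-1` C'.
    by rewrite !cylE; apply/seteqP; split => x /=; [case|case=> -[]].
  rewrite E; apply: (integral_pi_system_eq0 (G := oitv) (g := J)) => //.
  - exact: measurable_snd.
  - by apply: measurableX => //; exact: measurableX.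
  - by move=> C' IC'; rewrite -E; exact: step2.
(* Rectangles generate a product sigma-algebra: first for the pair of leading coordinates, then for
   all three. The whole space is itself a rectangle, whence the constant exhaustion. *)
have step4 (D : set (measurableTypeR R * measurableTypeR R)) (C : set (measurableTypeR R)) :
    measurable D -> measurable C -> (\int[mu3]_(x in D `*` C) (G x)%:E = 0)%E.
  move=> mD mC.
  have E D' : D' `*` C = (setT `*` C) `&` (fun x : T3 R => x.1) @^-1` D'.
    by apply/seteqP; split => x /=; [case|case=> -[]].
  rewrite E; apply: (integral_pi_system_eq0 (G := [set A `*` B | A in measurable & B in measurable]) (g := fun=> setT)) => //.
  - exact: measurable_fst.
  - exact: measurableX.
  - exact: measurable_prod_measurableType.
  - move=> _ _ [A mA [B mB <-]] [A' mA' [B' mB' <-]]; rewrite -setXI.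
    by exists (A `&` A'); [exact: measurableI|exists (B `&` B') => //; exact: measurableI].
  - by move=> _; exists setT => //; exists setT => //; rewrite setXTT.
  - by rewrite bigcup_const//; exists 0%N.
  - by move=> _ [A mA [B mB <-]]; rewrite -E; exact: step3.
have step5 (D : set (T3 R)) : measurable D -> (\int[mu3]_(x in D) (G x)%:E = 0)%E.
  move=> mD.
  have E (D' : set (T3 R)) : D' = setT `&` id @^-1` D' by rewrite setTI.
  rewrite [D]E; apply: (integral_pi_system_eq0 (G := [set A `*` B | A in measurable & B in measurable]) (g := fun=> setT)) => //.
  - exact: measurable_prod_measurableType.
  - move=> _ _ [A mA [B mB <-]] [A' mA' [B' mB' <-]]; rewrite -setXI.
    by exists (A `&` A'); [exact: measurableI|exists (B `&` B') => //; exact: measurableI].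
  - by move=> _; exists setT => //; exists setT => //; rewrite setXTT.
  - by rewrite bigcup_const//; exists 0%N.
  - by move=> _ [A mA [B mB <-]]; rewrite -E; exact: step4.
have := @integral_ae_eq _ (T3 R) R mu3 setT measurableT (cst 0%E) (EFin \o G) iG.
have mc0 : measurable_fun [set: T3 R] (cst (0 : \bar R)%E) by exact: measurable_cst.
move=> /(_ mc0) h; have : ae_eq mu3 setT (EFin \o G) (cst 0%E).
  by apply: h => E _ mE; rewrite step5// integral0.
by apply: filterS => x /(_ I) [].
Qed.

(** [g] is square integrable but perhaps not integrable. Its product with a bump positive on a box
    is integrable and vanishes almost everywhere; countably many boxes cover the space. *)
Lemma du_bois_reymond (g : R * R * R -> R) : L2 g ->
  (forall b, product_test b -> \int[mu3]_x (g x * prod3 b x) = 0) ->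
  {ae mu3, forall x, g x = 0}.
Proof.
move=> Lg g0.
pose beta n (i : 'I_3) := bump (- n.+1%:R) (n.+1%:R : R).
have beta0 n i s : n.+1%:R < `|s| -> beta n i s = 0.
  move=> ns; apply/eqP; rewrite eq_le bump_ge0 andbT leNgt bump_gt0 -ltr_norml.
  by rewrite -leNgt ltW.
have tb n : test_function (prod3 (beta n)).
  apply: (test_function_prod3 (N := n.+1%:R)) => // i; [exact: smooth1_bump|exact: beta0].
have h n : {ae mu3, forall x, g x * prod3 (beta n) x = 0}.
  apply: integrable_eq0; first by apply: L2M => //; exact: test_function_L2.
  move=> b sb b0; rewrite -[RHS](g0 (fun i s => beta n i s * b i s)); last first.
    split; first by move=> i; apply: smooth1M; [exact: smooth1_bump|exact: sb].
      by move=> i s; rewrite mulr_ge0// bump_ge0.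
    by exists n.+1%:R => // i s ns; rewrite (beta0 n i s ns) mul0r.
  apply: eq_Rintegral => x _; rewrite -mulrA; congr (_ * _).
  by rewrite /prod3 -big_split.
have := ae_foralln h; apply: filterS => x hx.
pose n := Num.bound (`|x.1.1| + `|x.1.2| + `|x.2|).
have := hx n; move/eqP; rewrite mulf_eq0 => /orP[/eqP//|].
suff : 0 < prod3 (beta n) x by move=> /gt_eqF ->.
have := archi_boundP (addr_ge0 (addr_ge0 (normr_ge0 x.1.1) (normr_ge0 x.1.2)) (normr_ge0 x.2)).
rewrite -/n => hn.
have := normr_ge0 x.1.1; have := normr_ge0 x.1.2; have := normr_ge0 x.2 => p2 p1 p0.
apply: prodr_gt0 => i _; rewrite bump_gt0 -ltr_norml /coord.
by case: ifP => _; last case: ifP => _; lra.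
Qed.

End du_bois_reymond.

(** * Shifts along the first coordinate *)

Section primitive.
Context {R : realType}.
Local Notation mu := (@lebesgue_measure R).

Lemma primitive_exists (b : R -> R) N : continuous b ->
  (forall s, N < `|s| -> b s = 0) ->
  exists B : R -> R, forall x : R, is_derive x (1 : R) B (b x).
Proof.
move=> cb bN; exists (fun x => \int[mu]_(t in [set` `]-oo, x]]) b t) => x.
have ib : mu.-integrable [set` `]-oo, x + 1]] (EFin \o b).
  apply: (@integrableS _ _ _ mu setT) => //.
  have -> : EFin \o b = (EFin \o b) \_ `[- N, N]%classic.
    apply/funext => s; rewrite patchE; case: ifPn => // /negP h /=.
    rewrite bN// ltNge ler_norml; apply/negP => h'; apply: h.
    by apply/mem_set; rewrite /= in_itv.
  apply/(integrable_mkcond _ _).1 => //.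
  apply: continuous_compact_integrable; first exact: segment_compact.
  exact: continuous_subspaceT.
have x1 : x < x + 1 by rewrite ltrDl.
have [d1 d2] := @continuous_FTC1 R b -oo%O x (x + 1) x1 ib (ltNyr _) (cb x).
apply: DeriveDef; first exact: d1.
by rewrite -derive1E; exact: d2.
Qed.

Lemma ge0_integral_itvoc (b B : R -> R) (x y : R) : x <= y -> continuous b ->
  (forall s : R, is_derive s (1 : R) B (b s)) ->
  (\int[mu]_(t in `]x, y]) (b t)%:E = (B y - B x)%:E)%E.
Proof.
move=> xy cb dB.
move: xy; rewrite le_eqVlt => /orP[/eqP ->|xy].
  by rewrite set_itv_ge ?integral_set0 ?subrr// bnd_simp ltxx.
rewrite integral_itv_obnd_cbnd; last first.
  by apply/measurable_EFinP; apply: measurable_funTS; exact: continuous_measurable_fun.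
have cB : continuous B.
  move=> s; apply: differentiable_continuous; apply/derivable1_diffP.
  by have [] := dB s.
rewrite (@continuous_FTC2 _ b B)//.
- exact: continuous_subspaceT.
- split => [s _||]; first by have [] := dB s.
  + by apply: cvg_at_right_filter; exact: cB.
  + by apply: cvg_at_left_filter; exact: cB.
- by move=> s _; rewrite derive1E; have [] := dB s.
Qed.

End primitive.

(** * A weighted Cauchy-Schwarz inequality with values in [0, +oo] *)

Section cauchy_schwarz.
Local Open Scope ereal_scope.
Context d (T : measurableType d) (R : realType) (mu : {measure set T -> \bar R}).

(** Integrate k x * k y * (f x - f y)^2 >= 0 in y, then in x. Working in the extended reals lets any
    of the integrals be infinite. *)
Lemma ge0_cauchy_schwarz (f k : T -> R) :
  measurable_fun setT f -> measurable_fun setT k ->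
  (forall x, (0 <= f x)%R) -> (forall x, (0 <= k x)%R) ->
  \int[mu]_x (f x * k x)%:E * \int[mu]_x (f x * k x)%:E <=
  \int[mu]_x (k x)%:E * \int[mu]_x (f x ^+ 2 * k x)%:E.
Proof.
move=> mf mk f0 k0; set H := \int[mu]_x (f x * k x)%:E.
set K := \int[mu]_x (k x)%:E; set J := \int[mu]_x (f x ^+ 2 * k x)%:E.
have mEk : measurable_fun setT (fun x => (k x)%:E) by exact/measurable_EFinP.
have mEfk : measurable_fun setT (fun x => (f x * k x)%:E).
  by apply/measurable_EFinP; exact: measurable_funM.
have mEffk : measurable_fun setT (fun x => (f x ^+ 2 * k x)%:E).
  by apply/measurable_EFinP; apply: measurable_funM => //; exact: measurable_funX.
have H0 : 0 <= H by apply: integral_ge0 => x _; rewrite lee_fin mulr_ge0.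
have K0 : 0 <= K by apply: integral_ge0 => x _; rewrite lee_fin.
have J0 : 0 <= J by apply: integral_ge0 => x _; rewrite lee_fin mulr_ge0// sqr_ge0.
have Z (h : T -> R) (c : \bar R) : measurable_fun setT (fun x => (h x)%:E) ->
    (forall x, (0 <= h x)%R) -> 0 <= c ->
    \int[mu]_x (c * (h x)%:E) = c * \int[mu]_x (h x)%:E.
  by move=> mh h0 c0; rewrite ge0_integralZl// => x _; rewrite lee_fin.
rewrite -[leLHS]Z//; last by move=> x; rewrite mulr_ge0.
apply: (@le_trans _ _ (\int[mu]_x (2^-1%:E * (K * (f x ^+ 2 * k x)%:E + J * (k x)%:E)))).
  apply: ge0_le_integral => //.
  - by move=> x _; rewrite mule_ge0// lee_fin mulr_ge0.
  - exact: emeasurable_funM.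
  - by apply: emeasurable_funM => //; apply: emeasurable_funD; exact: emeasurable_funM.
  - move=> x _; rewrite muleC -Z//; last 2 first.
    + by move=> y; rewrite mulr_ge0.
    + by rewrite lee_fin mulr_ge0.
    rewrite (muleC K) (muleC J) -Z//; last by rewrite lee_fin mulr_ge0// sqr_ge0.
    rewrite -[X in _ + X]Z//; last 2 first.
    + by move=> y; rewrite mulr_ge0// sqr_ge0.
    + by rewrite lee_fin.
    rewrite -ge0_integralD//; last 4 first.
    + by move=> y _; rewrite -EFinM lee_fin !mulr_ge0// sqr_ge0.
    + exact: emeasurable_funM.
    + by move=> y _; rewrite -EFinM lee_fin !mulr_ge0// sqr_ge0.
    + exact: emeasurable_funM.
    rewrite -ge0_integralZl//; last 2 first.
    + by apply: emeasurable_funD; exact: emeasurable_funM.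
    + by move=> y _; apply: adde_ge0; rewrite -EFinM lee_fin !mulr_ge0// sqr_ge0.
    apply: ge0_le_integral => //.
    + by move=> y _; rewrite -EFinM lee_fin !mulr_ge0.
    + exact: emeasurable_funM.
    + by apply: emeasurable_funM => //; apply: emeasurable_funD; exact: emeasurable_funM.
    + move=> y _; rewrite -(EFinM (f x * k x)%R) -(EFinM (f x ^+ 2 * k x)%R) -(EFinM (k x)).
      rewrite -EFinD -EFinM lee_fin -subr_ge0.
      rewrite (_ : _ - _ = 2^-1 * (k x * k y * (f x - f y) ^+ 2))%R; last by field.
      by apply: mulr_ge0; [rewrite invr_ge0|apply: mulr_ge0; [exact: mulr_ge0|exact: sqr_ge0]].
rewrite ge0_integralZl//; last 2 first.
- by apply: emeasurable_funD; exact: emeasurable_funM.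
- by move=> x _; apply: adde_ge0; apply: mule_ge0 => //; rewrite lee_fin ?mulr_ge0 ?sqr_ge0.
rewrite ge0_integralD//; last 4 first.
- by move=> x _; rewrite mule_ge0// lee_fin mulr_ge0// sqr_ge0.
- exact: emeasurable_funM.
- by move=> x _; rewrite mule_ge0// lee_fin.
- exact: emeasurable_funM.
rewrite Z//; last by move=> y; rewrite mulr_ge0// sqr_ge0.
rewrite Z// (muleC J) -/K -/J.
rewrite ge0_muleDr ?mule_ge0//.
have : 0 <= K * J by rewrite mule_ge0.
case: (K * J) => [r|_|//]; last by rewrite gt0_muley ?addey// leey.
by rewrite -EFinM -EFinD !lee_fin => r0; lra.
Qed.

End cauchy_schwarz.

(** * Integrals over the segments swept by the stretching *)

Section shift_integral.
Context {R : realType}.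
Local Notation mu := (@lebesgue_measure R).
Local Notation mu3 := (leb3 R).
Variables (Phi : R -> R) (delta : R).
Hypothesis Phi_mono : {mono Phi : x y / x <= y}.
Hypothesis Phi_ge : forall s, s <= Phi s.
Hypothesis Phi_le : forall s, Phi s <= s + delta.

Let measurable_Phi : measurable_fun [set: measurableTypeR R] (Phi : R -> measurableTypeR R).
Proof. by apply: nondecreasing_measurable => // x y xy; rewrite Phi_mono. Qed.

Let delta0 : 0 <= delta.
Proof. by have := le_trans (Phi_ge 0) (Phi_le 0); rewrite add0r. Qed.

Definition between (s r : R) : R := \1_(`]s, Phi s]%classic) r.

(** This form shows joint measurability: indicators composed with measurable functions of the pair
    (s, r). *)
Let betweenE s r : between s r = \1_(`]0, +oo[%classic) (r - s) * \1_(`[0, +oo[%classic) (Phi s - r).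
Proof.
rewrite /between !indicE !mem_setE !in_itv/= !andbT subr_gt0 subr_ge0.
by case: (s < r); case: (r <= Phi s); rewrite ?mulr1 ?mulr0 ?mul0r.
Qed.

Let measurable_between : measurable_fun [set: measurableTypeR R * measurableTypeR R]
  (fun sr => between sr.1 sr.2).
Proof.
rewrite (_ : (fun _ => _) = (fun sr => \1_(`]0, +oo[%classic) (sr.2 - sr.1) *
  \1_(`[0, +oo[%classic) (Phi sr.1 - sr.2))); last by apply/funext => sr; rewrite betweenE.
apply: measurable_funM.
  apply: (@measurableT_comp _ _ _ _ _ _ (\1_(`]0, +oo[%classic) : R -> R)).
    exact: measurable_indic.
  exact: measurable_funB.
apply: (@measurableT_comp _ _ _ _ _ _ (\1_(`[0, +oo[%classic) : R -> R)).
  exact: measurable_indic.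
by apply: measurable_funB => //; exact: measurableT_comp.
Qed.

Let measurable_between_comp d (T : measurableType d) (a b : T -> measurableTypeR R) :
  measurable_fun setT a -> measurable_fun setT b ->
  measurable_fun setT (fun t => between (a t) (b t)).
Proof.
move=> ma mb; have mab : measurable_fun setT (fun t => (a t, b t)) by exact: measurable_fun_pair.
exact: (measurableT_comp measurable_between mab).
Qed.

Let measurable_comp3 d (T : measurableType d) (h : T3 R -> R) (a b c : T -> measurableTypeR R) :
  measurable_fun setT h ->
  measurable_fun setT a -> measurable_fun setT b -> measurable_fun setT c ->
  measurable_fun setT (fun t => h (a t, b t, c t)).
Proof.
move=> mh ma mb mc.
have mabc : measurable_fun setT (fun t => (a t, b t, c t)).
  by apply: measurable_fun_pair => //; exact: measurable_fun_pair.
exact: (measurableT_comp mh mabc).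
Qed.

Local Notation T4 := (T3 R * measurableTypeR R)%type.

Let m4_1 : measurable_fun [set: T4] (fun t : T4 => t.1.1.1).
Proof. exact: (measurableT_comp measurable_fst (measurableT_comp measurable_fst measurable_fst)). Qed.
Let m4_2 : measurable_fun [set: T4] (fun t : T4 => t.1.1.2).
Proof. exact: (measurableT_comp measurable_snd (measurableT_comp measurable_fst measurable_fst)). Qed.
Let m4_3 : measurable_fun [set: T4] (fun t : T4 => t.1.2).
Proof. exact: (measurableT_comp measurable_snd measurable_fst). Qed.
Let m4_4 : measurable_fun [set: T4] (fun t : T4 => t.2).
Proof. exact: measurable_snd. Qed.

Local Open Scope ereal_scope.

(** If phi is the inverse of [Phi], the kernel selects phi r <= s < r with r = x.1.1: [f] is
    integrated along the first axis from the unstretched point to x. For f = d_1 u this is u x - u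
    (unstretch x). The kernel form makes the order of integration easy to exchange. *)
Definition shift_integral (f : R * R * R -> R) (x : R * R * R) : \bar R :=
  \int[mu]_s (f (s, x.1.2, x.2) * between s x.1.1)%:E.

Implicit Types f g : R * R * R -> R.

Let measurable_integrand f : measurable_fun [set: T3 R] f ->
  measurable_fun [set: T3 R * measurableTypeR R]
    (fun xs : T3 R * measurableTypeR R => (f (xs.2, xs.1.1.2, xs.1.2) * between xs.2 xs.1.1.1)%:E).
Proof.
move=> mf; apply/measurable_EFinP; apply: measurable_funM.
  exact: (measurable_comp3 mf m4_4 m4_2 m4_3).
exact: (measurable_between_comp m4_4 m4_1).
Qed.

Lemma shift_integral_ge0 f x : (forall x, (0 <= f x)%R) -> 0 <= shift_integral f x.
Proof. by move=> f0; apply: integral_ge0 => s _; rewrite lee_fin mulr_ge0. Qed.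

Lemma measurable_shift_integral f : measurable_fun [set: T3 R] f ->
  (forall x, (0 <= f x)%R) -> measurable_fun [set: T3 R] (shift_integral f).
Proof.
move=> mf f0.
apply: (@measurable_fun_fubini_tonelli_F _ _ (T3 R) (measurableTypeR R) _ mu
  _ (measurable_integrand mf)).
by move=> x; rewrite lee_fin mulr_ge0.
Qed.

(** Tonelli in the first coordinate moves the kernel from [f] to [g]. *)
Lemma shift_integral_duality f g : measurable_fun [set: T3 R] f ->
  measurable_fun [set: T3 R] g -> (forall x, (0 <= f x)%R) -> (forall x, (0 <= g x)%R) ->
  \int[mu3]_x (shift_integral f x * (g x)%:E) =
  \int[mu3]_y ((f y)%:E * \int[mu]_r (g (r, y.1.2, y.2) * between y.1.1 r)%:E).
Proof.
move=> mf mg f0 g0.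
have mgi : measurable_fun [set: T3 R] (fun y => \int[mu]_r (g (r, y.1.2, y.2) * between y.1.1 r)%:E).
  apply: (@measurable_fun_fubini_tonelli_F _ _ (T3 R) (measurableTypeR R) _ mu
    (fun yr => (g (yr.2, yr.1.1.2, yr.1.2) * between yr.1.1.1 yr.2)%:E)); last first.
    by move=> x; rewrite lee_fin mulr_ge0.
  apply/measurable_EFinP; apply: measurable_funM.
    exact: (measurable_comp3 mg m4_4 m4_2 m4_3).
  exact: (measurable_between_comp m4_1 m4_4).
have gi0 y : 0 <= \int[mu]_r (g (r, y.1.2, y.2) * between y.1.1 r)%:E.
  by apply: integral_ge0 => r _; rewrite lee_fin mulr_ge0.
have slice_meas (h : T3 R -> R) y z : measurable_fun [set: T3 R] h ->
    measurable_fun [set: measurableTypeR R] (fun s => h (s, y, z)).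
  by move=> mh; apply: measurable_comp3.
rewrite (@ge0_integral_leb3 R (fun x => shift_integral f x * (g x)%:E)); last 2 first.
- by move=> x; rewrite mule_ge0 ?lee_fin// shift_integral_ge0.
- by apply: emeasurable_funM; [exact: measurable_shift_integral|exact/measurable_EFinP].
rewrite (@ge0_integral_leb3 R (fun y => (f y)%:E * \int[mu]_r (g (r, y.1.2, y.2) * between y.1.1 r)%:E)); last 2 first.
- by move=> x; rewrite mule_ge0 ?lee_fin.
- by apply: emeasurable_funM; [exact/measurable_EFinP|].
apply: eq_integral => z _; apply: eq_integral => y _.
transitivity (\int[mu]_x \int[mu]_s (f (s, y, z) * between s x * g (x, y, z))%:E).
  apply: eq_integral => x _; rewrite /shift_integral/=.
  rewrite -ge0_integralZr//; last 3 first.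
  - apply/measurable_EFinP; apply: measurable_funM; first exact: slice_meas.
    exact: measurable_between_comp.
  - by move=> s _; rewrite lee_fin mulr_ge0.
  - by rewrite lee_fin.
transitivity (\int[mu]_s \int[mu]_x (f (s, y, z) * between s x * g (x, y, z))%:E).
  apply: (@fubini_tonelli _ _ _ _ _ mu mu (fun xs => (f (xs.2, y, z) * between xs.2 xs.1 * g (xs.1, y, z))%:E)).
    apply/measurable_EFinP; apply: measurable_funM; last first.
      exact: (measurableT_comp (slice_meas g y z mg) measurable_fst).
    apply: measurable_funM; first exact: (measurableT_comp (slice_meas f y z mf) measurable_snd).
    exact: (measurable_between_comp measurable_snd measurable_fst).
  by move=> xs; rewrite lee_fin !mulr_ge0.
apply: eq_integral => s _; rewrite -ge0_integralZl//; last 3 first.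
- apply/measurable_EFinP; apply: measurable_funM; first exact: slice_meas.
  exact: measurable_between_comp.
- by move=> r _; rewrite lee_fin mulr_ge0.
- by rewrite lee_fin.
by apply: eq_integral => r _; rewrite -EFinM mulrA mulrAC.
Qed.

Let between_int s : \int[mu]_r (between s r)%:E = (Phi s - s)%:E.
Proof.
rewrite /between integral_indic//= setIT lebesgue_measure_itv/= lte_fin.
case: ltP => [_|h]; first by rewrite EFinB.
by have /eqP -> : (Phi s == s)%R; [rewrite eq_le h Phi_ge|rewrite subrr].
Qed.

Let between_int2 r : \int[mu]_s (between s r)%:E <= delta%:E.
Proof.
apply: (@le_trans _ _ (\int[mu]_s (\1_(`[(r - delta)%R, r]%classic) s)%:E)).
  apply: ge0_le_integral => //.
  - by move=> s _; rewrite lee_fin.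
  - by apply/measurable_EFinP; apply: measurable_between_comp.
  - by apply/measurable_EFinP; exact: measurable_indic.
  - move=> s _; rewrite lee_fin /between !indicE !mem_setE !in_itv/=.
    case: (boolP (s < r)%R) => sr; last by rewrite /= ler0n.
    case: (boolP (r <= Phi s)%R) => rs; last by rewrite /= ler0n.
    by rewrite (ltW sr) lerBlDr (le_trans rs).
rewrite integral_indic//= setIT lebesgue_measure_itv/= lte_fin.
case: ifP => _; last by rewrite lee_fin.
by rewrite -EFinB lee_fin; lra.
Qed.

(** Schur's test. In s the kernel has mass at most delta, so Cauchy-Schwarz bounds the square by
    delta times the shift integral of f^2. In r it has mass Phi s - s <= delta, which by duality
    with the constant 1 gives the second factor delta. *)
Lemma shift_integral_sqr f : measurable_fun [set: T3 R] f -> (forall x, (0 <= f x)%R) ->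
  \int[mu3]_x (shift_integral f x * shift_integral f x) <=
  (delta ^+ 2)%:E * \int[mu3]_x (f x ^+ 2)%:E.
Proof.
move=> mf f0.
have mf2 : measurable_fun [set: T3 R] (fun x => f x ^+ 2)%R by exact: measurable_funX.
have f20 x : (0 <= f x ^+ 2)%R by rewrite sqr_ge0.
have mS := measurable_shift_integral mf f0; have mS2 := measurable_shift_integral mf2 f20.
apply: (@le_trans _ _ (\int[mu3]_x (delta%:E * shift_integral (fun x => f x ^+ 2)%R x))).
  apply: ge0_le_integral => //.
  - by move=> x _; rewrite mule_ge0// shift_integral_ge0.
  - exact: emeasurable_funM.
  - exact: emeasurable_funM.
  - move=> x _; rewrite /shift_integral.
    have mfx : measurable_fun [set: measurableTypeR R] (fun s => f (s, x.1.2, x.2)).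
      exact: measurable_comp3.
    have mkx : measurable_fun [set: measurableTypeR R] (fun s => between s x.1.1).
      exact: measurable_between_comp.
    apply: (le_trans (@ge0_cauchy_schwarz _ (measurableTypeR R) R mu _ _ mfx mkx _ _)) => //.
    apply: lee_wpmul2r; last exact: between_int2.
    by apply: integral_ge0 => s _; rewrite lee_fin mulr_ge0// sqr_ge0.
rewrite ge0_integralZl//; last by move=> x _; exact: shift_integral_ge0.
rewrite expr2 EFinM -muleA; apply: lee_wpmul2l; first by rewrite lee_fin.
have -> : \int[mu3]_x shift_integral (fun x => f x ^+ 2)%R x =
    \int[mu3]_x (shift_integral (fun x => f x ^+ 2)%R x * (1%R)%:E).
  by apply: eq_integral => x _; rewrite mule1.
rewrite (@shift_integral_duality _ (fun=> 1%R))//.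
rewrite -ge0_integralZl//; last 2 first.
- exact/measurable_EFinP.
- by move=> x _; rewrite lee_fin.
have E y : \int[mu]_r (1 * between y r)%:E = (Phi y - y)%:E.
  by rewrite -between_int; apply: eq_integral => r _; rewrite mul1r.
apply: ge0_le_integral => //.
- by move=> x _; rewrite E mule_ge0// lee_fin// subr_ge0.
- under eq_fun do rewrite E; apply: emeasurable_funM; apply/measurable_EFinP => //.
  apply: measurable_funB; last exact: (measurableT_comp measurable_fst measurable_fst).
  exact: (measurableT_comp measurable_Phi (measurableT_comp measurable_fst measurable_fst)).
- by apply: emeasurable_funM => //; exact/measurable_EFinP.
- move=> x _; rewrite E muleC lee_wpmul2r ?lee_fin//.
  by rewrite lerBlDl.
Qed.

(** Duality leaves the integral of [b ord0] over ]s, Phi s], which the primitive [B] evaluates. *)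
Lemma shift_integral_prod3 f (b : 'I_3 -> R -> R) (B : R -> R) :
  measurable_fun [set: T3 R] f -> (forall x, (0 <= f x)%R) ->
  (forall i, smooth1 (b i)) -> (forall i s, (0 <= b i s)%R) ->
  (forall s : R, is_derive s (1%R : R) B (b ord0 s)) ->
  \int[mu3]_x (shift_integral f x * (prod3 b x)%:E) =
  \int[mu3]_y (f y * prod3 (upd3 b ord0 (fun s => B (Phi s) - B s)) y)%:E.
Proof.
move=> mf f0 sb b0 dB; rewrite shift_integral_duality//; last 2 first.
- by apply: continuous_measurable3; exact: continuous_prod3.
- by move=> x; apply: prodr_ge0 => i _; exact: b0.
apply: eq_integral => y _; rewrite EFinM; congr (_ * _).
rewrite prod3_upd.
set q := (\prod_(j < 3 | _) _)%R.
have q0 : (0 <= q)%R by apply: prodr_ge0 => i _; exact: b0.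
transitivity (\int[mu]_r (q%:E * (b ord0 r * between y.1.1 r)%:E)).
  apply: eq_integral => r _; rewrite -EFinM; congr EFin.
  by rewrite mulrA; congr (_ * _)%R; rewrite -prod3_slice.
have mbr : measurable_fun [set: measurableTypeR R] (fun r => (b ord0 r * between y.1.1 r)%:E).
  apply/measurable_EFinP; apply: measurable_funM; first exact: smooth1_measurable.
  exact: measurable_between_comp.
rewrite (ge0_integralZl mu measurableT mbr); last 2 first.
- by move=> r _; rewrite lee_fin mulr_ge0.
- by rewrite lee_fin.
rewrite EFinM; congr (_ * _).
rewrite -(ge0_integral_itvoc (Phi_ge _) (smooth1_continuous (sb ord0)) dB).
rewrite [RHS]integral_mkcond; apply: eq_integral => r _.
rewrite patchE /between indicE.
by case: ifP => _; rewrite ?mulr1 ?mulr0.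
Qed.

End shift_integral.

(** * Weak derivatives of stretched functions *)

Section weak_partial.
Context {R : realType}.
Local Notation mu3 := (leb3 R).
Implicit Types u v g h : R * R * R -> R.

Lemma wgrad_spec i u : H1 u -> L2 (wgrad i u) /\ weak_partial i u (wgrad i u).
Proof.
move=> [_ /(_ i) [g gP]].
have P : [set g | L2 g /\ weak_partial i u g] !=set0 by exists g.
exact: (xgetPex (fun=> 0) P).
Qed.

Lemma product_test_test b : @product_test R b -> test_function (prod3 b).
Proof. by move=> [sb b0 [N N0 bN]]; exact: (test_function_prod3 N0). Qed.

Lemma weak_partial_unique i u g h : L2 g -> L2 h ->
  weak_partial i u g -> weak_partial i u h -> {ae mu3, forall x, g x = h x}.
Proof.
move=> Lg Lh ug uh.
have Lgh : L2 (fun x => g x + (-1) * h x) by apply: L2D => //; exact: L2Z.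
have := du_bois_reymond Lgh _; move=> H.
suff : {ae mu3, forall x, g x + (-1) * h x = 0}.
  apply: filterS; first exact: (ae_filter_ringOfSetsType mu3).
  by move=> x; rewrite mulN1r => /eqP; rewrite subr_eq0 => /eqP.
apply: H => b tb; have tf := product_test_test tb; have Lf := test_function_L2 tf.
transitivity (\int[mu3]_x (g x * prod3 b x - h x * prod3 b x)).
  by apply: eq_Rintegral => x _; rewrite mulrDl mulN1r mulNr.
rewrite RintegralB//; last 2 first.
- exact: L2M.
- exact: L2M.
by apply/eqP; rewrite subr_eq0 -(inj_eq oppr_inj) -ug// -uh.
Qed.

Lemma wgrad_unique i u g : H1 u -> L2 g -> weak_partial i u g ->
  {ae mu3, forall x, wgrad i u x = g x}.
Proof.
move=> Hu Lg ug; have [Lw uw] := wgrad_spec i Hu.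
exact: (weak_partial_unique Lw Lg uw ug).
Qed.

Lemma weak_partial_lin i (k l : R) u v g h : L2 u -> L2 v -> L2 g -> L2 h ->
  weak_partial i u g -> weak_partial i v h ->
  weak_partial i (fun x => k * u x + l * v x) (fun x => k * g x + l * h x).
Proof.
move=> Lu Lv Lg Lh ug vh f tf.
have Lf := test_function_L2 tf; have Lpf := test_function_L2 (test_function_partial i tf).
have lin (p q w : R * R * R -> R) : L2 p -> L2 q -> L2 w ->
    \int[mu3]_x ((k * p x + l * q x) * w x) =
    k * \int[mu3]_x (p x * w x) + l * \int[mu3]_x (q x * w x).
  move=> Lp Lq Lw.
  rewrite -RintegralZl//; last exact: L2M.
  rewrite -RintegralZl//; last exact: L2M.
  rewrite -RintegralD//; last 2 first.
  - exact: (integrableZl measurableT k (L2M Lp Lw)).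
  - exact: (integrableZl measurableT l (L2M Lq Lw)).
  by apply: eq_Rintegral => x _; rewrite mulrDl !mulrA.
by rewrite !lin// ug// vh// opprD !mulrN.
Qed.

Lemma H1_lin (k l : R) u v : H1 u -> H1 v -> H1 (fun x => k * u x + l * v x).
Proof.
move=> [Lu Hu] [Lv Hv]; split; first by apply: L2D; exact: L2Z.
move=> i; have [g [Lg ug]] := Hu i; have [h [Lh vh]] := Hv i.
exists (fun x => k * g x + l * h x); split; first by apply: L2D; exact: L2Z.
exact: weak_partial_lin.
Qed.

End weak_partial.

Section stretched.
Context {R : realType}.
Local Notation mu3 := (leb3 R).
Variables (Phi phi nu dnu : R -> R) (delta eps : R).
Hypothesis Phi_mono : {mono Phi : x y / x <= y}.
Hypothesis Phi_ge : forall s, s <= Phi s.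
Hypothesis Phi_le : forall s, Phi s <= s + delta.
Hypothesis PhiK : cancel Phi phi.
Hypothesis phiK : cancel phi Phi.
Hypothesis sPhi : smooth1 Phi.
Hypothesis snu : smooth1 nu.
Hypothesis PhiD : forall s : R, is_derive s (1 : R) Phi (nu s ^+ 2).
Hypothesis nuD : forall s : R, is_derive s (1 : R) nu (dnu s).
Hypothesis sdnu : smooth1 dnu.
Hypothesis nu_ge1 : forall s, 1 <= nu s.
Hypothesis nu_le2 : forall s, nu s <= 2.
Hypothesis dnu_le : forall s, `|dnu s| <= eps.
Implicit Types u v w g h : R * R * R -> R.

Let delta0 : 0 <= delta.
Proof. by have := le_trans (Phi_ge 0) (Phi_le 0); rewrite add0r. Qed.

Let nu_gt0 s : 0 < nu s. Proof. exact: lt_le_trans (nu_ge1 s). Qed.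
Let nu_neq0 s : nu s != 0. Proof. by rewrite gt_eqF. Qed.
Let snu2 : smooth1 (fun s => nu s ^+ 2). Proof. exact: smooth1M. Qed.
Let cnu2 : continuous (fun s => nu s ^+ 2). Proof. exact: smooth1_continuous. Qed.
Let nu2_ge0 s : 0 <= nu s ^+ 2. Proof. exact: sqr_ge0. Qed.

Let sub_stretch (f : T3 R -> R) := Rintegral_stretch PhiD cnu2 nu2_ge0 Phi_mono phiK (f := f).

Definition pull w (x : R * R * R) : R := w (unstretch phi x).

Lemma pull_stretch w y : pull w (stretch Phi y) = w y.
Proof. by case: y => -[x y] z; rewrite /pull /unstretch /stretch/= PhiK. Qed.

Lemma measurable_pull w : measurable_fun [set: T3 R] w -> measurable_fun [set: T3 R] (pull w).
Proof. move=> mw; exact: (measurableT_comp mw (measurable_unstretch Phi_mono phiK)). Qed.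

Lemma measurable_coord1 (f : R -> R) : smooth1 f ->
  measurable_fun [set: T3 R] (fun y : T3 R => f y.1.1).
Proof.
move=> sf; apply: measurableT_comp (smooth1_measurable sf) _.
exact: measurableT_comp measurable_fst measurable_fst.
Qed.

Lemma pull_L2 w : measurable_fun [set: T3 R] w -> L2 (fun y => w y * nu y.1.1) -> L2 (pull w).
Proof.
move=> mw Lw; apply: L2_intro; first exact: measurable_pull.
have /integrableP[_] := L2_sqr Lw; apply: le_lt_trans.
rewrite (ge0_integral_stretch PhiD cnu2 nu2_ge0 Phi_mono phiK); last 2 first.
- by move=> x; rewrite lee_fin sqr_ge0.
- by apply/measurable_EFinP; apply: measurable_funX; exact: measurable_pull.
rewrite le_eqVlt; apply/orP; left; apply/eqP; apply: eq_integral => y _.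
by rewrite pull_stretch -EFinM -exprMn/= ger0_norm// sqr_ge0.
Qed.

(** The stretching has Jacobian nu^2; this is why u / nu, and not u, is pulled back when the mass
    must be kept. *)
Lemma pull_sqr w : measurable_fun [set: T3 R] w ->
  \int[mu3]_x (pull w x ^+ 2) = \int[mu3]_y ((w y * nu y.1.1) ^+ 2).
Proof.
move=> mw; rewrite sub_stretch; last by apply: measurable_funX; exact: measurable_pull.
by apply: eq_Rintegral => y _; rewrite pull_stretch exprMn.
Qed.

Lemma stretch_out_box N y : ~ box (N + delta) y -> ~ box N (stretch Phi y).
Proof.
apply: contra_not; case: y => -[x y] z; rewrite /box/stretch/= => -[[]] /=.
rewrite !in_itv/= => h1 h2 h3; have := Phi_ge x; have := Phi_le x; have := delta0.
move: h1 h2 h3 => /andP[? ?] /andP[? ?] /andP[? ?] ? ? ?.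
by split; first split; rewrite /= ?in_itv/=; apply/andP; split; lra.
Qed.

Lemma test_function_stretch m f : smooth1 m -> test_function f ->
  test_function (fun y => m y.1.1 * f (stretch Phi y)).
Proof.
move=> sm /test_functionP[sf [N N0 fN]]; apply/test_functionP; split.
  exact: (smooth_stretch sPhi PhiD).
exists (N + delta); first by rewrite addr_ge0.
by move=> x /stretch_out_box /fN ->; rewrite mulr0.
Qed.

(** Changing variables puts the stretching on the test function. With T = nu^-1 (f o stretch), d_1 T
    = nu (d_1 f o stretch) - (nu' / nu^2) (f o stretch): the first term is what [u] is integrated
    against, the second is compensated by the term in dnu. *)
Lemma weak_partial_pull0 u g : L2 u -> L2 g -> weak_partial ord0 u g ->
  weak_partial ord0 (pull (fun y => u y / nu y.1.1))
    (pull (fun y => g y / nu y.1.1 ^+ 3 - dnu y.1.1 * u y / nu y.1.1 ^+ 4)).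
Proof.
move=> Lu Lg ug f tf.
have [sf _] := tf.
have mu_ := L2_measurable Lu; have mg := L2_measurable Lg.
have snuV : smooth1 (fun s => (nu s)^-1) by exact: smooth1V.
pose T := fun y : R * R * R => (nu y.1.1)^-1 * f (stretch Phi y).
have tT : test_function T by exact: (test_function_stretch snuV tf).
have LT := test_function_L2 tT.
have LpT := test_function_L2 (test_function_partial ord0 tT).
have dnuV s : is_derive s (1 : R) (fun s => (nu s)^-1) (- dnu s / nu s ^+ 2).
  have h := nuD s; have := is_deriveV (nu_neq0 s) h => {}h.
  by apply: is_derive_eq; rewrite /GRing.scale/= mulNr mulrC mulNr.
have LdT : L2 (fun y => (dnu y.1.1 / nu y.1.1) * T y).
  apply: (@L2_boundedM R _ (fun y => dnu y.1.1 / nu y.1.1) eps) => //.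
    by apply: (measurable_coord1 (f := fun s => dnu s / nu s)); exact: smooth1M.
  move=> y; rewrite normrM normfV ler_pdivrMr; last by rewrite normr_gt0.
  rewrite (ger0_norm (ltW (nu_gt0 _))); apply: (le_trans (dnu_le _)).
  by rewrite ler_peMr// (le_trans _ (dnu_le 0)).
have mpf : measurable_fun [set: T3 R] (partial ord0 f).
  by apply: L2_measurable; apply: test_function_L2; exact: test_function_partial.
have mf : measurable_fun [set: T3 R] f by apply: L2_measurable; exact: test_function_L2.
have mn n : measurable_fun [set: T3 R] (fun y : T3 R => (nu y.1.1 ^+ n)^-1).
  apply: (measurable_coord1 (f := fun s => (nu s ^+ n)^-1)).
  apply: smooth1V; first by move=> s; rewrite expf_neq0.
  elim: n => [|n IH]; first exact: smooth1_cst.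
  by under eq_fun do rewrite exprS; exact: smooth1M.
have mdn : measurable_fun [set: T3 R] (fun y : T3 R => dnu y.1.1) by exact: measurable_coord1.
rewrite sub_stretch; last first.
  apply: measurable_funM => //; apply: measurable_pull; apply: measurable_funM => //.
  exact: (mn 1%N).
transitivity (\int[mu3]_y (u y * partial ord0 T y + u y * (dnu y.1.1 / nu y.1.1 * T y))).
  apply: eq_Rintegral => y _.
  rewrite (partial_stretch PhiD _ _ dnuV sf) pull_stretch/= /T.
  by field; exact: nu_neq0.
rewrite RintegralD//; last 2 first.
- exact: L2M.
- exact: L2M.
rewrite ug// [in RHS]sub_stretch; last first.
  apply: measurable_funM mf; apply: measurable_pull.
  exact: (measurable_funB (measurable_funM mg (mn 3%N))
    (measurable_funM (measurable_funM mdn mu_) (mn 4%N))).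
apply: oppr_inj; rewrite opprK opprD opprK.
rewrite -RintegralB//; last 2 first.
- exact: L2M.
- exact: L2M.
apply: eq_Rintegral => y _; rewrite pull_stretch /T.
by field; exact: nu_neq0.
Qed.

(** In a transverse direction the weight is constant, and T = nu (f o stretch) is the test function
    to use. *)
Lemma weak_partial_pull i u g : i != ord0 -> L2 u -> L2 g -> weak_partial i u g ->
  weak_partial i (pull (fun y => u y / nu y.1.1)) (pull (fun y => g y / nu y.1.1)).
Proof.
move=> i0 Lu Lg ug f tf.
have [sf _] := tf.
have mu_ := L2_measurable Lu; have mg := L2_measurable Lg.
pose T := fun y : R * R * R => nu y.1.1 * f (stretch Phi y).
have tT : test_function T by exact: (test_function_stretch snu tf).
have mpf : measurable_fun [set: T3 R] (partial i f).
  by apply: L2_measurable; apply: test_function_L2; exact: test_function_partial.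
have mf : measurable_fun [set: T3 R] f by apply: L2_measurable; exact: test_function_L2.
have mn : measurable_fun [set: T3 R] (fun y : T3 R => (nu y.1.1)^-1).
  by apply: (measurable_coord1 (f := fun s => (nu s)^-1)); exact: smooth1V.
have i0' : (i == 0 :> nat) = false by apply/negbTE; apply: contra i0 => /eqP h; apply/eqP/val_inj.
rewrite sub_stretch; last first.
  by apply: measurable_funM => //; apply: measurable_pull; exact: measurable_funM.
transitivity (\int[mu3]_y (u y * partial i T y)).
  apply: eq_Rintegral => y _.
  rewrite (partial_stretch PhiD _ _ nuD sf) pull_stretch i0' add0r.
  by field; exact: nu_neq0.
rewrite ug// [in RHS]sub_stretch; last first.
  by apply: measurable_funM => //; apply: measurable_pull; exact: measurable_funM.
congr (- _); apply: eq_Rintegral => y _; rewrite pull_stretch /T.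
by field; exact: nu_neq0.
Qed.

(** [fine] turns +oo into 0, so it can only lower the integral of the square. *)
Let L2_fine (S : R * R * R -> \bar R) : measurable_fun [set: T3 R] S ->
  (forall x, 0 <= S x)%E -> (\int[mu3]_x (S x * S x) < +oo)%E ->
  L2 (fun x => fine (S x)) /\ (\int[mu3]_x (fine (S x) ^+ 2)%:E <= \int[mu3]_x (S x * S x))%E.
Proof.
move=> mS S0 foo.
have mfS : measurable_fun [set: T3 R] (fun x => fine (S x)) by exact: measurableT_comp.
have le : (\int[mu3]_x (fine (S x) ^+ 2)%:E <= \int[mu3]_x (S x * S x))%E.
  apply: ge0_le_integral => //.
  - by move=> x _; rewrite lee_fin sqr_ge0.
  - by apply/measurable_EFinP; exact: measurable_funX.
  - exact: emeasurable_funM.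
  - move=> x _; have := S0 x; case: (S x) => [r|_|//]; first by rewrite -EFinM.
    by rewrite /= expr0n leey.
by split => //; apply: L2_intro => //; exact: le_lt_trans foo.
Qed.

Let ae_fin (S : R * R * R -> \bar R) : measurable_fun [set: T3 R] S ->
  (forall x, 0 <= S x)%E -> (\int[mu3]_x (S x * S x) < +oo)%E ->
  {ae mu3, forall x, S x \is a fin_num}.
Proof.
move=> mS S0 foo.
have iSS : mu3.-integrable setT (fun x => (S x * S x)%E).
  apply/integrableP; split; first exact: emeasurable_funM.
  apply: le_lt_trans foo; rewrite le_eqVlt; apply/orP; left; apply/eqP.
  by apply: eq_integral => x _; rewrite gee0_abs// mule_ge0.
have := integrable_ae measurableT iSS.
apply: filterS => x /(_ Logic.I); have := S0 x.
by case: (S x) => [r|_|//]; rewrite ?fin_numE// mulyy.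
Qed.

(** The square of the shift integral has finite integral, so its values are finite almost everywhere
    and [fine] does not change the integral. *)
Let shift_prod3_fine (f : R * R * R -> R) (b : 'I_3 -> R -> R) (B : R -> R) : product_test b ->
  (forall s : R, is_derive s (1 : R) B (b ord0 s)) ->
  measurable_fun [set: T3 R] f -> (forall x, 0 <= f x) ->
  (\int[mu3]_x (f x ^+ 2)%:E < +oo)%E ->
  \int[mu3]_x (fine (shift_integral Phi f x) * prod3 b x) =
  \int[mu3]_x (f x * prod3 (upd3 b ord0 (fun s => B (Phi s) - B s)) x).
Proof.
move=> [sb b0 _] dB mf f0 foo.
have mS := measurable_shift_integral Phi_mono mf f0.
have S0 x := shift_integral_ge0 Phi x f0.
have Soo : (\int[mu3]_x (shift_integral Phi f x * shift_integral Phi f x) < +oo)%E.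
  apply: le_lt_trans (shift_integral_sqr Phi_mono Phi_ge Phi_le mf f0) _.
  by rewrite lte_mul_pinfty// lee_fin sqr_ge0.
have mb : measurable_fun [set: T3 R] (prod3 b).
  by apply: continuous_measurable3; exact: continuous_prod3.
rewrite /Rintegral -(shift_integral_prod3 Phi_mono Phi_ge mf f0 sb b0 dB); congr fine.
apply: ae_eq_integral => //.
- apply/measurable_EFinP; apply: measurable_funM => //.
  exact: measurableT_comp.
- by apply: emeasurable_funM => //; exact/measurable_EFinP.
have := ae_fin mS S0 Soo.
apply: filterS; first exact: (ae_filter_ringOfSetsType mu3).
by move=> x fx _; rewrite EFinM fineK.
Qed.

(** [B] alone need not vanish at infinity, but B s - B (Phi s) is minus the integral of [b ord0]
    over ]s, Phi s]. It is 0 once this segment misses [-N, N], which |s| > N + delta ensures. *)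
Let product_test_stretch (b : 'I_3 -> R -> R) (B : R -> R) : product_test b ->
  (forall s : R, is_derive s (1 : R) B (b ord0 s)) ->
  test_function (prod3 (upd3 b ord0 (fun s => B s - B (Phi s)))).
Proof.
move=> [sb b0 [N N0 bN]] dB.
have sB : smooth1 B by exact: (smooth1_primitive dB (sb ord0)).
have sBP : smooth1 (fun s => B s - B (Phi s)).
  rewrite (_ : (fun _ => _) = (fun s => B s + (-1) * B (Phi s))); last first.
    by apply/funext => s; rewrite mulN1r.
  apply: smooth1D => //; apply: smooth1M; first exact: smooth1_cst.
  exact: smooth1_comp.
apply: (@test_function_prod3 R _ (N + delta)); first by rewrite addr_ge0.
  by move=> i; rewrite /upd3; case: eqP.
move=> i s Ns; rewrite /upd3; case: eqP => _; last first.
  by apply: bN; apply: le_lt_trans Ns; rewrite lerDl.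
have := ge0_integral_itvoc (Phi_ge s) (smooth1_continuous (sb ord0)) dB.
rewrite integral0_eq => [[/eqP]|r]; first by rewrite eq_sym subr_eq0 => /eqP ->; rewrite subrr.
rewrite /= in_itv/= => /andP[sr rP]; congr EFin; apply: bN.
have [s0|s0] := leP 0 s.
  rewrite ger0_norm ?(le_trans s0 (ltW sr))//; move: Ns; rewrite ger0_norm// => Ns.
  by have := delta0; lra.
move: Ns; rewrite ltr0_norm// => Ns; have := Phi_le s; have := delta0 => h1 h2.
by rewrite ltr0_norm; lra.
Qed.

(* Testing the weak derivative with B - B o Phi, where B' is a one-dimensional
   factor of the test function, identifies u - pull u with a shift integral of g. *)
Lemma weak_partial_shift u g : L2 u -> L2 g -> weak_partial ord0 u g ->
  \int[mu3]_x ((u x - pull u x) ^+ 2) <= 2 * delta ^+ 2 * \int[mu3]_x (g x ^+ 2).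
Proof.
move=> Lu Lg ug.
have mu_ := L2_measurable Lu; have mg := L2_measurable Lg.
(* Shift integrals are handled for nonnegative functions only, hence the splitting of [g]. *)
have mgp : measurable_fun [set: T3 R] (g ^\+)%R by exact: measurable_funrpos.
have mgn : measurable_fun [set: T3 R] (g ^\-)%R by exact: measurable_funrneg.
have gp0 x : 0 <= (g ^\+) x by exact: funrpos_ge0.
have gn0 x : 0 <= (g ^\-) x by exact: funrneg_ge0.
have gpn x : (g ^\+) x - (g ^\-) x = g x by rewrite -[in RHS](funrposBneg g).
have gsq x : (g ^\+) x ^+ 2 + (g ^\-) x ^+ 2 = g x ^+ 2.
  rewrite /funrpos /funrneg; have [h|h] := leP 0 (g x).
    by rewrite (max_idPr _) ?oppr_le0// expr0n addr0.
  by rewrite (max_idPl _) ?oppr_ge0 ?ltW// expr0n add0r sqrrN.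
have sqle (f : R * R * R -> R) : (forall x, f x ^+ 2 <= g x ^+ 2) -> measurable_fun [set: T3 R] f -> L2 f.
  move=> fg mf; apply: L2_intro => //.
  have /integrableP[_] := L2_sqr Lg; apply: le_lt_trans; apply: ge0_le_integral => //.
  - by move=> x _; rewrite lee_fin sqr_ge0.
  - by apply/measurable_EFinP; exact: measurable_funX.
  - by apply: measurableT_comp => //; apply/measurable_EFinP; exact: measurable_funX.
  - by move=> x _ /=; rewrite lee_fin (le_trans (fg x))// ler_norm.
have Lgp : L2 (g ^\+)%R by apply: sqle => // x; rewrite -gsq lerDl sqr_ge0.
have Lgn : L2 (g ^\-)%R by apply: sqle => // x; rewrite -gsq lerDr sqr_ge0.
have fin f : L2 f -> (\int[mu3]_x (f x ^+ 2)%:E < +oo)%E.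
  move=> /L2_sqr /integrableP[_]; apply: le_lt_trans.
  by rewrite le_eqVlt; apply/orP; left; apply/eqP; apply: eq_integral => x _; rewrite /= ger0_norm// sqr_ge0.
pose Sp := shift_integral Phi (g ^\+)%R; pose Sn := shift_integral Phi (g ^\-)%R.
have mSp := measurable_shift_integral Phi_mono mgp gp0.
have mSn := measurable_shift_integral Phi_mono mgn gn0.
have Sp0 x := shift_integral_ge0 Phi x gp0.
have Sn0 x := shift_integral_ge0 Phi x gn0.
have bp := shift_integral_sqr Phi_mono Phi_ge Phi_le mgp gp0.
have bn := shift_integral_sqr Phi_mono Phi_ge Phi_le mgn gn0.
have lt2 f : L2 f -> ((delta ^+ 2)%:E * \int[mu3]_x (f x ^+ 2)%:E < +oo)%E.
  by move=> /fin h; rewrite lte_mul_pinfty// lee_fin sqr_ge0.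
have [LSp Sp2] := L2_fine mSp Sp0 (le_lt_trans bp (lt2 _ Lgp)).
have [LSn Sn2] := L2_fine mSn Sn0 (le_lt_trans bn (lt2 _ Lgn)).
have Lpu : L2 (pull u).
  apply: pull_L2 => //; rewrite (_ : (fun _ => _) = (fun y => nu y.1.1 * u y)); last first.
    by apply/funext => y; rewrite mulrC.
  apply: (@L2_boundedM R _ (fun y => nu y.1.1) 2) => //; first exact: measurable_coord1.
  by move=> y; rewrite ger0_norm// ltW.
pose h x := fine (Sp x) - fine (Sn x).
have LB (p q : R * R * R -> R) : L2 p -> L2 q -> L2 (fun x => p x - q x).
  move=> Lp Lq; rewrite (_ : (fun _ => _) = (fun x => p x + (-1) * q x)); last first.
    by apply/funext => x; rewrite mulN1r.
  by apply: L2D => //; exact: L2Z.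
have Lh : L2 h by exact: LB.
have Lw : L2 (fun x => u x - pull u x) by exact: LB.
have intB (p q f : R * R * R -> R) : L2 p -> L2 q -> L2 f ->
    \int[mu3]_x ((p x - q x) * f x) = \int[mu3]_x (p x * f x) - \int[mu3]_x (q x * f x).
  move=> Lp Lq Lf; rewrite -RintegralB//; last 2 first.
  - exact: L2M.
  - exact: L2M.
  by apply: eq_Rintegral => x _; rewrite mulrBl.
have wh : {ae mu3, forall x, (u x - pull u x) - h x = 0}.
  apply: du_bois_reymond; first exact: LB.
  move=> b tb; have tf := product_test_test tb; have Lf := test_function_L2 tf.
  have [sb b0 [N N0 bN]] := tb.
  have [B dB] := primitive_exists (smooth1_continuous (sb ord0)) (bN ord0).
  rewrite !intB//.
  rewrite (shift_prod3_fine tb dB mgp gp0 (fin _ Lgp)).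
  rewrite (shift_prod3_fine tb dB mgn gn0 (fin _ Lgn)).
  have tP := product_test_stretch tb dB.
  have PE x : prod3 (upd3 b ord0 (fun s => B (Phi s) - B s)) x =
      (-1) * prod3 (upd3 b ord0 (fun s => B s - B (Phi s))) x.
    by rewrite !prod3_upd mulN1r -mulrN opprB.
  have LP : L2 (prod3 (upd3 b ord0 (fun s => B (Phi s) - B s))).
    by rewrite (funext PE); apply: L2Z; exact: test_function_L2.
  rewrite -(intB _ _ _ Lgp Lgn LP).
  under [X in _ - X]eq_Rintegral do rewrite gpn.
  have mf : measurable_fun [set: T3 R] (prod3 b) by exact: L2_measurable.
  rewrite (sub_stretch (f := fun x => pull u x * prod3 b x)); last first.
    by apply: measurable_funM => //; exact: measurable_pull.
  (* (B - B o Phi)' = b - nu^2 (b o Phi) is exactly the weight multiplying [u] once the integral of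
     [pull u] is written in the stretched variable. *)
  have dBP s : is_derive s (1 : R) (fun s => B s - B (Phi s)) (b ord0 s - nu s ^+ 2 * b ord0 (Phi s)).
    have d1 := dB s; have d2 := @is_derive1_comp R B Phi s _ _ (dB (Phi s)) (PhiD s).
    have := is_deriveB d1 d2; rewrite (mulrC (b ord0 (Phi s))); exact.
  have pE x : partial ord0 (prod3 (upd3 b ord0 (fun s => B s - B (Phi s)))) x =
      prod3 b x - prod3 b (stretch Phi x) * nu x.1.1 ^+ 2.
    have hd := is_derive_prod3 (b := upd3 b ord0 (fun s => B s - B (Phi s))) x (i := ord0)
       (d := fun s => b ord0 s - nu s ^+ 2 * b ord0 (Phi s)).
    have {}hd := hd dBP; rewrite /partial (@derive_val _ _ _ _ _ _ _ hd).
    rewrite prod3_upd; set q := \prod_(j < 3 | _) _.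
    have -> : q = \prod_(j < 3 | j != ord0) b j (coord j x).
      by apply: eq_bigr => j /negbTE; rewrite /upd3 => ->.
    have -> : prod3 b (stretch Phi x) = (\prod_(j < 3 | j != ord0) b j (coord j x)) * b ord0 (Phi x.1.1).
      by rewrite -(prod3_slice b ord0 x (Phi x.1.1)).
    have -> : prod3 b x = (\prod_(j < 3 | j != ord0) b j (coord j x)) * b ord0 x.1.1.
      by rewrite -(prod3_slice b ord0 x x.1.1); congr (prod3 b _); case: x {hd q} => -[].
    by rewrite /coord/= mulrBr -mulrA (mulrC (b ord0 _)).
  rewrite -RintegralB//; last 2 first.
  - exact: L2M.
  - have mpf : measurable_fun [set: T3 R] (fun x => pull u x * prod3 b x).
      by apply: measurable_funM => //; exact: measurable_pull.
    exact: (integrable_stretch PhiD cnu2 nu2_ge0 Phi_mono phiK mpf).1 (L2M Lpu Lf).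
  transitivity (\int[mu3]_x (u x * partial ord0 (prod3 (upd3 b ord0 (fun s => B s - B (Phi s)))) x) -
     \int[mu3]_x (g x * prod3 (upd3 b ord0 (fun s => B (Phi s) - B s)) x)).
    congr (_ - _); apply: eq_Rintegral => x _; rewrite pE pull_stretch.
    by ring.
  rewrite ug//; apply/eqP; rewrite subr_eq0; apply/eqP.
  under [RHS]eq_Rintegral do rewrite PE mulN1r mulrN -mulN1r.
  rewrite RintegralZl ?mulN1r//; apply: L2M => //; exact: test_function_L2.
have sqE (f : R * R * R -> R) : L2 f -> (\int[mu3]_x (f x ^+ 2)%:E = (\int[mu3]_x (f x ^+ 2))%:E)%E.
  by move=> Lf; rewrite fineK// (integrable_fin_num measurableT (L2_sqr Lf)).
have -> : \int[mu3]_x ((u x - pull u x) ^+ 2) = \int[mu3]_x (h x ^+ 2).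
  congr fine; apply: ae_eq_integral => //.
  - by apply/measurable_EFinP; apply: measurable_funX; exact: L2_measurable.
  - by apply/measurable_EFinP; apply: measurable_funX; exact: L2_measurable.
  apply: filterS wh; first exact: (ae_filter_ringOfSetsType mu3).
  by move=> x /eqP; rewrite subr_eq0 => /eqP ->.
have Ip := L2_sqr LSp; have In := L2_sqr LSn.
(* Origin of the factor 2: (a - b)^2 <= 2 (a^2 + b^2). The two bounds then add up, since the squares
   of the positive and negative parts of [g] sum to g^2. *)
apply: (@le_trans _ _ (\int[mu3]_x (2 * (fine (Sp x) ^+ 2 + fine (Sn x) ^+ 2)))).
  apply: le_Rintegral => //.
  - exact: (L2_sqr Lh).
  - exact: (integrableZl measurableT 2 (integrableD measurableT Ip In)).
  - move=> x _; rewrite -subr_ge0.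
    rewrite (_ : _ - _ = (fine (Sp x) + fine (Sn x)) ^+ 2) ?sqr_ge0//.
    by rewrite /h; ring.
rewrite RintegralZl//; last exact: (integrableD measurableT Ip In).
rewrite RintegralD//.
have {}bp := le_trans Sp2 bp; have {}bn := le_trans Sn2 bn.
rewrite !sqE// -EFinM lee_fin in bp; rewrite !sqE// -EFinM lee_fin in bn.
rewrite -mulrA ler_pM2l//; apply: le_trans (lerD bp bn) _.
rewrite -mulrDr -RintegralD//; last 2 first.
- exact: (L2_sqr Lgp).
- exact: (L2_sqr Lgn).
by under eq_Rintegral do rewrite gsq.
Qed.

End stretched.

(** * The Coulomb energy as a superposition of squares *)

Section gaussian.
Context {R : realType}.
Local Notation mu := (@lebesgue_measure R).

Lemma integral_gaussian (l m : R) : 0 < l ->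
  (\int[mu]_z (expR (- (l * (z - m) ^+ 2)))%:E = (Num.sqrt (pi / l))%:E)%E.
Proof.
(* [s] is the standard deviation of the normal law whose density is proportional to the
   integrand. *)
move=> l0; pose s := Num.sqrt (2 * l)^-1.
have s2 : s ^+ 2 = (2 * l)^-1 by rewrite sqr_sqrtr// invr_ge0 mulr_ge0// ltW.
have s0 : s != 0 by rewrite sqrtr_eq0 -ltNge invr_gt0 mulr_gt0.
have l1 : l != 0 by rewrite gt_eqF.
have pk : normal_peak s = (Num.sqrt (pi / l))^-1.
  rewrite /normal_peak s2; congr (Num.sqrt _)^-1; rewrite -mulr_natr; field.
  by rewrite l1.
have p0 : 0 < Num.sqrt (pi / l) by rewrite sqrtr_gt0 divr_gt0// pi_gt0.
transitivity (\int[mu]_z ((Num.sqrt (pi / l))%:E * (normal_pdf m s z)%:E))%E.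
  apply: eq_integral => z _; rewrite -EFinM.
  have -> : normal_pdf m s z = normal_peak s * normal_fun m s z by rewrite normal_pdfE.
  rewrite pk mulVKf ?gt_eqF// /normal_fun.
  congr (expR _)%:E; rewrite s2 -mulr_natr; field.
  by rewrite l1.
rewrite ge0_integralZl//.
- by rewrite integral_normal_pdf mule1.
- by apply/measurable_EFinP; exact: measurable_normal_pdf.
- by move=> z _; rewrite lee_fin normal_pdf_ge0.
Qed.

(* o = (s, z) collects an inverse width and a centre: integrating the product of
   the kernels at x and y over z gives a multiple of exp (- s^2 |x - y|^2) / |s|^3,
   and integrating exp (- s^2 |x - y|^2) over s a multiple of 1 / |x - y|. *)
Definition gauss_ker (o : R * (R * R * R)) (x : R * R * R) : R :=
  expR (- (2 * o.1 ^+ 2 * ((x.1.1 - o.2.1.1) ^+ 2 + (x.1.2 - o.2.1.2) ^+ 2 + (x.2 - o.2.2) ^+ 2))).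

Lemma gauss_ker_ge0 o x : 0 <= gauss_ker o x.
Proof. exact: expR_ge0. Qed.

(** Completing the square: (a - z)^2 + (b - z)^2 = 2 (z - (a + b) / 2)^2 + (a - b)^2 / 2. *)
Let gauss1 (s a b : R) : s != 0 ->
  (\int[mu]_z (expR (- (2 * s ^+ 2 * ((a - z) ^+ 2 + (b - z) ^+ 2))))%:E =
   (expR (- (s ^+ 2 * (a - b) ^+ 2)) * (Num.sqrt pi / 2 / `|s|))%:E)%E.
Proof.
move=> s0.
have s2 : 0 < 4 * s ^+ 2 by rewrite mulr_gt0// exprn_even_gt0.
transitivity (\int[mu]_z ((expR (- (s ^+ 2 * (a - b) ^+ 2)))%:E *
    (expR (- (4 * s ^+ 2 * (z - (a + b) / 2) ^+ 2)))%:E))%E.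
  by apply: eq_integral => z _; rewrite -EFinM -expRD; congr (expR _)%:E; field.
have mg : measurable_fun [set: measurableTypeR R] (fun z => (expR (- (4 * s ^+ 2 * (z - (a + b) / 2) ^+ 2)))%:E).
  apply/measurable_EFinP; apply: measurableT_comp => //; apply: measurableT_comp => //.
  by apply: measurable_funM => //; apply: measurable_funX; exact: measurable_funB.
rewrite (ge0_integralZl mu measurableT mg); last 2 first.
- by move=> z _; rewrite lee_fin expR_ge0.
- by rewrite lee_fin expR_ge0.
rewrite integral_gaussian// -EFinM; congr (_ * _)%:E.
rewrite sqrtrM ?pi_ge0// -mulrA; congr (_ * _).
rewrite -invfM; apply: (@mulfI _ (2 * `|s|)); first by rewrite mulf_neq0// normr_eq0.
rewrite divff; last by rewrite mulf_neq0// normr_eq0.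
rewrite -[2 * `|s|]ger0_norm ?mulr_ge0// -sqrtr_sqr -sqrtrM ?sqr_ge0//.
rewrite exprMn real_normK ?num_real// (_ : 2 ^+ 2 = 4); last by ring.
by rewrite divff ?sqrtr1// gt_eqF.
Qed.

Lemma enorm3_sqr (x : R * R * R) : enorm3 x ^+ 2 = x.1.1 ^+ 2 + x.1.2 ^+ 2 + x.2 ^+ 2.
Proof. by rewrite sqr_sqrtr// !addr_ge0// sqr_ge0. Qed.

Lemma enorm3_ge0 (x : R * R * R) : 0 <= enorm3 x.
Proof. exact: sqrtr_ge0. Qed.

(** One factor sqrt pi / 2 for each coordinate of the centre, and sqrt pi for the integral of exp (-
    s^2 |x - y|^2) over s, which is sqrt pi / |x - y|. *)
Definition coulomb_cst : R := (Num.sqrt pi / 2) ^+ 3 * Num.sqrt pi.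

Lemma coulomb_cst_gt0 : 0 < coulomb_cst.
Proof.
have := pi_gt0 R; rewrite -sqrtr_gt0 => h.
by rewrite mulr_gt0// exprn_gt0// divr_gt0.
Qed.

Let measurable_ker1 (s a b : R) : measurable_fun [set: measurableTypeR R]
  (fun z : R => (expR (- (2 * s ^+ 2 * ((a - z) ^+ 2 + (b - z) ^+ 2))))%:E : \bar R).
Proof.
apply/measurable_EFinP; apply: measurableT_comp => //; apply: measurableT_comp => //.
apply: measurable_funM => //; apply: measurable_funD; apply: measurable_funX;
exact: measurable_funB.
Qed.

Lemma measurable_gauss_ker : measurable_fun [set: (measurableTypeR R * T3 R) * T3 R]
  (fun p : (measurableTypeR R * T3 R) * T3 R => gauss_ker p.1 p.2).
Proof.
have mx (c : T3 R -> measurableTypeR R) : measurable_fun setT c ->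
    measurable_fun [set: (measurableTypeR R * T3 R) * T3 R] (fun p => (c p.2 - c p.1.2) ^+ 2).
  move=> mc; apply: measurable_funX; apply: measurable_funB.
    exact: (measurableT_comp mc measurable_snd).
  exact: (measurableT_comp mc (measurableT_comp measurable_snd measurable_fst)).
apply: measurableT_comp => //; apply: measurableT_comp => //.
apply: measurable_funM.
  apply: measurable_funM => //; apply: measurable_funX.
  exact: (measurableT_comp measurable_fst measurable_fst).
apply: measurable_funD.
  apply: measurable_funD.
    exact: (mx _ (measurableT_comp measurable_fst measurable_fst)).
  exact: (mx _ (measurableT_comp measurable_snd measurable_fst)).
exact: (mx _ measurable_snd).
Qed.

Local Open Scope ereal_scope.

(** The kernel factors over the coordinates, so [gauss1] applies three times. *)
Let gauss3 (s : R) (x y : R * R * R) : (s != 0)%R ->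
  \int[leb3 R]_z (gauss_ker (s, z) x * gauss_ker (s, z) y)%:E =
  (expR (- (s ^+ 2 * enorm3 (x - y) ^+ 2)) * (Num.sqrt pi / 2 / `|s|) ^+ 3)%:E.
Proof.
move=> s0; rewrite ge0_integral_leb3; last 2 first.
- by move=> z; rewrite lee_fin mulr_ge0// gauss_ker_ge0.
- have mk (u : T3 R) : measurable_fun [set: T3 R] (fun z : T3 R => gauss_ker (s, z) u).
    have mp : measurable_fun [set: T3 R] (fun z : T3 R => ((s, z), u)).
      by do 2 apply: measurable_fun_pair => //.
    exact: (measurableT_comp measurable_gauss_ker mp).
  by apply/measurable_EFinP; exact: measurable_funM.
pose q (a b z : R) := expR (- (2 * s ^+ 2 * ((a - z) ^+ 2 + (b - z) ^+ 2))).
have q0 a b z : 0 <= (q a b z)%:E by rewrite lee_fin expR_ge0.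
pose Q (a b : R) := (expR (- (s ^+ 2 * (a - b) ^+ 2)) * (Num.sqrt pi / 2 / `|s|))%R.
have Q0 a b : 0 <= (Q a b)%:E by rewrite lee_fin mulr_ge0// ?expR_ge0// divr_ge0// divr_ge0// sqrtr_ge0.
have E a b c : 0 <= c -> \int[mu]_z (c * (q a b z)%:E) = c * (Q a b)%:E.
  move=> c0; rewrite (ge0_integralZl mu measurableT (measurable_ker1 s a b))//.
  by rewrite gauss1.
transitivity (\int[mu]_c \int[mu]_b \int[mu]_a
    ((q x.2 y.2 c)%:E * (q x.1.2 y.1.2 b)%:E * (q x.1.1 y.1.1 a)%:E)).
  apply: eq_integral => c _; apply: eq_integral => b _; apply: eq_integral => a _.
  rewrite -!EFinM /q /gauss_ker -!expRD/=; congr (expR _)%:E; ring.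
transitivity (\int[mu]_c \int[mu]_b ((q x.2 y.2 c)%:E * (Q x.1.1 y.1.1)%:E * (q x.1.2 y.1.2 b)%:E)).
  apply: eq_integral => c _; apply: eq_integral => b _.
  by rewrite E ?mule_ge0// muleAC.
transitivity (\int[mu]_c ((Q x.1.1 y.1.1)%:E * (Q x.1.2 y.1.2)%:E * (q x.2 y.2 c)%:E)).
  apply: eq_integral => c _; rewrite E ?mule_ge0//.
  by rewrite muleC muleA muleAC (muleC (Q x.1.2 y.1.2)%:E).
rewrite E ?mule_ge0// -!EFinM; congr EFin.
rewrite /Q enorm3_sqr/= (_ : - (s ^+ 2 * ((x.1.1 - y.1.1) ^+ 2 + (x.1.2 - y.1.2) ^+ 2 + (x.2 - y.2) ^+ 2)) = - (s ^+ 2 * (x.1.1 - y.1.1) ^+ 2) +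
  - (s ^+ 2 * (x.1.2 - y.1.2) ^+ 2) + - (s ^+ 2 * (x.2 - y.2) ^+ 2))%R; last by ring.
rewrite !expRD; ring.
Qed.

Lemma coulomb_gauss (x y : R * R * R) : x != y ->
  \int[mu]_s \int[leb3 R]_z (`|s| ^+ 3 * (gauss_ker (s, z) x * gauss_ker (s, z) y))%:E =
  (coulomb_cst / enorm3 (x - y))%:E.
Proof.
move=> xy.
have Q0 : (0 < enorm3 (x - y) ^+ 2)%R.
  rewrite enorm3_sqr lt_neqAle !addr_ge0 ?sqr_ge0// andbT eq_sym.
  rewrite !paddr_eq0 ?addr_ge0 ?sqr_ge0// !sqrf_eq0 !subr_eq0.
  apply: contra xy => /andP[/andP[/eqP a /eqP b] /eqP c].
  by apply/eqP; apply: injective_projections => //; exact: injective_projections.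
have N0 : (0 < enorm3 (x - y))%R by rewrite lt_neqAle enorm3_ge0 andbT eq_sym -sqrf_eq0 gt_eqF.
pose f (s : R) := (expR (- (enorm3 (x - y) ^+ 2 * (s - 0) ^+ 2)))%:E.
have mf : measurable_fun [set: measurableTypeR R] f.
  apply/measurable_EFinP; apply: measurableT_comp => //; apply: measurableT_comp => //.
  by apply: measurable_funM => //; apply: measurable_funX; exact: measurable_funB.
have mk (s : R) (u : T3 R) : measurable_fun [set: T3 R] (fun z : T3 R => gauss_ker (s, z) u).
  have mp : measurable_fun [set: T3 R] (fun z : T3 R => ((s, z), u)).
    by do 2 apply: measurable_fun_pair => //.
  exact: (measurableT_comp measurable_gauss_ker mp).
have E (s : R) : (s != 0)%R ->
    \int[leb3 R]_z (`|s| ^+ 3 * (gauss_ker (s, z) x * gauss_ker (s, z) y))%:E =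
    ((Num.sqrt pi / 2) ^+ 3)%:E * f s.
  move=> s0; under eq_integral do rewrite EFinM.
  have mm : measurable_fun [set: T3 R] (fun z => (gauss_ker (s, z) x * gauss_ker (s, z) y)%:E).
    by apply/measurable_EFinP; exact: measurable_funM.
  rewrite (ge0_integralZl (leb3 R) measurableT mm); last 2 first.
  - by move=> z _; rewrite lee_fin mulr_ge0// gauss_ker_ge0.
  - by rewrite lee_fin exprn_ge0.
  rewrite gauss3// /f -!EFinM; congr EFin; rewrite subr0 [in RHS](mulrC (enorm3 (x - y) ^+ 2)%R).
  by field; rewrite normr_eq0.
transitivity (\int[mu]_s (((Num.sqrt pi / 2) ^+ 3)%:E * f s)).
  have mp (u : T3 R) : measurable_fun [set: measurableTypeR R * T3 R] (fun sz => gauss_ker sz u).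
    have mp : measurable_fun [set: measurableTypeR R * T3 R] (fun sz => (sz, u)).
      exact: measurable_fun_pair.
    exact: (measurableT_comp measurable_gauss_ker mp).
  have mF : measurable_fun [set: measurableTypeR R * T3 R]
      (fun sz => (`|sz.1| ^+ 3 * (gauss_ker sz x * gauss_ker sz y))%:E).
    apply/measurable_EFinP; apply: measurable_funM; last exact: measurable_funM.
    by apply: measurable_funX; exact: measurableT_comp.
  have F0 sz : 0 <= (`|sz.1| ^+ 3 * (gauss_ker sz x * gauss_ker sz y))%:E.
    by rewrite lee_fin mulr_ge0 ?exprn_ge0// mulr_ge0// gauss_ker_ge0.
  apply: ge0_ae_eq_integral => //.
  - exact: (@measurable_fun_fubini_tonelli_F _ _ (measurableTypeR R) (T3 R) R (sfleb3 (R := R)) _ mF F0).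
  - exact: emeasurable_funM.
  - by move=> s _; apply: integral_ge0 => z _; exact: (F0 (s, z)).
  - by move=> s _; rewrite mule_ge0// lee_fin ?expR_ge0// exprn_ge0// divr_ge0// sqrtr_ge0.
  (* At s = 0 the weight |s|^3 vanishes instead of cancelling |s|^-3; a single point is
     negligible. *)
  exists [set 0%R]; split; [by []|exact: lebesgue_measure_set1|].
  move=> s /= h; apply: contrapT => /eqP s0; apply: h => _; exact: E.
rewrite (ge0_integralZl mu measurableT mf); last 2 first.
- by move=> s _; rewrite lee_fin expR_ge0.
- by rewrite lee_fin exprn_ge0// divr_ge0// sqrtr_ge0.
rewrite /f integral_gaussian// -EFinM /coulomb_cst; congr EFin.
rewrite (sqrtrM _ (pi_ge0 R)) (sqrtrV (ltW Q0)) sqrtr_sqr (ger0_norm (ltW N0)).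
by rewrite mulrA.
Qed.

End gaussian.

Arguments coulomb_cst : clear implicits.

Section convex_ereal.
Context {R : realType}.
Local Open Scope ereal_scope.

(** For finite values the defect is (1 - t) t (a - b)^2. If [a] or [b] is infinite, so is the
    right-hand side, because both weights are positive. *)
Lemma ereal_sqr_convex (t : R) (a b c : \bar R) : (0 < t < 1)%R -> 0 <= a -> 0 <= b -> 0 <= c ->
  c <= (1 - t)%:E * a + t%:E * b -> c * c <= (1 - t)%:E * (a * a) + t%:E * (b * b).
Proof.
move=> /andP[t0 t1]; have t1' : (0 < 1 - t)%R by rewrite subr_gt0.
case: a => [a|_|//]; case: b => [b|_|//]; case: c => [c|//|//] /=.
- rewrite !lee_fin => a0 b0 c0 h.
  have {}h : (c <= (1 - t) * a + t * b)%R by rewrite -lee_fin EFinD !EFinM.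
  suff : (c * c <= (1 - t) * (a * a) + t * (b * b))%R by rewrite -lee_fin EFinD !EFinM.
  apply: (@le_trans _ _ (((1 - t) * a + t * b) ^+ 2)%R).
    by rewrite -expr2 lerXn2r// nnegrE// addr_ge0// mulr_ge0// ltW.
  rewrite -subr_ge0 (_ : _ - _ = (1 - t) * t * (a - b) ^+ 2)%R; last by ring.
  by apply: mulr_ge0; [apply: mulr_ge0; exact: ltW|exact: sqr_ge0].
- by move=> *; rewrite mulyy gt0_muley ?lte_fin// addey ?leey.
- by move=> *; rewrite mulyy gt0_muley ?lte_fin// addey ?leey.
- by move=> *; rewrite mulyy gt0_muley ?lte_fin// addye ?leey.
- by move=> *; rewrite mulyy gt0_muley ?lte_fin// addye ?leey.
- by move=> *; rewrite mulyy !gt0_muley ?lte_fin// addye ?leey.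
Qed.

Lemma ge0_integral_convex d (T : measurableType d) (mu : {measure set T -> \bar R})
    (t : R) (f g h : T -> \bar R) : (0 < t < 1)%R ->
  measurable_fun setT f -> measurable_fun setT g -> measurable_fun setT h ->
  (forall x, 0 <= f x) -> (forall x, 0 <= g x) -> (forall x, 0 <= h x) ->
  (forall x, h x <= (1 - t)%:E * f x + t%:E * g x) ->
  \int[mu]_x h x <= (1 - t)%:E * \int[mu]_x f x + t%:E * \int[mu]_x g x.
Proof.
move=> /andP[t0 t1] mf mg mh f0 g0 h0 hfg.
have t1' : (0 <= 1 - t)%R by rewrite subr_ge0 ltW.
rewrite -(ge0_integralZl mu measurableT mf (fun x _ => f0 x))//.
rewrite -(ge0_integralZl mu measurableT mg (fun x _ => g0 x)); last by rewrite lee_fin ltW.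
have f1 x : 0 <= (1 - t)%:E * f x by rewrite mule_ge0.
have g1 x : 0 <= t%:E * g x by rewrite mule_ge0// lee_fin ltW.
rewrite -ge0_integralD//; [|exact: emeasurable_funM|exact: emeasurable_funM].
have mr : measurable_fun setT (fun x => (1 - t)%:E * f x + t%:E * g x).
  by apply: emeasurable_funD; exact: emeasurable_funM.
exact: (ge0_le_integral mu measurableT (fun x _ => h0 x) mh mr (fun x _ => hfg x)).

Qed.

End convex_ereal.

Section coulomb.
Context {R : realType}.
Local Notation mu := (@lebesgue_measure R).
Local Notation mu3 := (leb3 R).
Implicit Types u v w : R * R * R -> R.
Local Open Scope ereal_scope.

Definition coulomb u : \bar R :=
  \int[mu3]_x \int[mu3]_y (`|u x| ^+ 2 * `|u y| ^+ 2 / enorm3 (x - y))%:E.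

Let om : {sigma_finite_measure set (measurableTypeR R * T3 R)%type -> \bar R} :=
  sfprod mu (sfleb3 (R := R)).

Definition gauss_avg u (o : R * (R * R * R)) : \bar R :=
  \int[mu3]_x (u x ^+ 2 * gauss_ker o x)%:E.

Lemma gauss_avg_ge0 u o : 0 <= gauss_avg u o.
Proof. by apply: integral_ge0 => x _; rewrite lee_fin mulr_ge0 ?sqr_ge0// gauss_ker_ge0. Qed.

Lemma measurable_inv_enorm3 : measurable_fun [set: T3 R * T3 R]
  (fun p : T3 R * T3 R => (enorm3 (p.1 - p.2 : R * R * R))^-1%R).
Proof.
rewrite (_ : (fun _ => _) = (fun p : T3 R * T3 R =>
    ((p.1.1.1 - p.2.1.1) ^+ 2 + (p.1.1.2 - p.2.1.2) ^+ 2 + (p.1.2 - p.2.2) ^+ 2) `^ (- 2^-1))%R); last first.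
  apply/funext => p; rewrite powRN powR12_sqrt//.
  by rewrite !addr_ge0// sqr_ge0.
have mx (c : T3 R -> measurableTypeR R) : measurable_fun setT c ->
    measurable_fun [set: T3 R * T3 R] (fun p => (c p.1 - c p.2) ^+ 2)%R.
  move=> mc; apply: measurable_funX; apply: measurable_funB.
    exact: (measurableT_comp mc measurable_fst).
  exact: (measurableT_comp mc measurable_snd).
apply: (measurableT_comp (measurable_powR _)).
apply: measurable_funD; last exact: (mx _ measurable_snd).
apply: measurable_funD.
  exact: (mx _ (measurableT_comp measurable_fst measurable_fst)).
exact: (mx _ (measurableT_comp measurable_snd measurable_fst)).
Qed.

Let set1_prod (x : T3 R) : [set x] = ([set x.1.1] `*` [set x.1.2]) `*` [set x.2].
Proof. by apply/seteqP; split => [y -> //|[[a b] c] [[/= -> ->] ->]]; case: x => -[]. Qed.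

Lemma measurable_set1_leb3 (x : T3 R) : measurable [set x].
Proof. by rewrite set1_prod; apply: measurableX => //; exact: measurableX. Qed.

Lemma leb3_set1 (x : T3 R) : mu3 [set x] = 0.
Proof.
rewrite set1_prod.
transitivity (leb2 ([set x.1.1] `*` [set x.1.2]) * mu [set x.2]).
  by apply: product_measure1E => //; exact: measurableX.
by rewrite lebesgue_measure_set1 mule0.
Qed.

Let W (o : R * (R * R * R)) : R := (`|o.1| ^+ 3)%R.

Let W0 o : (0 <= W o)%R. Proof. by rewrite exprn_ge0. Qed.

Let mW : measurable_fun [set: measurableTypeR R * T3 R] W.
Proof. by apply: measurable_funX; exact: measurableT_comp. Qed.

Let mKu (x : T3 R) : measurable_fun [set: measurableTypeR R * T3 R] (gauss_ker^~ x).
Proof.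
have mp : measurable_fun [set: measurableTypeR R * T3 R] (fun o => (o, x)).
  exact: measurable_fun_pair.
exact: (measurableT_comp measurable_gauss_ker mp).
Qed.

Let mKo (o : measurableTypeR R * T3 R) : measurable_fun [set: T3 R] (gauss_ker o).
Proof.
have mp : measurable_fun [set: T3 R] (fun x => (o, x)).
  exact: measurable_fun_pair.
exact: (measurableT_comp measurable_gauss_ker mp).
Qed.

Lemma measurable_gauss_avg u : measurable_fun [set: T3 R] u ->
  measurable_fun [set: measurableTypeR R * T3 R] (gauss_avg u).
Proof.
move=> mu_.
apply: (@measurable_fun_fubini_tonelli_F _ _ (measurableTypeR R * T3 R)%type (T3 R) R (sfleb3 (R := R))
  (fun p => (u p.2 ^+ 2 * gauss_ker p.1 p.2)%:E)).
  apply/measurable_EFinP; apply: measurable_funM; last exact: measurable_gauss_ker.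
  by apply: measurable_funX; exact: (measurableT_comp mu_ measurable_snd).
by move=> p; rewrite lee_fin mulr_ge0 ?sqr_ge0// gauss_ker_ge0.
Qed.

Let coulomb_ker (x y : R * R * R) : x != y ->
  (coulomb_cst R / enorm3 (x - y))%:E = \int[om]_o (W o * (gauss_ker o x * gauss_ker o y))%:E.
Proof.
move=> xy; rewrite -coulomb_gauss//; apply/esym.
apply: (@fubini_tonelli1 _ _ (measurableTypeR R) (T3 R) R mu (sfleb3 (R := R))
  (fun o => (W o * (gauss_ker o x * gauss_ker o y))%:E)).
  by apply/measurable_EFinP; apply: measurable_funM => //; exact: measurable_funM.
by move=> o; rewrite lee_fin mulr_ge0// mulr_ge0// gauss_ker_ge0.
Qed.

(* Convexity of the Coulomb energy comes from here: gauss_avg u o is nonnegative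
   and convex in u, hence so is its square. *)
Lemma coulombE u : measurable_fun [set: T3 R] u ->
  (coulomb_cst R)%:E * coulomb u = \int[om]_o ((W o)%:E * (gauss_avg u o * gauss_avg u o)).
Proof.
move=> mu_.
have C0 : (0 <= coulomb_cst R)%R by rewrite ltW// coulomb_cst_gt0.
have mu2 : measurable_fun [set: T3 R] (fun x => `|u x| ^+ 2)%R.
  by apply: measurable_funX; exact: measurableT_comp.
have usq x : (`|u x| ^+ 2 = u x ^+ 2)%R by rewrite real_normK// num_real.
pose F x y o : R := (`|u x| ^+ 2 * `|u y| ^+ 2 * (W o * (gauss_ker o x * gauss_ker o y)))%R.
have F0 x y o : (0 <= F x y o)%R.
  by rewrite !mulr_ge0 ?exprn_ge0// gauss_ker_ge0.
have mk (x : T3 R) : measurable_fun [set: T3 R] (fun y : T3 R => (enorm3 (x - y : R * R * R))^-1%R).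
  have mp : measurable_fun [set: T3 R] (fun y => (x, y)) by exact: measurable_fun_pair.
  exact: (measurableT_comp measurable_inv_enorm3 mp).
have mI (x : T3 R) : measurable_fun [set: T3 R] (fun y : T3 R => (`|u x| ^+ 2 * `|u y| ^+ 2 / enorm3 (x - y : R * R * R))%:E).
  by apply/measurable_EFinP; apply: measurable_funM => //; exact: measurable_funM.
have I0 x y : 0 <= (`|u x| ^+ 2 * `|u y| ^+ 2 / enorm3 (x - y))%:E.
  by rewrite lee_fin divr_ge0 ?enorm3_ge0// mulr_ge0// exprn_ge0.
have mKK d (T : measurableType d) (a b : T -> T3 R) (o : T -> measurableTypeR R * T3 R) :
    measurable_fun setT a -> measurable_fun setT b -> measurable_fun setT o ->
    measurable_fun setT (fun t => (F (a t) (b t) (o t))%:E).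
  move=> ma mb mo; apply/measurable_EFinP; apply: measurable_funM.
    by apply: measurable_funM; [exact: (measurableT_comp mu2 ma)|exact: (measurableT_comp mu2 mb)].
  apply: measurable_funM; first exact: (measurableT_comp mW mo).
  have moa : measurable_fun setT (fun t => (o t, a t)) by exact: measurable_fun_pair.
  have mob : measurable_fun setT (fun t => (o t, b t)) by exact: measurable_fun_pair.
  exact: (measurable_funM (measurableT_comp measurable_gauss_ker moa)
    (measurableT_comp measurable_gauss_ker mob)).
have F0E x y o : 0 <= (F x y o)%:E by rewrite lee_fin.
transitivity (\int[mu3]_x \int[mu3]_y \int[om]_o (F x y o)%:E).
  have mIx : measurable_fun [set: T3 R] (fun x => \int[mu3]_y (`|u x| ^+ 2 * `|u y| ^+ 2 / enorm3 (x - y))%:E).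
    apply: (@measurable_fun_fubini_tonelli_F _ _ (T3 R) (T3 R) R (sfleb3 (R := R))
      (fun p => (`|u p.1| ^+ 2 * `|u p.2| ^+ 2 / enorm3 (p.1 - p.2 : R * R * R))%:E)).
      apply/measurable_EFinP; apply: measurable_funM; last exact: measurable_inv_enorm3.
      by apply: measurable_funM; [exact: (measurableT_comp mu2 measurable_fst)|exact: (measurableT_comp mu2 measurable_snd)].
    by move=> p; exact: I0.
  rewrite /coulomb -(ge0_integralZl mu3 measurableT mIx); last 2 first.
  - by move=> x _; exact: integral_ge0.
  - by rewrite lee_fin.
  apply: eq_integral => x _.
  rewrite -(ge0_integralZl mu3 measurableT (mI x)); last 2 first.
  - by move=> y _; exact: I0.
  - by rewrite lee_fin.
  apply: ge0_ae_eq_integral => //.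
  - exact: emeasurable_funM.
  - apply: (@measurable_fun_fubini_tonelli_F _ _ (T3 R) (measurableTypeR R * T3 R)%type R om
      (fun p => (F x p.1 p.2)%:E)) => //.
    exact: (mKK _ _ (fun=> x)).
  - by move=> y _; rewrite mule_ge0// lee_fin.
  - by move=> y _; exact: integral_ge0.
  (* On the diagonal the quotient takes the default value 0 and the Gaussian formula does not apply;
     the point x is negligible. *)
  exists [set x]; split; [exact: measurable_set1_leb3|exact: leb3_set1|].
  move=> y /= h; apply: contrapT => yx; apply: h => _.
  have xy : x != y by apply/eqP => e; apply: yx.
  rewrite -EFinM mulrCA EFinM coulomb_ker// -ge0_integralZl//.
  - by apply/measurable_EFinP; apply: measurable_funM => //; exact: measurable_funM.
  - by move=> o _; rewrite lee_fin mulr_ge0// mulr_ge0// gauss_ker_ge0.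
transitivity (\int[mu3]_x \int[om]_o \int[mu3]_y (F x y o)%:E).
  apply: eq_integral => x _.
  apply: (@fubini_tonelli _ _ (T3 R) (measurableTypeR R * T3 R)%type R (sfleb3 (R := R)) om
    (fun p => (F x p.1 p.2)%:E)) => //.
  exact: (mKK _ _ (fun=> x)).
have inner x o : \int[mu3]_y (F x y o)%:E = ((W o)%:E * (`|u x| ^+ 2 * gauss_ker o x)%:E) * gauss_avg u o.
  rewrite /gauss_avg -EFinM -ge0_integralZl//.
  - by apply: eq_integral => y _; rewrite -EFinM /F !usq; congr EFin; ring.
  - apply/measurable_EFinP; apply: measurable_funM; last exact: mKo.
    exact: measurable_funX.
  - by move=> y _; rewrite lee_fin mulr_ge0 ?sqr_ge0// gauss_ker_ge0.
  - by rewrite lee_fin mulr_ge0// mulr_ge0// ?exprn_ge0// gauss_ker_ge0.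
transitivity (\int[om]_o \int[mu3]_x \int[mu3]_y (F x y o)%:E).
  apply: (@fubini_tonelli _ _ (T3 R) (measurableTypeR R * T3 R)%type R (sfleb3 (R := R)) om
    (fun p => \int[mu3]_y (F p.1 y p.2)%:E)); last by move=> p; exact: integral_ge0.
  apply: (@measurable_fun_fubini_tonelli_F _ _ (T3 R * (measurableTypeR R * T3 R))%type (T3 R) R (sfleb3 (R := R))
      (fun q => (F q.1.1 q.2 q.1.2)%:E)) => //.
  apply: mKK; [|exact: measurable_snd|].
  - exact: (measurableT_comp measurable_fst measurable_fst).
  - exact: (measurableT_comp measurable_snd measurable_fst).
apply: eq_integral => o _.
under eq_integral do rewrite inner.
rewrite ge0_integralZr//; last 3 first.
- apply: emeasurable_funM => //; apply/measurable_EFinP; apply: measurable_funM; last exact: mKo.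
  exact: mu2.
- by move=> x _; rewrite mule_ge0// lee_fin ?mulr_ge0 ?exprn_ge0 ?gauss_ker_ge0.
- exact: gauss_avg_ge0.
rewrite muleA; congr (_ * _).
rewrite /gauss_avg -ge0_integralZl//.
- by apply: eq_integral => x _; rewrite usq.
- apply/measurable_EFinP; apply: measurable_funM; last exact: mKo.
  exact: measurable_funX.
- by move=> y _; rewrite lee_fin mulr_ge0 ?sqr_ge0// gauss_ker_ge0.
- by rewrite lee_fin.
Qed.

Lemma coulomb_ge0 u : 0 <= coulomb u.
Proof.
apply: integral_ge0 => x _; apply: integral_ge0 => y _.
by rewrite lee_fin divr_ge0 ?enorm3_ge0// mulr_ge0// exprn_ge0.
Qed.

Lemma gauss_avg_convex (t : R) u w o : (0 < t < 1)%R ->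
  measurable_fun [set: T3 R] u -> measurable_fun [set: T3 R] w ->
  gauss_avg (fun x => (1 - t) * u x + t * w x)%R o <=
  (1 - t)%:E * gauss_avg u o + t%:E * gauss_avg w o.
Proof.
move=> t01 mu_ mw; have /andP[t0 t1] := t01.
have mg v : measurable_fun [set: T3 R] v -> measurable_fun [set: T3 R] (fun x => (v x ^+ 2 * gauss_ker o x)%:E).
  by move=> mv; apply/measurable_EFinP; apply: measurable_funM; [exact: measurable_funX|exact: mKo].
have g0 v x : 0 <= (v x ^+ 2 * gauss_ker o x)%:E by rewrite lee_fin mulr_ge0 ?sqr_ge0// gauss_ker_ge0.
have muw : measurable_fun [set: T3 R] (fun x => (1 - t) * u x + t * w x)%R.
  by apply: measurable_funD; exact: measurable_funM.
apply: (@ge0_integral_convex _ _ _ mu3 _ _ _ _ t01 (mg _ mu_) (mg _ mw) (mg _ muw) (g0 _) (g0 _) (g0 _) _) => x.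
 rewrite -(EFinM (1 - t)) -(EFinM t) -EFinD lee_fin -subr_ge0.
rewrite (_ : _ - _ = (1 - t) * t * (u x - w x) ^+ 2 * gauss_ker o x)%R; last by ring.
apply: mulr_ge0; last exact: gauss_ker_ge0.
by apply: mulr_ge0; [apply: mulr_ge0; rewrite ?subr_ge0; exact: ltW|exact: sqr_ge0].
Qed.

Lemma coulomb_convex (t : R) u w : (0 < t < 1)%R ->
  measurable_fun [set: T3 R] u -> measurable_fun [set: T3 R] w ->
  coulomb (fun x => (1 - t) * u x + t * w x)%R <= (1 - t)%:E * coulomb u + t%:E * coulomb w.
Proof.
move=> t01 mu_ mw; have /andP[t0 t1] := t01.
have muw : measurable_fun [set: T3 R] (fun x => (1 - t) * u x + t * w x)%R.
  by apply: measurable_funD; exact: measurable_funM.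
have C0 : (0 < coulomb_cst R)%R by exact: coulomb_cst_gt0.
have mA v : measurable_fun [set: T3 R] v -> measurable_fun [set: measurableTypeR R * T3 R]
    (fun o => (W o)%:E * (gauss_avg v o * gauss_avg v o)).
  move=> mv; have := measurable_gauss_avg mv => h.
  by apply: emeasurable_funM; [exact/measurable_EFinP|exact: emeasurable_funM].
have A0 v o : 0 <= (W o)%:E * (gauss_avg v o * gauss_avg v o).
  by rewrite mule_ge0 ?lee_fin// mule_ge0// gauss_avg_ge0.
have := @ge0_integral_convex _ _ _ om _ _ _ _ t01 (mA u mu_) (mA w mw) (mA _ muw) (A0 u) (A0 w) (A0 _).
rewrite -(coulombE muw) -(coulombE mu_) -(coulombE mw).
move: (coulomb_ge0 u) (coulomb_ge0 w).
move: (coulomb _) (coulomb u) (coulomb w) => cuw cu cw cu0 cw0 h.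
rewrite -(@lee_pmul2l _ (coulomb_cst R)%:E)//.
have t1' : (0 < 1 - t)%R by rewrite subr_gt0.
rewrite ge0_muleDr ?mule_ge0 ?lee_fin ?(ltW t0) ?(ltW t1')//.
rewrite (muleCA _ (1 - t)%:E cu) (muleCA _ t%:E cw).
apply: h => o; rewrite (muleCA (1 - t)%:E) (muleCA t%:E) -ge0_muleDr; last 2 first.
- by apply: mule_ge0; [rewrite lee_fin ltW|apply: mule_ge0; exact: gauss_avg_ge0].
- by apply: mule_ge0; [rewrite lee_fin ltW|apply: mule_ge0; exact: gauss_avg_ge0].
apply: lee_wpmul2l; first by rewrite lee_fin.
by apply: ereal_sqr_convex; rewrite ?gauss_avg_ge0//; exact: gauss_avg_convex.
Qed.

Lemma coulombZ (k : R) u : measurable_fun [set: T3 R] u ->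
  coulomb (fun x => k * u x)%R = (k ^+ 4)%:E * coulomb u.
Proof.
move=> mu_.
have mu2 : measurable_fun [set: T3 R] (fun x => `|u x| ^+ 2)%R.
  by apply: measurable_funX; exact: measurableT_comp.
have k0 : (0 <= k ^+ 4)%R by rewrite exprn_even_ge0.
have I0 x y : 0 <= (`|u x| ^+ 2 * `|u y| ^+ 2 / enorm3 (x - y))%:E.
  by rewrite lee_fin divr_ge0 ?enorm3_ge0// mulr_ge0// exprn_ge0.
have mJ : measurable_fun [set: T3 R * T3 R]
    (fun p : T3 R * T3 R => (`|u p.1| ^+ 2 * `|u p.2| ^+ 2 / enorm3 (p.1 - p.2 : R * R * R))%:E).
  apply/measurable_EFinP; apply: measurable_funM; last exact: measurable_inv_enorm3.
  by apply: measurable_funM; [exact: (measurableT_comp mu2 measurable_fst)|exact: (measurableT_comp mu2 measurable_snd)].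
have mI (x : T3 R) : measurable_fun [set: T3 R] (fun y : T3 R => (`|u x| ^+ 2 * `|u y| ^+ 2 / enorm3 (x - y : R * R * R))%:E).
  have mp : measurable_fun [set: T3 R] (fun y => (x, y)) by exact: measurable_fun_pair.
  exact: (measurableT_comp mJ mp).
have mIx : measurable_fun [set: T3 R] (fun x => \int[mu3]_y (`|u x| ^+ 2 * `|u y| ^+ 2 / enorm3 (x - y))%:E).
  by apply: (@measurable_fun_fubini_tonelli_F _ _ (T3 R) (T3 R) R (sfleb3 (R := R)) _ mJ) => p; exact: I0.
rewrite /coulomb -(ge0_integralZl mu3 measurableT mIx); last 2 first.
- by move=> x _; exact: integral_ge0.
- by rewrite lee_fin.
apply: eq_integral => x _.
rewrite -(ge0_integralZl mu3 measurableT (mI x)); last 2 first.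
- by move=> y _; exact: I0.
- by rewrite lee_fin.
apply: eq_integral => y _; rewrite -EFinM !normrM !exprMn real_normK ?num_real//.
by congr EFin; ring.
Qed.

End coulomb.

(** * Convex homogeneous functionals *)

Section convex_functional.
Context {R : realType} d (T : measurableType d).
Implicit Types u w : T -> R.
Variables (N : (T -> R) -> \bar R) (s : R -> R).
Hypothesis N_ge0 : forall u, (0 <= N u)%E.
Hypothesis N_convex : forall (t : R) u w, 0 < t < 1 ->
  measurable_fun setT u -> measurable_fun setT w ->
  (N (fun x => (1 - t) * u x + t * w x)%R <= (1 - t)%:E * N u + t%:E * N w)%E.
Hypothesis NZ : forall (k : R) u, measurable_fun setT u -> N (fun x => k * u x) = ((s k)%:E * N u)%E.

(** a u + b w is the midpoint of 2 a u and 2 b w: by convexity and homogeneity, the functions where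
    [N] is finite are stable under linear combinations. *)
Let N_fin_lin (a b : R) u w : measurable_fun setT u -> measurable_fun setT w ->
  N u \is a fin_num -> N w \is a fin_num -> N (fun x => a * u x + b * w x) \is a fin_num.
Proof.
move=> mu_ mw fu fw; rewrite ge0_fin_numE//.
have h2 : 0 < (2^-1 : R) < 1 by apply/andP; split; lra.
have := @N_convex 2^-1 (fun x => 2 * a * u x) (fun x => 2 * b * w x) h2
  (measurable_funM (measurable_cst _) mu_) (measurable_funM (measurable_cst _) mw).
rewrite (_ : (fun x => _ + _) = (fun x => a * u x + b * w x)); last first.
  by apply/funext => x; field.
move/le_lt_trans; apply; rewrite !NZ// -(fineK fu) -(fineK fw).
by rewrite -!EFinM -(EFinD (_ * _)) ltry.
Qed.

(* Where [N u = +oo] the junk value [fine +oo = 0] makes the bound non trivial: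
   it holds because [N] is finite for at most one point of the segment. *)
Lemma convex_functional_fine (l : R) u w : measurable_fun setT u -> measurable_fun setT w ->
  (N w <= l%:E * N u)%E ->
  exists2 t0, 0 < t0 & forall t, 0 < t < t0 ->
    fine (N (fun x => u x + t * (w x - u x))) <= (1 + t * (l - 1)) * fine (N u).
Proof.
move=> mu_ mw lN.
have seg t : (fun x => u x + t * (w x - u x)) = (fun x => (1 - t) * u x + t * w x).
  by apply/funext => x; ring.
have mseg t : measurable_fun setT (fun x => (1 - t) * u x + t * w x).
  by apply: measurable_funD; exact: measurable_funM.
have [fu|nfu] := boolP (N u \is a fin_num).
  exists 1 => // t t01; have /andP[t0 t1] := t01; rewrite seg.
  have fw : N w \is a fin_num.
    by rewrite ge0_fin_numE//; apply: le_lt_trans lN _; rewrite -(fineK fu) -EFinM ltry.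
  have := N_convex t01 mu_ mw.
  rewrite -(fineK (N_fin_lin (1 - t) t mu_ mw fu fw)); move: lN.
  rewrite -(fineK fu) -(fineK fw) -!EFinM -(EFinD (_ * _)) !lee_fin => lN /le_trans; apply.
  have -> : (1 + t * (l - 1)) * fine (N u) = (1 - t) * fine (N u) + t * (l * fine (N u)) by ring.
  by rewrite lerD2l ler_wpM2l// ltW.
have uoo : fine (N u) = 0.
  move: nfu (N_ge0 u); case: (N u) => //.
rewrite uoo.
have [[r [r0 fr]]|none] := pselect (exists r, 0 < r /\
    N (fun x => (1 - r) * u x + r * w x) \is a fin_num).
  exists r => // t /andP[t0 tr]; rewrite mulr0 seg.
  have [ft|] := boolP (N (fun x => (1 - t) * u x + t * w x) \is a fin_num); last first.
    by move: (N_ge0 (fun x => (1 - t) * u x + t * w x)); case: (N _).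
  exfalso; move/negP : nfu; apply.
  have rt : r - t != 0 by rewrite gt_eqF// subr_gt0.
  (* Extrapolating the points of parameters t and r back to parameter 0 recovers u, which would make
     [N u] finite. *)
  have := N_fin_lin (r / (r - t)) (- t / (r - t)) (mseg t) (mseg r) ft fr.
  rewrite (_ : (fun x => _ + _) = u)//.
  by apply/funext => x; field.
exists 1 => // t /andP[t0 t1]; rewrite mulr0 seg.
have [ft|] := boolP (N (fun x => (1 - t) * u x + t * w x) \is a fin_num); last first.
  by move: (N_ge0 (fun x => (1 - t) * u x + t * w x)); case: (N _).
by exfalso; apply: none; exists t.
Qed.

End convex_functional.

(** * The integral of the p-th power *)

Section power_integral.
Context {R : realType} d (T : measurableType d) (mu : {measure set T -> \bar R}) (p : R).
Implicit Types u w : T -> R.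

Definition power_integral u : \bar R := (\int[mu]_x (`|u x| `^ p)%:E)%E.

Lemma power_integral_ge0 u : (0 <= power_integral u)%E.
Proof. by apply: integral_ge0 => x _; rewrite lee_fin powR_ge0. Qed.

Lemma measurable_power u : measurable_fun setT u ->
  measurable_fun setT (fun x => (`|u x| `^ p)%:E).
Proof.
move=> mu_; apply/measurable_EFinP.
apply: (measurableT_comp (measurable_powR _)); exact: measurableT_comp.
Qed.

Lemma power_integral_convex (t : R) u w : 1 <= p -> 0 < t < 1 ->
  measurable_fun setT u -> measurable_fun setT w ->
  (power_integral (fun x => (1 - t) * u x + t * w x)%R
    <= (1 - t)%:E * power_integral u + t%:E * power_integral w)%E.
Proof.
move=> p1 t01 mu_ mw; have /andP[t0 t1] := t01.
have t1' : 0 <= 1 - t by rewrite subr_ge0 ltW.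
apply: (@ge0_integral_convex _ _ _ mu _ _ _ _ t01 (measurable_power mu_) (measurable_power mw)).
- by apply: measurable_power; apply: measurable_funD; exact: measurable_funM.
- by move=> x; rewrite lee_fin powR_ge0.
- by move=> x; rewrite lee_fin powR_ge0.
- by move=> x; rewrite lee_fin powR_ge0.
move=> x; rewrite -!EFinM -EFinD lee_fin.
apply: (@le_trans _ _ (((1 - t) * `|u x| + t * `|w x|) `^ p)).
  rewrite ge0_ler_powR ?nnegrE ?(le_trans _ p1)//.
    by rewrite addr_ge0// mulr_ge0// ltW.
  by rewrite (le_trans (ler_normD _ _))// !normrM ger0_norm// (gtr0_norm t0).
have t1le : 1 - t <= 1 by rewrite lerBlDr lerDl ltW.
have := @convex_powR _ p p1 (Itv01 t1' t1le) `|u x| `|w x|.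
rewrite !inE/= !in_itv/= !normr_ge0/= => /(_ isT isT).
rewrite !convRE/= unstable.onemK; congr (_ `^ p <= _).
by rewrite -[LHS]/((1 - t) * `|u x| + (1 - (1 - t)) * `|w x|) subKr.
Qed.

Lemma power_integralZ (k : R) u : measurable_fun setT u ->
  power_integral (fun x => k * u x) = ((`|k| `^ p)%:E * power_integral u)%E.
Proof.
move=> mu_; rewrite /power_integral -(ge0_integralZl mu measurableT (measurable_power mu_)); last 2 first.
- by move=> x _; rewrite lee_fin powR_ge0.
- by rewrite lee_fin powR_ge0.
by apply: eq_integral => x _; rewrite normrM powRM.
Qed.

End power_integral.

(** * Energies of the stretched function *)

Section pull_functionals.
Context {R : realType}.
Local Notation mu3 := (leb3 R).
Variables (Phi phi nu : R -> R).
Hypothesis Phi_mono : {mono Phi : x y / x <= y}.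
Hypothesis PhiK : cancel Phi phi.
Hypothesis phiK : cancel phi Phi.
Hypothesis snu : smooth1 nu.
Hypothesis PhiD : forall s : R, is_derive s (1 : R) Phi (nu s ^+ 2).
Hypothesis nu_ge1 : forall s, 1 <= nu s.
Hypothesis Phi_expand : forall s t, `|s - t| <= `|Phi s - Phi t|.
Variable u : R * R * R -> R.
Hypothesis measurable_u : measurable_fun [set: T3 R] u.

Let nu_gt0 s : 0 < nu s. Proof. exact: lt_le_trans (nu_ge1 s). Qed.
Let nu_neq0 s : nu s != 0. Proof. by rewrite gt_eqF. Qed.
Let snu2 : smooth1 (fun s => nu s ^+ 2). Proof. exact: smooth1M. Qed.
Let cnu2 : continuous (fun s => nu s ^+ 2). Proof. exact: smooth1_continuous. Qed.
Let nu2_ge0 s : 0 <= nu s ^+ 2. Proof. exact: sqr_ge0. Qed.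

Let v := pull phi (fun y => u y / nu y.1.1).

Let ge0_sub (f : T3 R -> \bar R) := ge0_integral_stretch PhiD cnu2 nu2_ge0 Phi_mono phiK (f := f).

Let mv : measurable_fun [set: T3 R] v.
Proof.
apply: (measurable_pull Phi_mono phiK); apply: measurable_funM => //.
exact: (measurable_coord1 (smooth1V nu_neq0 snu)).
Qed.

Let vE y : v (stretch Phi y) = u y / nu y.1.1.
Proof. exact: (pull_stretch PhiK (fun y => u y / nu y.1.1)). Qed.

(** In the stretched variable the integrand is |u|^p nu^(2 - p), with nu >= 1 and p >= 2. *)
Lemma power_integral_pull_le (p : R) : 2 <= p ->
  (power_integral mu3 p v <= power_integral mu3 p u)%E.
Proof.
move=> p2; rewrite /power_integral ge0_sub; last 2 first.
- by move=> x; rewrite lee_fin powR_ge0.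
- exact: measurable_power.
apply: ge0_le_integral => //.
- by move=> y _; rewrite mule_ge0// lee_fin// powR_ge0.
- apply: emeasurable_funM.
    exact: (measurableT_comp (measurable_power p mv) (measurable_stretch Phi_mono)).
  by apply/measurable_EFinP; exact: (measurable_coord1 snu2).
- exact: measurable_power.
move=> y _; rewrite vE -EFinM lee_fin normrM powRM// normfV -mulrA ler_piMr ?powR_ge0//.
have n0 := ltW (nu_gt0 y.1.1).
rewrite gtr0_norm// -(powR_inv1 n0) -powRrM -(powR_mulrn _ n0) -powRD; last by rewrite nu_neq0 implybT.
by rewrite -[leRHS](powRr0 (nu y.1.1)) ler_powR//; lra.
Qed.

Let enorm3_stretch x y : enorm3 (x - y) <= enorm3 (stretch Phi x - stretch Phi y).
Proof.
rewrite /enorm3 ler_wsqrtr// /= !lerD2r.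
by rewrite -[leLHS]real_normK ?num_real// -[leRHS]real_normK ?num_real// lerXn2r ?nnegrE.
Qed.

(** The two Jacobians nu^2 cancel the divisions by nu in |v|^2 |v|^2. Only the distance is left, and
    the stretching does not decrease it. *)
Lemma coulomb_pull_le : (coulomb v <= coulomb u)%E.
Proof.
have mu2 (w : R * R * R -> R) : measurable_fun [set: T3 R] w -> measurable_fun [set: T3 R] (fun x => `|w x| ^+ 2).
  by move=> mw; apply: measurable_funX; exact: measurableT_comp.
pose F (w : R * R * R -> R) (p : T3 R * T3 R) := (`|w p.1| ^+ 2 * `|w p.2| ^+ 2 / enorm3 (p.1 - p.2 : R * R * R))%:E.
have mF w : measurable_fun [set: T3 R] w -> measurable_fun setT (F w).
  move=> mw; apply/measurable_EFinP; apply: measurable_funM; last exact: measurable_inv_enorm3.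
  apply: measurable_funM; first exact: (measurableT_comp (mu2 _ mw) measurable_fst).
  exact: (measurableT_comp (mu2 _ mw) measurable_snd).
have F0 w p : (0 <= F w p)%E.
  by rewrite lee_fin divr_ge0 ?enorm3_ge0// mulr_ge0// exprn_ge0.
have mFx w (x : T3 R) : measurable_fun [set: T3 R] w -> measurable_fun [set: T3 R] (fun y => F w (x, y)).
  move=> mw; have mp : measurable_fun [set: T3 R] (fun y => (x, y)) by exact: measurable_fun_pair.
  exact: (measurableT_comp (mF w mw) mp).
have mI w : measurable_fun [set: T3 R] w -> measurable_fun [set: T3 R] (fun x => \int[mu3]_y F w (x, y))%E.
  move=> mw.
  by apply: (@measurable_fun_fubini_tonelli_F _ _ (T3 R) (T3 R) R (sfleb3 (R := R)) _ (mF w mw)) => p; exact: F0.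
have I0 w x : (0 <= \int[mu3]_y F w (x, y))%E by exact: integral_ge0.
have mj : measurable_fun [set: T3 R] (fun x => (nu x.1.1 ^+ 2)%:E).
  by apply/measurable_EFinP; exact: (measurable_coord1 snu2).
have mst : measurable_fun [set: T3 R] (stretch Phi : T3 R -> T3 R) := measurable_stretch Phi_mono.
rewrite -[leLHS]/(\int[mu3]_x \int[mu3]_y F v (x, y))%E -[leRHS]/(\int[mu3]_x \int[mu3]_y F u (x, y))%E.
rewrite (ge0_sub (I0 v) (mI v mv)).
apply: (ge0_le_integral mu3 measurableT).
- by move=> x _; rewrite mule_ge0// lee_fin.
- by apply: emeasurable_funM mj; exact: (measurableT_comp (mI v mv) mst).
- exact: mI.
move=> x _; rewrite (ge0_sub (fun y => F0 v (_, y)) (mFx v _ mv)).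
rewrite -ge0_integralZr//; last 3 first.
- by apply: emeasurable_funM mj; exact: (measurableT_comp (mFx v _ mv) mst).
- by move=> y _; rewrite mule_ge0// lee_fin.
- by rewrite lee_fin.
apply: (ge0_le_integral mu3 measurableT).
- by move=> y _; rewrite !mule_ge0// lee_fin.
- apply: emeasurable_funM => //; apply: emeasurable_funM mj.
  exact: (measurableT_comp (mFx v _ mv) mst).
- exact: mFx.
move=> y _; rewrite /F /= !vE -!EFinM lee_fin !real_normK ?num_real//.
have -> : (u x / nu x.1.1) ^+ 2 * (u y / nu y.1.1) ^+ 2 / enorm3 (stretch Phi x - stretch Phi y) *
    nu y.1.1 ^+ 2 * nu x.1.1 ^+ 2 =
    u x ^+ 2 * u y ^+ 2 * (enorm3 (stretch Phi x - stretch Phi y))^-1.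
  by move: (enorm3 (stretch Phi x - _))^-1 => E; field; rewrite !nu_neq0.
apply: ler_wpM2l; first by rewrite mulr_ge0 ?sqr_ge0.
(* When x = y both inverses have the default value 0; inversion is decreasing on positive distances
   only. *)
have [xy|xy] := eqVneq (enorm3 (x - y)) 0; last first.
  have xy0 : 0 < enorm3 (x - y) by rewrite lt_neqAle eq_sym xy enorm3_ge0.
  by rewrite lef_pV2// posrE (lt_le_trans xy0).
have -> : enorm3 (stretch Phi x - stretch Phi y) = 0; last by rewrite xy.
have := enorm3_sqr (x - y); rewrite xy expr0n/= => /esym/eqP.
rewrite !paddr_eq0 ?addr_ge0 ?sqr_ge0// !sqrf_eq0 !subr_eq0 => /andP[/andP[/eqP e1 /eqP e2] /eqP e3].
by rewrite (_ : x = y) ?subrr; [rewrite /enorm3/= expr0n/= !addr0 sqrtr0|case: x y e1 e2 e3 {xy} => -[? ?] ? [[? ?] ?] /= -> -> ->].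
Qed.

End pull_functionals.

(** * The stretching *)

Section lorentz.
Context {R : realType}.
Variable r : R.
Hypothesis r0 : 0 < r.

(** This profile and its square have elementary primitives whose values stay bounded, so [Phi] is
    explicit and Phi - id is bounded. *)
Definition lorentz (x : R) : R := (1 + (x / r) ^+ 2)^-1.

Let den_gt0 x : 0 < 1 + (x / r) ^+ 2.
Proof. by rewrite ltr_wpDr// sqr_ge0. Qed.

Lemma lorentz_gt0 x : 0 < lorentz x.
Proof. by rewrite invr_gt0. Qed.

Lemma lorentz_le1 x : lorentz x <= 1.
Proof. by rewrite invf_le1// lerDl sqr_ge0. Qed.

Lemma smooth1_lorentz : smooth1 lorentz.
Proof.
apply: smooth1V => [x|]; first by rewrite gt_eqF.
apply: smooth1D; first exact: smooth1_cst.
by apply: smooth1M; apply: smooth1M; [exact: smooth1_id|exact: smooth1_cst|exact: smooth1_id|exact: smooth1_cst].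
Qed.

Definition lorentz' (x : R) : R := - (2 * (x / r) / r) * lorentz x ^+ 2.

Lemma smooth1_lorentz' : smooth1 lorentz'.
Proof.
apply: smooth1M; last by apply: smooth1M; exact: smooth1_lorentz.
rewrite (_ : (fun _ => _) = (fun x => x * (- 2 / r ^+ 2))); last first.
  by apply/funext => x; field; rewrite gt_eqF.
by apply: smooth1M; [exact: smooth1_id|exact: smooth1_cst].
Qed.

Lemma is_derive_lorentz (x : R) : is_derive x (1 : R) lorentz (lorentz' x).
Proof.
have dd : is_derive x (1 : R) (fun x : R => 1 + (x / r) ^+ 2) (2 * (x / r) / r).
  apply: is_derive_eq; rewrite -?mulr_regl /GRing.scale/=; field; by rewrite gt_eqF.
have n0 : 1 + (x / r) ^+ 2 != 0 by rewrite gt_eqF.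
apply: (is_derive_eq (@is_deriveV R (fun x : R => 1 + (x / r) ^+ 2) x _ _ n0 dd)).
by rewrite /lorentz' /lorentz /GRing.scale/= exprVn; ring.
Qed.

(** With z = |x / r|, 2 z <= 1 + z^2 <= (1 + z^2)^2. This keeps the unwanted term nu' of size t /
    r. *)
Lemma lorentz'_le x : `|lorentz' x| <= r^-1.
Proof.
have h : 2 * `|x / r| * lorentz x ^+ 2 <= 1.
  rewrite /lorentz exprVn ler_pdivrMr ?exprn_gt0// mul1r -[(x / r) ^+ 2]real_normK ?num_real//.
  move: `|x / r| (normr_ge0 (x / r)) => z z0; have h := sqr_ge0 (z - 1).
  apply: (@le_trans _ _ (1 + z ^+ 2)); first by nra.
  by rewrite [leRHS]expr2 ler_peMl ?lerDl ?sqr_ge0// addr_ge0// sqr_ge0.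
rewrite /lorentz' mulNr normrN.
rewrite !normrM (gtr0_norm (lorentz_gt0 x)) normfV (gtr0_norm r0) (gtr0_norm (ltr0n R 2)).
rewrite normrM normfV (gtr0_norm r0) in h.
rewrite (_ : _ * _ = 2 * (`|x| / r) * lorentz x ^+ 2 / r); last by ring.
by rewrite ler_piMl// invr_ge0 ltW.
Qed.

(** The three summands are primitives of the terms 1, 2 t l and t^2 l^2 of (1 + t l)^2, where l is
    [lorentz]. *)
Definition lorentz_prim (t x : R) : R :=
  x + 2 * t * (r * atan (x / r)) + t ^+ 2 / 2 * (r * atan (x / r) + x * lorentz x).

Lemma is_derive_lorentz_prim (t x : R) :
  is_derive x (1 : R) (lorentz_prim t) ((1 + t * lorentz x) ^+ 2).
Proof.
have da : is_derive x (1 : R) (fun x => r * atan (x / r)) (lorentz x).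
  have d1 : is_derive x (1 : R) (fun x => x / r) r^-1.
    by apply: is_derive_eq; rewrite /GRing.scale/=; field; rewrite gt_eqF.
  have d2 := @is_derive1_comp R (@atan R) (fun x : R => x / r) x _ _ (is_derive1_atan (x / r)) d1.
  have d3 := is_deriveZ r d2.
  have e : r *: ((1 + (x / r) ^+ 2)^-1 * r^-1) = lorentz x.
    by rewrite /GRing.scale/= /lorentz mulrCA mulfV ?mulr1// gt_eqF.
  exact: (is_derive_eq d3 e).
have dl := is_derive_lorentz x.
rewrite /lorentz_prim; apply: is_derive_eq.
rewrite /GRing.scale/= /lorentz'.
have e : (x / r) * (x / r) * lorentz x = 1 - lorentz x.
  by have := den_gt0 x; rewrite /lorentz -expr2; move: (_ ^+ 2) => z z0; field; rewrite gt_eqF.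
have -> : x * (- (2 * (x / r) / r) * lorentz x ^+ 2) = - (2 * lorentz x * (x / r * (x / r) * lorentz x)) by ring.
by rewrite e; field.
Qed.

(** Mean value theorem for the primitive minus the identity, whose derivative (1 + t l)^2 - 1 is
    nonnegative. *)
Lemma lorentz_prim_expand (t x y : R) : 0 <= t -> x <= y ->
  y - x <= lorentz_prim t y - lorentz_prim t x.
Proof.
move=> t0 xy.
have dd z : is_derive z (1 : R) (fun z => lorentz_prim t z - z) ((1 + t * lorentz z) ^+ 2 - 1).
  have := is_derive_lorentz_prim t z => ?; exact: is_derive_eq.
have cd : {within `[x, y], continuous (fun z => lorentz_prim t z - z)}.
  by apply: derivable_within_continuous => z _; have := dd z => ?; exact: ex_derive.
have [z _ e] := MVT_segment xy (fun z _ => dd z) cd.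
rewrite -subr_ge0 (_ : _ - _ = (lorentz_prim t y - y) - (lorentz_prim t x - x)); last by ring.
rewrite e mulr_ge0 ?subr_ge0//.
have := mulr_ge0 t0 (ltW (lorentz_gt0 z)); move: (t * _) => s s0.
by rewrite expr_ge1// ?lerDl// addr_ge0.
Qed.

(** From |atan| <= 2 and |x l(x)| <= r, with l the profile [lorentz], the displacement is at most 4
    t r + (3 / 2) t^2 r, and t <= 1. *)
Lemma lorentz_prim_bound (t x : R) : 0 <= t -> t <= 1 -> `|lorentz_prim t x - x| <= 6 * t * r.
Proof.
move=> t0 t1.
have at2 (y : R) : `|atan y| <= 2.
  have := atan_gtNpi2 y; have := atan_ltpi2 y; have := @pihalf_lt2 R.
  by move: (pi / 2) (atan y) => q z ? ? ?; rewrite ler_norml; apply/andP; split; lra.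
have a2 : `|r * atan (x / r)| <= 2 * r.
  by rewrite normrM (gtr0_norm r0) mulrC ler_wpM2r// ltW.
have l1 : `|x * lorentz x| <= r.
  rewrite normrM (gtr0_norm (lorentz_gt0 x)) /lorentz ler_pdivrMr//.
  rewrite -[(x / r) ^+ 2]real_normK ?num_real// normrM normfV (gtr0_norm r0).
  have {1}-> : `|x| = r * (`|x| / r) by rewrite mulrCA mulfV ?mulr1// gt_eqF.
  rewrite ler_wpM2l ?ltW//; move: (_ / r) => z.
  by have := sqr_ge0 (z - 1); have := sqr_ge0 z; nra.
have h : `|r * atan (x / r) + x * lorentz x| <= 3 * r.
  by apply: le_trans (ler_normD _ _) _; lra.
have -> : lorentz_prim t x - x = 2 * t * (r * atan (x / r)) +
    t ^+ 2 / 2 * (r * atan (x / r) + x * lorentz x) by rewrite /lorentz_prim; ring.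
apply: le_trans (ler_normD _ _) _; rewrite [in leLHS]normrM [X in _ + X]normrM.
move: a2 h; move: (normr_ge0 (r * atan (x / r) + x * lorentz x)).
move: `|r * atan _| `|_ + _| => A B B0 hA hB.
rewrite !ger0_norm ?divr_ge0 ?mulr_ge0 ?sqr_ge0//.
have : 2 * t * A <= 2 * t * (2 * r) by rewrite ler_wpM2l// mulr_ge0.
have : t ^+ 2 / 2 * B <= t / 2 * (3 * r).
  apply: ler_pM => //; first by rewrite divr_ge0// sqr_ge0.
  by rewrite ler_wpM2r// expr2 ler_piMr.
by have := mulr_ge0 t0 (ltW r0); nra.
Qed.

Lemma stretching_exists (t : R) : 0 < t -> t <= 1 ->
  exists Phi phi : R -> R,
  [/\ [/\ {mono Phi : x y / x <= y},
      forall s, s <= Phi s,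
      forall s, Phi s <= s + 12 * t * r,
      cancel Phi phi & cancel phi Phi],
      smooth1 Phi,
      forall s, is_derive s (1 : R) Phi ((1 + t * lorentz s) ^+ 2) &
      forall x y, `|x - y| <= `|Phi x - Phi y|].
Proof.
(* Adding the bound on the displacement makes Phi >= id, as the one-sided kernel [between] requires;
   the displacement becomes at most twice that bound. *)
move=> t0 t1; pose Phi x := lorentz_prim t x + 6 * t * r.
have PhiD s : is_derive s (1 : R) Phi ((1 + t * lorentz s) ^+ 2).
  by have := is_derive_lorentz_prim t s => ?; apply: is_derive_eq; rewrite addr0.
have sPhi : smooth1 Phi.
  apply: (smooth1_primitive PhiD); rewrite (_ : (fun _ => _) = (fun x => (1 + t * lorentz x) * (1 + t * lorentz x)))//.
  have h : smooth1 (fun x => 1 + t * lorentz x).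
    apply: smooth1D; first exact: smooth1_cst.
    by apply: smooth1M; [exact: smooth1_cst|exact: smooth1_lorentz].
  exact: smooth1M.
have ex x y : x <= y -> y - x <= Phi y - Phi x.
  move=> xy; have := lorentz_prim_expand (ltW t0) xy; rewrite /Phi; lra.
have Phi_mono : {mono Phi : x y / x <= y}.
  apply: le_mono => x y xy; have := ex _ _ (ltW xy); lra.
have Phi_bd s : s <= Phi s <= s + 12 * t * r.
  have := lorentz_prim_bound s (ltW t0) t1; rewrite ler_norml /Phi => /andP[? ?].
  by apply/andP; split; lra.
have Phi_surj y : exists x, Phi x = y.
  have d0 : y - 12 * t * r <= y by rewrite gerBl !mulr_ge0// ltW.
  have cPhi : {within `[y - 12 * t * r, y], continuous Phi}.
    by apply: continuous_subspaceT; exact: smooth1_continuous.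
  have [|x _ <-] := @IVT R Phi (y - 12 * t * r) y y d0 cPhi; last by exists x.
  have /andP[h1 h2] := Phi_bd y; have /andP[h3 h4] := Phi_bd (y - 12 * t * r).
  by rewrite ge_min le_max h1 orbT andbT; apply/orP; left; lra.
have [phi phiK] := choice Phi_surj.
exists Phi, phi; split => //; first split => //.
- by move=> s; have /andP[] := Phi_bd s.
- by move=> s; have /andP[] := Phi_bd s.
- by move=> s; apply: (inc_inj Phi_mono); rewrite phiK.
move=> x y; wlog xy : x y / x <= y => [hw|].
  have [|/ltW] := leP x y; first exact: hw.
  by rewrite (distrC x) (distrC (Phi x)); exact: hw.
have := ex _ _ xy => h.
by rewrite distrC (distrC (Phi x)) ger0_norm ?subr_ge0// ger0_norm// (le_trans _ h)// subr_ge0.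
Qed.

End lorentz.

(** * Quadratic identities, and positivity of the norm of the first partial derivative *)

Section L2_geometry.
Context {R : realType}.
Local Notation mu3 := (leb3 R).
Implicit Types u v f g : R * R * R -> R.

Lemma L2B f g : L2 f -> L2 g -> L2 (fun x => f x - g x).
Proof.
move=> Lf Lg; rewrite (_ : (fun _ => _) = (fun x => f x + (-1) * g x)); last first.
  by apply/funext => x; rewrite mulN1r.
by apply: L2D => //; exact: L2Z.
Qed.

Lemma Rintegral_sqr_ae f g : L2 f -> L2 g -> {ae mu3, forall x, f x = g x} ->
  \int[mu3]_x (f x ^+ 2) = \int[mu3]_x (g x ^+ 2).
Proof.
move=> Lf Lg fg; congr fine; apply: ae_eq_integral => //.
- by apply/measurable_EFinP; apply: measurable_funX; exact: L2_measurable.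
- by apply/measurable_EFinP; apply: measurable_funX; exact: L2_measurable.
apply: filterS fg; first exact: (ae_filter_ringOfSetsType mu3).
by move=> x ->.
Qed.

Lemma Rintegral_sqr_eq0 f : L2 f -> \int[mu3]_x (f x ^+ 2) <= 0 -> {ae mu3, forall x, f x = 0}.
Proof.
move=> Lf f0; have mf := L2_measurable Lf; have If := L2_sqr Lf.
have : (\int[mu3]_x `|(f x ^+ 2)%:E| = 0)%E.
  transitivity (\int[mu3]_x (f x ^+ 2)%:E)%E.
    by apply: eq_integral => x _; rewrite /= ger0_norm ?sqr_ge0.
  rewrite -(fineK (integrable_fin_num measurableT If)); congr EFin.
  by apply/eqP; rewrite eq_le f0 Rintegral_ge0// => x _; exact: sqr_ge0.
move=> h; have [/(_ h) + _] := ae_eq_integral_abs mu3 measurableT (measurable_int _ If).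
apply: filterS => x /(_ Logic.I) [] /eqP.
by rewrite sqrf_eq0 => /eqP.
Qed.

Lemma Rintegral_sqrB f g : L2 f -> L2 g ->
  \int[mu3]_x ((f x - g x) ^+ 2) =
  \int[mu3]_x (f x ^+ 2) - 2 * \int[mu3]_x (f x * g x) + \int[mu3]_x (g x ^+ 2).
Proof.
move=> Lf Lg; have If := L2_sqr Lf; have Ig := L2_sqr Lg; have Ifg := L2M Lf Lg.
have I2 := integrableZl measurableT 2 Ifg.
rewrite -RintegralZl// -RintegralB// -RintegralD//; last exact: (integrableB measurableT If I2).
by apply: eq_Rintegral => x _; ring.
Qed.

Lemma Rintegral_sqrD_le f g : L2 f -> L2 g ->
  \int[mu3]_x ((f x + g x) ^+ 2) <= 2 * (\int[mu3]_x (f x ^+ 2) + \int[mu3]_x (g x ^+ 2)).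
Proof.
move=> Lf Lg; have If := L2_sqr Lf; have Ig := L2_sqr Lg.
have Ifg := integrableD measurableT If Ig.
rewrite -RintegralD// -RintegralZl//.
apply: le_Rintegral => //.
- exact: (L2_sqr (L2D Lf Lg)).
- exact: (integrableZl measurableT 2 Ifg).
by move=> x _; have := sqr_ge0 (f x - g x); lra.
Qed.

Lemma Rintegral_sqrZ (k : R) f : L2 f ->
  \int[mu3]_x ((k * f x) ^+ 2) = k ^+ 2 * \int[mu3]_x (f x ^+ 2).
Proof.
move=> Lf; rewrite -RintegralZl//; last exact: L2_sqr.
by apply: eq_Rintegral => x _; rewrite exprMn.
Qed.

Lemma Rintegral_sqr_convex (t : R) f g : 0 < t < 1 -> L2 f -> L2 g ->
  \int[mu3]_x (((1 - t) * f x + t * g x) ^+ 2) <=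
  (1 - t) * \int[mu3]_x (f x ^+ 2) + t * \int[mu3]_x (g x ^+ 2).
Proof.
move=> /andP[t0 t1] Lf Lg; have If := L2_sqr Lf; have Ig := L2_sqr Lg.
have If' := integrableZl measurableT (1 - t) If; have Ig' := integrableZl measurableT t Ig.
rewrite -!RintegralZl// -RintegralD//; apply: le_Rintegral => //.
- exact: (L2_sqr (L2D (L2Z (1 - t) Lf) (L2Z t Lg))).
- exact: (integrableD measurableT If' Ig').
move=> x _; rewrite -subr_ge0.
rewrite (_ : _ - _ = (1 - t) * t * (f x - g x) ^+ 2); last by ring.
by rewrite mulr_ge0 ?sqr_ge0// mulr_ge0 ?subr_ge0 ?(ltW t0) ?(ltW t1).
Qed.

Lemma L2_coord1M (m : R -> R) (K : R) f : smooth1 m -> (forall s, `|m s| <= K) -> L2 f ->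
  L2 (fun x => m x.1.1 * f x).
Proof.
move=> sm mK Lf; apply: (@L2_boundedM R _ (fun y => m y.1.1) K) => //.
exact: measurable_coord1.
Qed.

(** If [g] vanished, [weak_partial_shift] would give u = u o unstretch almost everywhere. But this
    composition has the norm of u nu, and nu > 1 everywhere, so u would vanish too. The stretching
    with t = r = 1 is enough. *)
Lemma weak_partial_sqr_gt0 u g : L2 u -> L2 g -> weak_partial ord0 u g ->
  0 < \int[mu3]_x (u x ^+ 2) -> 0 < \int[mu3]_x (g x ^+ 2).
Proof.
move=> Lu Lg ug; rewrite !ltNge; apply: contra => g0.
have mu_ := L2_measurable Lu.
have [Phi [phi [[Pm Pge Ple PK pK] sPhi PhiD _]]] := stretching_exists ltr01 ltr01 (lexx (1 : R)).
have l0 (x : R) : 0 < lorentz 1 x by exact: lorentz_gt0.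
have l1 (x : R) : lorentz 1 x <= 1 by exact: lorentz_le1.
have snu : smooth1 (fun s => 1 + 1 * lorentz (1 : R) s).
  apply: smooth1D; first exact: smooth1_cst.
  by apply: smooth1M; [exact: smooth1_cst|exact: smooth1_lorentz].
have nu1 s : 1 <= 1 + 1 * lorentz (1 : R) s by rewrite mul1r lerDl ltW.
have nu2 s : 1 + 1 * lorentz (1 : R) s <= 2 by have := l1 s; lra.
have Lun : L2 (fun x => u x * (1 + 1 * lorentz 1 x.1.1)).
  rewrite (_ : (fun _ => _) = (fun x => (1 + 1 * lorentz 1 x.1.1) * u x)); last first.
    by apply/funext => x; rewrite mulrC.
  by apply: (L2_coord1M (K := 2) snu) => // s; rewrite ger0_norm// (le_trans ler01).
have Lp : L2 (pull phi u) := pull_L2 Pm PK pK snu PhiD mu_ Lun.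
have D0 : \int[mu3]_x ((u x - pull phi u x) ^+ 2) <= 0.
  apply: le_trans (weak_partial_shift Pm Pge Ple PK pK sPhi snu PhiD nu1 nu2 Lu Lg ug) _.
  by rewrite mulr_ge0_le0// mulr_ge0// sqr_ge0.
have upu : \int[mu3]_x (u x ^+ 2) = \int[mu3]_x ((u x * (1 + 1 * lorentz 1 x.1.1)) ^+ 2).
  rewrite -(pull_sqr Pm PK pK snu PhiD mu_); apply: Rintegral_sqr_ae => //.
  have := Rintegral_sqr_eq0 (L2B Lu Lp) D0; apply: filterS; first exact: (ae_filter_ringOfSetsType mu3).
  by move=> x /eqP; rewrite subr_eq0 => /eqP.
have sl : smooth1 (@lorentz R 1) by exact: smooth1_lorentz.
have Ll : L2 (fun x => lorentz 1 x.1.1 * u x).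
  by apply: (L2_coord1M (K := 1) sl) => // s; rewrite gtr0_norm.
have Il := L2_sqr Ll; have Iu := L2_sqr Lu; have Iun := L2_sqr Lun.
have l2 : \int[mu3]_x ((lorentz 1 x.1.1 * u x) ^+ 2) <= 0.
  have -> : 0 = \int[mu3]_x ((u x * (1 + 1 * lorentz 1 x.1.1)) ^+ 2 - u x ^+ 2).
    by rewrite RintegralB// -upu subrr.
  apply: le_Rintegral => //; first exact: (integrableB measurableT Iun Iu).
  move=> x _; rewrite -subr_ge0.
  rewrite (_ : _ - _ = 2 * lorentz 1 x.1.1 * u x ^+ 2); last by ring.
  by rewrite mulr_ge0 ?sqr_ge0// mulr_ge0// ltW.
have L0 : L2 (fun=> 0 : R).
  by have := L2Z 0 Lu; rewrite (_ : (fun _ => _) = (fun=> 0))//; apply/funext => x; rewrite mul0r.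
rewrite (Rintegral_sqr_ae Lu L0); last first.
  have := Rintegral_sqr_eq0 Ll l2; apply: filterS; first exact: (ae_filter_ringOfSetsType mu3).
  by move=> x /eqP; rewrite mulf_eq0 gt_eqF//= => /eqP.
by under eq_Rintegral do rewrite expr0n/=; rewrite Rintegral_cst// mul0r.
Qed.

End L2_geometry.

Section lorentz_weight.
Context {R : realType}.
Local Notation mu3 := (leb3 R).
Implicit Types u v f g : R * R * R -> R.

Lemma cvg_lorentz (x : R) : (lorentz n.+1%:R x : R) @[n --> \oo] --> (1 : R).
Proof.
rewrite -[X in _ --> X]invr1; apply: cvgV; first exact: oner_neq0.
rewrite -[X in _ --> X]addr0; apply: cvgD; first exact: cvg_cst.
rewrite -(mulr0 (0 : R)); have h : x / n.+1%:R @[n --> \oo] --> (0 : R).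
  by rewrite -(mulr0 x); apply: cvgM; [exact: cvg_cst|exact: cvg_harmonic].
exact: cvgM.
Qed.

(** The weight tends to 1 as r grows, and dominated convergence applies. The bound [M] leaves room
    to absorb the error of order t / r later. *)
Lemma lorentz_sqr_ge_half g (M : R) : L2 g -> 0 < \int[mu3]_x (g x ^+ 2) ->
  exists r, [/\ 1 <= r, M <= r &
    \int[mu3]_x (g x ^+ 2) / 2 <= \int[mu3]_x (lorentz r x.1.1 * g x ^+ 2)].
Proof.
move=> Lg G0; have mg := L2_measurable Lg; have Ig := L2_sqr Lg.
pose f_ n x := (lorentz n.+1%:R x.1.1 * g x ^+ 2)%:E.
have mf n : measurable_fun [set: T3 R] (f_ n).
  apply/measurable_EFinP; apply: measurable_funM; last exact: measurable_funX.
  by apply: measurable_coord1; exact: smooth1_lorentz.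
have mE : measurable_fun [set: T3 R] (fun x => (g x ^+ 2)%:E) := measurable_int _ Ig.
have ff : {ae mu3, forall x, [set: T3 R] x -> f_ n x @[n --> \oo] --> (g x ^+ 2)%:E}.
  apply: aeW => x _; apply/fine_cvgP; split; first exact: nearW.
  rewrite -[X in _ --> X]mul1r; apply: cvgM; last exact: cvg_cst.
  exact: cvg_lorentz.
have le1 n x : lorentz n.+1%:R x.1.1 * g x ^+ 2 <= g x ^+ 2.
  by rewrite ler_piMl ?sqr_ge0// lorentz_le1.
have f0 n x : 0 <= lorentz n.+1%:R x.1.1 * g x ^+ 2.
  by rewrite mulr_ge0 ?sqr_ge0// ltW// lorentz_gt0.
have fg : {ae mu3, forall x n, [set: T3 R] x -> (`|f_ n x| <= (g x ^+ 2)%:E)%E}.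
  by apply: aeW => x n _; rewrite /= lee_fin ger0_norm.
have [_ _] := @dominated_convergence _ (T3 R) R mu3 setT measurableT f_ (fun x => (g x ^+ 2)%:E)
   (fun x => (g x ^+ 2)%:E) mf mE ff Ig fg.
rewrite -(fineK (integrable_fin_num measurableT Ig)) => /fine_cvgP[_].
move=> /(cvgr_gt (\int[mu3]_x (g x ^+ 2))) /(_ (\int[mu3]_x (g x ^+ 2) / 2)).
have /[swap] /[apply] : \int[mu3]_x (g x ^+ 2) / 2 < \int[mu3]_x (g x ^+ 2).
  by rewrite ltr_pdivrMr// ltr_pMr// ltr1n.
move=> [N _ hN]; have [m Mm] : exists m, M <= m%:R.
  by exists (Num.truncn M).+1; exact/ltW/truncnS_gt.
exists (maxn m N).+1%:R; split; first by rewrite ler1n.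
  by apply: le_trans Mm _; rewrite ler_nat leqW// leq_maxl.
by apply/ltW; apply: hN => /=; exact: leq_maxr.
Qed.

End lorentz_weight.

(** * The trial function *)

Section trial.
Context {R : realType}.
Local Notation mu3 := (leb3 R).
Implicit Types u v f g : R * R * R -> R.

Let i1 : 'I_3 := lift ord0 ord0.
Let i2 : 'I_3 := lift ord0 (lift ord0 ord0).

Let sum3 (F : 'I_3 -> R) : \sum_(i < 3) F i = F ord0 + (F i1 + F i2).
Proof. by rewrite !big_ord_recl big_ord0 addr0. Qed.

Lemma Rintegral_wgrad_sqr u : H1 u ->
  \int[mu3]_x (\sum_(i < 3) wgrad i u x ^+ 2) = \sum_(i < 3) \int[mu3]_x (wgrad i u x ^+ 2).
Proof.
move=> Hu; have I i : mu3.-integrable setT (EFin \o (fun x => wgrad i u x ^+ 2)).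
  by have [/L2_sqr] := wgrad_spec i Hu.
rewrite (sum3 (fun i => \int[mu3]_x (wgrad i u x ^+ 2))).
have e12 := RintegralD measurableT (I i1) (I i2).
have e := RintegralD measurableT (I ord0) (integrableD measurableT (I i1) (I i2)).
apply: etrans (etrans e (congr1 (+%R _) e12)).
by apply: eq_Rintegral => x _; exact: (sum3 (fun i => wgrad i u x ^+ 2)).
Qed.

Lemma Rintegral_wgrad u g i : H1 u -> L2 g -> weak_partial i u g ->
  \int[mu3]_x (wgrad i u x ^+ 2) = \int[mu3]_x (g x ^+ 2).
Proof.
move=> Hu Lg ug; have [Lw _] := wgrad_spec i Hu.
by apply: Rintegral_sqr_ae => //; exact: wgrad_unique.
Qed.

(** Here [s] is t lorentz, [d] is nu' and [e] is t / r. With a = 1 / (1 + s), the gain comes from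
    a^4 <= a <= 1 - s / 2. With q = d a and |q| <= e <= 1, the cross term is at most e (g^2 + u^2)
    and q^2 <= e. *)
Let gradient_le (s d e g u : R) : 0 <= s -> s <= 1 -> `|d| <= e -> e <= 1 ->
  (g / (1 + s) ^+ 2 - d * u / (1 + s) ^+ 3) ^+ 2 <=
  (g ^+ 2 - s / 2 * g ^+ 2) + e * (g ^+ 2 + 2 * u ^+ 2).
Proof.
move=> s0 s1 de e1; have n0 : 0 < 1 + s by rewrite ltr_wpDr.
set a := (1 + s)^-1.
have a0 : 0 <= a by rewrite invr_ge0 ltW.
have a1 : a <= 1 by rewrite invf_le1// lerDl.
have as2 : a <= 1 - s / 2.
  by rewrite -[a]mul1r ler_pdivrMr//; nra.
have a4 : a ^+ 4 <= a by rewrite -[leRHS]expr1 ler_wiXn2l.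
have a40 : 0 <= a ^+ 4 by rewrite exprn_ge0.
have qe : `|d * a| <= e.
  by rewrite normrM (ger0_norm a0) (le_trans _ de)// ler_piMr.
have -> : (g / (1 + s) ^+ 2 - d * u / (1 + s) ^+ 3) ^+ 2 = a ^+ 4 * (g - d * a * u) ^+ 2.
  by rewrite -!exprVn -/a; ring.
move: qe; move: (d * a) => q qe.
have q2 : (g - q * u) ^+ 2 <= g ^+ 2 + e * (g ^+ 2 + 2 * u ^+ 2).
  have q2e : q ^+ 2 <= e.
    rewrite -real_normK ?num_real// expr2 -[leRHS]mulr1; apply: ler_pM => //.
    exact: le_trans qe e1.
  have h2 : - (2 * q * g * u) <= e * (g ^+ 2 + u ^+ 2).
    apply: (@le_trans _ _ (`|q| * (g ^+ 2 + u ^+ 2))); last first.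
      by rewrite ler_wpM2r// addr_ge0// sqr_ge0.
    have [q0|q0] := leP 0 q; [rewrite ger0_norm//|rewrite ltr0_norm//].
      by have := mulr_ge0 q0 (sqr_ge0 (g + u)); nra.
    have q0' : 0 <= - q by rewrite oppr_ge0 ltW.
    by have := mulr_ge0 q0' (sqr_ge0 (g - u)); nra.
  by nra.
have e0 : 0 <= e := le_trans (normr_ge0 _) qe.
have E0 : 0 <= e * (g ^+ 2 + 2 * u ^+ 2).
  by rewrite mulr_ge0// addr_ge0 ?sqr_ge0// mulr_ge0// sqr_ge0.
apply: (le_trans (ler_wpM2l a40 q2)).
rewrite mulrDr lerD//; last by rewrite ler_piMl// (le_trans a4).
rewrite -[X in X - _]mul1r -mulrBl ler_wpM2r ?sqr_ge0//.
exact: le_trans a4 as2.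
Qed.

(** Origin of the constant 1 / 8: the gain is at least (t / 2) (G / 2), and the choice of [r] holds
    the error (t / r) (G + 2 c) below t G / 8. The equations allow integrals to be passed as plain
    reals. *)
Let gain_le (t r G c I A B L A2 B2 B3 : R) : 0 < t -> 0 < r -> 0 < G ->
  8 * (G + 2 * c) / G <= r ->
  I = A + B -> A = G - A2 -> A2 = t / 2 * L -> B = t / r * B2 ->
  B2 = G + B3 -> B3 = 2 * c -> G / 2 <= L -> I <= G - G / 8 * t.
Proof.
move=> t0 r0 G0 rM -> -> -> -> -> -> GL.
have h1 : t / 2 * (G / 2) <= t / 2 * L by rewrite ler_wpM2l// divr_ge0// ltW.
have h2 : t / r * (G + 2 * c) <= t * (G / 8).
  rewrite -mulrA ler_wpM2l ?(ltW t0)// mulrC ler_pdivrMr//.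
  by move: rM; rewrite ler_pdivrMr//; lra.
by lra.
Qed.

Lemma trial_exists u : H1 u -> 0 < \int[mu3]_x (u x ^+ 2) ->
  exists K k : R, [/\ 0 <= K, 0 < k & forall t : R, 0 < t -> t <= 1 -> exists v,
    [/\ H1 v, \int[mu3]_x (v x ^+ 2) = \int[mu3]_x (u x ^+ 2),
        \int[mu3]_x ((u x - v x) ^+ 2) <= K * t ^+ 2,
        \int[mu3]_x (\sum_(i < 3) wgrad i v x ^+ 2) <=
          \int[mu3]_x (\sum_(i < 3) wgrad i u x ^+ 2) - k * t &
        (coulomb v <= coulomb u)%E /\
        forall p, 2 <= p -> (power_integral mu3 p v <= power_integral mu3 p u)%E]].
Proof.
move=> Hu; have [Lu _] := Hu; have mu_ := L2_measurable Lu.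
set c := \int[mu3]_x (u x ^+ 2) => c0.
have Lg i := (wgrad_spec i Hu).1; have ug i := (wgrad_spec i Hu).2.
set g := fun i => wgrad i u in Lg ug *.
pose G := \int[mu3]_x (g ord0 x ^+ 2).
have G0 : 0 < G := weak_partial_sqr_gt0 Lu (Lg _) (ug _) c0.
have [r [r1 rM Gr]] := lorentz_sqr_ge_half (8 * (G + 2 * c) / G) (Lg _) G0.
rewrite -/G in Gr.
have r0 : 0 < r := lt_le_trans ltr01 r1.
(* The distance from u to v is split at [pull phi u]. The first part is bounded by
   [weak_partial_shift] with delta = 12 t r; the second uses nu - 1 <= t and gives t^2 c. The outer
   2 comes from the square of a sum. *)
exists (2 * (2 * (12 * r) ^+ 2 * G + c)), (G / 8); split.
- by rewrite mulr_ge0// addr_ge0 ?mulr_ge0 ?sqr_ge0// ltW.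
- by rewrite divr_gt0.
move=> t t0 t1; pose nu (s : R) : R := 1 + t * lorentz r s; pose dnu (s : R) : R := t * lorentz' r s.
have l0 (s : R) : 0 < lorentz r s by exact: lorentz_gt0.
have l1 (s : R) : lorentz r s <= 1 by exact: lorentz_le1.
have tl0 (s : R) : 0 <= t * lorentz r s by rewrite mulr_ge0// ltW.
have tl1 (s : R) : t * lorentz r s <= t by rewrite ler_piMr// ltW.
have [Phi [phi [[Pm Pge Ple PK pK] sPhi PhiD Pex]]] := stretching_exists r0 t0 t1.
have snu : smooth1 nu.
  apply: smooth1D; first exact: smooth1_cst.
  by apply: smooth1M; [exact: smooth1_cst|exact: smooth1_lorentz].
have sdnu : smooth1 dnu.
  by apply: smooth1M; [exact: smooth1_cst|exact: smooth1_lorentz'].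
have nuD s : is_derive s (1 : R) nu (dnu s).
  by have := is_derive_lorentz r0 s => ?; apply: is_derive_eq; rewrite /GRing.scale/= /dnu; ring.
have nu1 s : 1 <= nu s by rewrite lerDl.
have nu2 s : nu s <= 2 by have := tl1 s; rewrite /nu; lra.
have dnu_le s : `|dnu s| <= t / r.
  by rewrite normrM (gtr0_norm t0) ler_wpM2l ?(ltW t0)// lorentz'_le.
have nu0 s : 0 < nu s := lt_le_trans ltr01 (nu1 s).
have nuN s : nu s != 0 by rewrite gt_eqF.
have sV : smooth1 (fun s => (nu s)^-1) by exact: smooth1V.
have V1 s : `|(nu s)^-1| <= 1 by rewrite gtr0_norm ?invr_gt0// invf_le1.
have mV : measurable_fun [set: T3 R] (fun x => (nu x.1.1)^-1) by exact: (measurable_coord1 sV).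
pose v := pull phi (fun y => u y / nu y.1.1).
pose h i := if i == ord0
  then pull phi (fun y => g ord0 y / nu y.1.1 ^+ 3 - dnu y.1.1 * u y / nu y.1.1 ^+ 4)
  else pull phi (fun y => g i y / nu y.1.1).
have Lc (f w : R * R * R -> R) (m : R -> R) (K : R) : smooth1 m -> (forall s, `|m s| <= K) -> L2 f ->
    (forall y, w y = m y.1.1 * f y) -> L2 w.
  by move=> sm mK Lf wE; rewrite (funext wE); exact: (L2_coord1M sm mK Lf).
have mdiv f : L2 f -> measurable_fun [set: T3 R] (fun y => f y / nu y.1.1).
  by move=> Lf; apply: measurable_funM => //; exact: L2_measurable.
have Lpull f : L2 f -> L2 (pull phi (fun y => f y / nu y.1.1)).
  move=> Lf; apply: (pull_L2 Pm PK pK snu PhiD (mdiv f Lf)).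
  rewrite (_ : (fun _ => _) = f)//; apply/funext => y; by rewrite divfK.
pose w0 y := g ord0 y / nu y.1.1 ^+ 3 - dnu y.1.1 * u y / nu y.1.1 ^+ 4.
have s3 : smooth1 (fun s => (nu s)^-1 * ((nu s)^-1 * (nu s)^-1)).
  by apply: smooth1M => //; exact: smooth1M.
have s2 : smooth1 (fun s => (nu s)^-1 * (nu s)^-1) by exact: smooth1M.
have sd3 : smooth1 (fun s => dnu s * ((nu s)^-1 * ((nu s)^-1 * (nu s)^-1))) by exact: smooth1M.
have sd4 : smooth1 (fun s => dnu s * ((nu s)^-1 * ((nu s)^-1 * (nu s)^-1)) * (nu s)^-1) by exact: smooth1M.
have mle (a b : R) (x y : R) : `|x| <= a -> `|y| <= b -> `|x * y| <= a * b.
  by move=> xa yb; rewrite normrM ler_pM.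
have V2 s : `|(nu s)^-1 * (nu s)^-1| <= 1 * 1 by exact: mle.
have V3 s : `|(nu s)^-1 * ((nu s)^-1 * (nu s)^-1)| <= 1 * (1 * 1) by exact: mle.
have Vd3 s : `|dnu s * ((nu s)^-1 * ((nu s)^-1 * (nu s)^-1))| <= t / r * (1 * (1 * 1)) by exact: mle.
have Vd4 s : `|dnu s * ((nu s)^-1 * ((nu s)^-1 * (nu s)^-1)) * (nu s)^-1| <= t / r * (1 * (1 * 1)) * 1 by exact: mle.
have Lw0 : L2 w0.
  apply: L2B.
    apply: (Lc (g ord0) _ _ _ s3 V3 (Lg _)) => y; by field.
  apply: (Lc u _ _ _ sd4 Vd4 Lu) => y; by field.
have w0E y : w0 y * nu y.1.1 = g ord0 y / nu y.1.1 ^+ 2 - dnu y.1.1 * u y / nu y.1.1 ^+ 3.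
  by rewrite /w0; field.
have Lw0' : L2 (fun y => w0 y * nu y.1.1).
  rewrite (funext w0E); apply: L2B.
    apply: (Lc (g ord0) _ _ _ s2 V2 (Lg _)) => y; by field.
  apply: (Lc u _ _ _ sd3 Vd3 Lu) => y; by field.
have Lv : L2 v by exact: Lpull.
have Lh i : L2 (h i).
  rewrite /h; case: eqP => _; last exact: (Lpull _ (Lg i)).
  exact: (pull_L2 Pm PK pK snu PhiD (L2_measurable Lw0) Lw0').
have vh i : weak_partial i v (h i).
  rewrite /h; have [->|i0] := eqVneq i ord0.
    exact: (weak_partial_pull0 Pm Pge Ple PK pK sPhi snu PhiD nuD sdnu nu1 dnu_le Lu (Lg _) (ug _)).
  exact: (weak_partial_pull Pm Pge Ple PK pK sPhi snu PhiD nuD nu1 i0 Lu (Lg _) (ug _)).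
have Hv : H1 v by split => // i; exists (h i).
have sqr_pull f : L2 f -> \int[mu3]_x (pull phi (fun y => f y / nu y.1.1) x ^+ 2) = \int[mu3]_x (f x ^+ 2).
  move=> Lf; rewrite (pull_sqr Pm PK pK snu PhiD (mdiv f Lf)).
  by apply: eq_Rintegral => y _; rewrite divfK.
exists v; split; first exact: Hv.
- exact: (sqr_pull u Lu).
- have Lpu : L2 (pull phi u).
    apply: (pull_L2 Pm PK pK snu PhiD mu_).
    by apply: (Lc u _ _ 2 snu _ Lu) => [s|y]; [rewrite gtr0_norm|rewrite mulrC].
  have := Rintegral_sqrD_le (L2B Lu Lpu) (L2B Lpu Lv).
  under eq_Rintegral do rewrite subrKA.
  move=> /le_trans; apply.
  have h1 := weak_partial_shift Pm Pge Ple PK pK sPhi snu PhiD nu1 nu2 Lu (Lg _) (ug _).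
  rewrite -/G in h1.
  have h2 : \int[mu3]_x ((pull phi u x - v x) ^+ 2) <= t ^+ 2 * c.
    have Lud : L2 (fun y => u y - u y / nu y.1.1).
      by apply: L2B => //; apply: (Lc u _ _ _ sV V1 Lu) => y; rewrite mulrC.
    have -> : \int[mu3]_x ((pull phi u x - v x) ^+ 2) =
        \int[mu3]_x (((u x - u x / nu x.1.1) * nu x.1.1) ^+ 2).
      exact: (pull_sqr Pm PK pK snu PhiD (L2_measurable Lud)).
    rewrite -(Rintegral_sqrZ _ Lu); apply: le_Rintegral => //.
    + have e y : (u y - u y / nu y.1.1) * nu y.1.1 = (t * lorentz r y.1.1) * u y.
        by rewrite mulrBl divfK// /nu; ring.
      apply: L2_sqr; apply: (Lc u _ (fun s => t * lorentz r s) t _ _ Lu e) => [|s].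
        by apply: smooth1M; [exact: smooth1_cst|exact: smooth1_lorentz].
      by rewrite ger0_norm; [exact: tl1|exact: tl0].
    + exact: (L2_sqr (L2Z t Lu)).
    + move=> x _; rewrite mulrBl divfK// (_ : _ - _ = t * lorentz r x.1.1 * u x); last by rewrite /nu; ring.
      by rewrite !exprMn ler_wpM2r ?sqr_ge0// -exprMn lerXn2r ?nnegrE// ltW.
  rewrite -[leRHS]mulrA ler_wpM2l//; apply: le_trans (lerD h1 h2) _.
  by rewrite le_eqVlt; apply/orP; left; apply/eqP; ring.
(* The transverse derivatives keep their norms, since they are divided by nu and pulled back just as
   u is; only direction 0 contributes to the gain. *)
- have sum_le (A B a0 a1 a2 b0 b1 b2 k : R) : A = a0 + (a1 + a2) -> B = b0 + (b1 + b2) ->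
      a1 = b1 -> a2 = b2 -> a0 <= b0 - k -> A <= B - k by move=> -> -> -> -> ?; lra.
  have eu := etrans (Rintegral_wgrad_sqr Hu) (sum3 (fun i => \int[mu3]_x (wgrad i u x ^+ 2))).
  have ev := etrans (Rintegral_wgrad_sqr Hv) (sum3 (fun i => \int[mu3]_x (wgrad i v x ^+ 2))).
  have hi i : i != ord0 -> \int[mu3]_x (wgrad i v x ^+ 2) = \int[mu3]_x (wgrad i u x ^+ 2).
    move=> /negbTE i0; apply: (etrans (Rintegral_wgrad Hv (Lh i) (vh i))).
    by rewrite /h i0; exact: (sqr_pull _ (Lg i)).
  apply: (sum_le _ _ _ _ _ _ _ _ _ ev eu (hi i1 isT) (hi i2 isT)).
  apply: (@le_trans _ _ (\int[mu3]_y ((w0 y * nu y.1.1) ^+ 2))).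
    rewrite -(pull_sqr Pm PK pK snu PhiD (L2_measurable Lw0)).
    by rewrite le_eqVlt; apply/orP; left; apply/eqP; exact: (Rintegral_wgrad Hv (Lh ord0) (vh ord0)).
  set e := t / r.
  have e1 : e <= 1 by rewrite ler_pdivrMr// mul1r (le_trans t1).
  have Ig := L2_sqr (Lg ord0); have Iu := L2_sqr Lu.
  have Il : mu3.-integrable setT (EFin \o (fun x => lorentz r x.1.1 * g ord0 x ^+ 2)).
    have Ll : L2 (fun x => lorentz r x.1.1 * g ord0 x).
      apply: (L2_coord1M (K := 1) (smooth1_lorentz r)) (Lg ord0) => s.
      by rewrite gtr0_norm.
    have -> : (fun x => lorentz r x.1.1 * g ord0 x ^+ 2) = (fun x => lorentz r x.1.1 * g ord0 x * g ord0 x).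
      by apply/funext => x; rewrite expr2 mulrA.
    exact: (L2M Ll (Lg ord0)).
  have Il2 := integrableZl measurableT (t / 2) Il.
  have Iu2 := integrableZl measurableT 2 Iu.
  have Igu := integrableD measurableT Ig Iu2.
  have Ie := integrableZl measurableT e Igu.
  have Igl := integrableB measurableT Ig Il2.
  apply: (@le_trans _ _ (\int[mu3]_x ((g ord0 x ^+ 2 - t / 2 * (lorentz r x.1.1 * g ord0 x ^+ 2)) +
      e * (g ord0 x ^+ 2 + 2 * u x ^+ 2)))).
    apply: le_Rintegral => //.
    - exact: (L2_sqr Lw0').
    - exact: (integrableD measurableT Igl Ie).
    move=> x _; rewrite w0E.
    have := gradient_le (g ord0 x) (u x) (tl0 x.1.1) (le_trans (tl1 _) t1) (dnu_le x.1.1) e1.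
    by have -> : t * lorentz r x.1.1 / 2 * g ord0 x ^+ 2 =
        t / 2 * (lorentz r x.1.1 * g ord0 x ^+ 2) by ring.
  have E1 := RintegralD measurableT Igl Ie.
  have E2 := RintegralB measurableT Ig Il2.
  have E3 := RintegralZl (t / 2) measurableT Il.
  have E4 := RintegralZl e measurableT Igu.
  have E5 := RintegralD measurableT Ig Iu2.
  have E6 := RintegralZl 2 measurableT Iu.
  exact: (gain_le t0 r0 G0 rM E1 E2 E3 E4 E5 E6 Gr).
- split; first exact: (coulomb_pull_le Pm PK pK snu PhiD nu1 Pex mu_).
  by move=> p; exact: (power_integral_pull_le Pm PK pK snu PhiD nu1 mu_).
Qed.

End trial.

(** * The derivative of the energy *)

Section criticality.
Context {R : realType}.
Local Notation mu3 := (leb3 R).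
Implicit Types u v f g : R * R * R -> R.

(** The derivative is known to exist, so one difference quotient at a small positive t decides. *)
Lemma is_derive_le (f : R -> R) (l k : R) : is_derive (0 : R) (1 : R) f l ->
  (exists2 t0, 0 < t0 & forall t, 0 < t < t0 -> f t <= f 0 + t * k) -> l <= k.
Proof.
move=> fl [t0 t00 fk]; rewrite leNgt; apply/negP => kl.
have [df dE] := fl.
have : h^-1 *: (f (h *: (1 : R) + 0) - f 0) @[h --> 0^'] --> l.
  by rewrite -dE; exact: df.
move=> /(cvgr_gt l) /(_ k kl); rewrite near_withinE => /nbhs_ballP[e /= e0 he].
have m0 : 0 < Num.min e t0 by rewrite lt_min e0.
pose t := Num.min e t0 / 2; have tpos : 0 < t by rewrite divr_gt0.
have tm : t < Num.min e t0 by rewrite ltr_pdivrMr// ltr_pMr// ltr1n.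
have [te tt0] : t < e /\ t < t0 by move: tm; rewrite lt_min => /andP[].
have := he t; rewrite /ball/= sub0r normrN gtr0_norm// => /(_ te).
rewrite gt_eqF// => /(_ isT); rewrite /GRing.scale/= mulr1 addr0 mulrC ltr_pdivlMr//.
have := fk t; rewrite tpos tt0 => /(_ isT).
by rewrite (mulrC t); lra.
Qed.

(** [wgrad] is a choice, linear only almost everywhere, so the comparison is made between the
    integrals of each squared partial derivative. *)
Lemma dirichlet_segment (k t : R) u v : 0 < t < 1 -> H1 u -> H1 v ->
  \int[mu3]_x (\sum_(i < 3) wgrad i (fun x => u x + t * (k * v x - u x)) x ^+ 2) <=
  (1 - t) * \int[mu3]_x (\sum_(i < 3) wgrad i u x ^+ 2) +
  t * (k ^+ 2 * \int[mu3]_x (\sum_(i < 3) wgrad i v x ^+ 2)).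
Proof.
move=> t01 Hu Hv.
have -> : (fun x => u x + t * (k * v x - u x)) = (fun x => (1 - t) * u x + (t * k) * v x).
  by apply/funext => x; ring.
have Hw := H1_lin (1 - t) (t * k) Hu Hv.
have le_sum (A B C : R) (F G H : 'I_3 -> R) : A = \sum_(i < 3) F i -> B = \sum_(i < 3) G i ->
    C = \sum_(i < 3) H i -> (forall i, F i <= (1 - t) * G i + t * (k ^+ 2 * H i)) ->
    A <= (1 - t) * B + t * (k ^+ 2 * C).
  move=> -> -> -> h; rewrite !mulr_sumr -big_split/=; exact: ler_sum.
apply: (le_sum _ _ _ _ _ _ (Rintegral_wgrad_sqr Hw) (Rintegral_wgrad_sqr Hu) (Rintegral_wgrad_sqr Hv)) => i.
have [Lg ug] := wgrad_spec i Hu; have [Lh vh] := wgrad_spec i Hv.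
have wp := weak_partial_lin (1 - t) (t * k) Hu.1 Hv.1 Lg Lh ug vh.
have Lw := L2D (L2Z (1 - t) Lg) (L2Z (t * k) Lh).
rewrite (Rintegral_wgrad Hw Lw wp) -(Rintegral_sqrZ k Lh).
apply: le_trans (Rintegral_sqr_convex t01 Lg (L2Z k Lh)).
by rewrite le_eqVlt; apply/orP; left; apply/eqP; apply: eq_Rintegral => x _; rewrite mulrA.
Qed.

(** [m] stands for <u, v> and [D] for ||u - v||^2, with ||u||^2 = ||v||^2 = c. Polarization gives m
    = c - D / 2 >= c / 2, hence c / m - 1 = D / (2 m) <= D / c. *)
Lemma normalizing_factor (c D m B : R) : 0 < c -> 0 <= D -> D <= B -> D <= c -> D = c - 2 * m + c ->
  [/\ 0 < m, 1 <= c / m, c / m <= 2 & c / m - 1 <= B / c].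
Proof.
move=> c0 D0 DB Dc DE; have mE : m = c - D / 2 by lra.
have m0 : 0 < m by lra.
split=> //; first by rewrite ler_pdivlMr//; lra.
  by rewrite ler_pdivrMr//; lra.
have -> : c / m - 1 = (c - m) / m by field; rewrite gt_eqF.
rewrite ler_pdivrMr// mulrAC ler_pdivlMr//.
have h1 : (c - m) * c <= D / 2 * (2 * m) by rewrite ler_pM//; lra.
by apply: (le_trans h1); rewrite mulrA divfK// ler_wpM2r// ltW.
Qed.

(** The exponent 6 dominates the degrees 2, 4 and p of the three terms. For 1 <= th <= 2, th^6 - 1
    <= 63 (th - 1), since 1 + 2 + ... + 2^5 = 63. The constant 126 = 2 * 63 makes the loss, of order
    t^2, smaller than the gain k t / 2. *)
Lemma second_order_gain_lt0 (th K k t c U E C P qC qP : R) : 0 < t -> 0 <= K -> 0 < k -> 0 < c -> 0 <= U ->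
  0 <= C -> 0 <= P -> 1 <= th -> th <= 2 -> th - 1 <= K * t ^+ 2 / c ->
  qC <= th ^+ 6 -> qP <= th ^+ 6 -> E = 2^-1 * U + C + P -> 126 * E * K * t < c * k ->
  2^-1 * (th ^+ 2 * (U - k * t) - U) + (qC - 1) * C + (qP - 1) * P < 0.
Proof.
move=> t0 K0 k0 c0 U0 C0 P0 th1 th2 thK hC hP EE small.
have E0 : 0 <= E by rewrite EE !addr_ge0// mulr_ge0.
have th0 : 0 <= th by rewrite (le_trans ler01).
have h26 : th ^+ 2 <= th ^+ 6 by rewrite ler_weXn2l.
have h02 : 1 <= th ^+ 2 by rewrite exprn_ege1.
have h6 : th ^+ 6 - 1 <= 63 * (th - 1).
  have h n : th ^+ n <= 2 ^+ n by rewrite lerXn2r// nnegrE.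
  have -> : th ^+ 6 - 1 = (th - 1) * (1 + th + th ^+ 2 + th ^+ 3 + th ^+ 4 + th ^+ 5) by ring.
  rewrite mulrC ler_wpM2r ?subr_ge0//.
  have := h 2; have := h 3; have := h 4; have := h 5.
  by lra.
have A1 : th ^+ 2 * (U - k * t) <= th ^+ 6 * U - k * t.
  rewrite mulrBr lerB ?ler_wpM2r// ler_peMl// mulr_ge0// ltW//.
have A2 : (qC - 1) * C <= (th ^+ 6 - 1) * C by rewrite ler_wpM2r// lerD2r.
have A3 : (qP - 1) * P <= (th ^+ 6 - 1) * P by rewrite ler_wpM2r// lerD2r.
have A4 : (th ^+ 6 - 1) * E <= 63 * (K * t ^+ 2 / c) * E.
  by rewrite ler_wpM2r// (le_trans h6)// ler_wpM2l.
have A5 : 63 * (K * t ^+ 2 / c) * E < 2^-1 * (k * t).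
  have -> : 63 * (K * t ^+ 2 / c) * E = 2^-1 * t * (126 * E * K * t) / c by field; rewrite gt_eqF.
  rewrite ltr_pdivrMr//.
  have -> : 2^-1 * (k * t) * c = 2^-1 * t * (c * k) by ring.
  by rewrite ltr_pM2l// mulr_gt0// invr_gt0.
have A6 : (th ^+ 6 - 1) * E = 2^-1 * (th ^+ 6 * U) - 2^-1 * U + (th ^+ 6 - 1) * C + (th ^+ 6 - 1) * P.
  by rewrite EE; ring.
by lra.
Qed.

(** X, Y, Z stand for the Dirichlet, Coulomb and power integrals at parameter [s] of the segment, U,
    Y0, Z0 for those of u, and W for an upper bound of the Dirichlet integral V of v. *)
Lemma energy_chord_le (gamma a p s th qC qP X Y Z U V Y0 Z0 W : R) :
  0 <= - gamma / 4 -> 0 <= - a / p -> 0 < s < 1 ->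
  X <= (1 - s) * U + s * (th ^+ 2 * V) -> V <= W ->
  Y <= (1 + s * (qC - 1)) * Y0 -> Z <= (1 + s * (qP - 1)) * Z0 ->
  2^-1 * X - gamma / 4 * Y - a / p * Z <= 2^-1 * U - gamma / 4 * Y0 - a / p * Z0 +
  s * (2^-1 * (th ^+ 2 * W - U) + (qC - 1) * (- gamma / 4 * Y0) + (qP - 1) * (- a / p * Z0)).
Proof.
rewrite !mulNr; move: (gamma / 4) (a / p) => g b g0 b0 /andP[s0 s1] hX hV hY hZ.
have h1 := ler_wpM2l g0 hY; have h2 := ler_wpM2l b0 hZ.
have h3 : s * (th ^+ 2 * V) <= s * (th ^+ 2 * W).
  by rewrite ler_wpM2l ?(ltW s0)// ler_wpM2l ?sqr_ge0.
by lra.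
Qed.

End criticality.

Theorem theorem1p1 (R : realType) (p c gamma a : R)
    (hp : 10 / 3 < p <= 6) (hc : 0 < c) (hgamma : gamma < 0) (ha : a < 0) :
  ~ exists u : R * R * R -> R, critical_point_on_sphere (energy p gamma a) c u.
Proof.
move=> [u [[Hu uc] crit]].
have /andP[p103 p6] := hp; have p2 : 2 <= p by lra.
have p1 : 1 <= p by lra.
have p0 : 0 < p by lra.
have {}uc : \int[leb3 R]_x (u x ^+ 2) = c.
  by rewrite -uc; apply: eq_Rintegral => x _; rewrite real_normK ?num_real.
have c0 : 0 < \int[leb3 R]_x (u x ^+ 2) by rewrite uc.
have [K [k [K0 k0 trial]]] := trial_exists Hu c0; rewrite uc in trial.
have [Lu _] := Hu; have mu_ := L2_measurable Lu.
pose U := \int[leb3 R]_x (\sum_(i < 3) wgrad i u x ^+ 2).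
pose C := - gamma / 4 * fine (coulomb u).
pose P := - a / p * fine (power_integral (leb3 R) p u).
have U0 : 0 <= U by apply: Rintegral_ge0 => x _; apply: sumr_ge0 => i _; exact: sqr_ge0.
have gam0 : 0 <= - gamma / 4 by rewrite divr_ge0// oppr_ge0 ltW.
have ap0 : 0 <= - a / p by apply: divr_ge0; [rewrite oppr_ge0 ltW|rewrite ltW].
have hc0 := ltW hc; have ck0 : 0 <= c * k by rewrite mulr_ge0// ltW.
have C0 : 0 <= C by rewrite mulr_ge0// fine_ge0// coulomb_ge0.
have P0 : 0 <= P by rewrite mulr_ge0// fine_ge0// power_integral_ge0.
pose E := 2^-1 * U + C + P.
have E0 : 0 <= E by rewrite !addr_ge0// mulr_ge0.
(* The first summand of [q] gives K t <= c, which bounds the normalizing factor by 2; the second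
   gives 126 E K t < c k, which makes the gain win. *)
pose q := K / c + 126 * E * K / (c * k).
have q0 : 0 <= q by rewrite addr_ge0// divr_ge0// !mulr_ge0.
pose t := (1 + q)^-1.
have den0 : 0 < 1 + q by rewrite ltr_wpDr.
have t0 : 0 < t by rewrite invr_gt0.
have t1 : t <= 1 by rewrite invf_le1// lerDl.
have EK0 : 0 <= 126 * E * K by rewrite !mulr_ge0.
have Kt : K * t <= c.
  rewrite ler_pdivrMr//; have -> : c * (1 + q) = c + K + 126 * E * K / k.
    by rewrite /q; field; rewrite !gt_eqF.
  by have := divr_ge0 EK0 (ltW k0); lra.
have small : 126 * E * K * t < c * k.
  rewrite ltr_pdivrMr//; have -> : c * k * (1 + q) = c * k + K * k + 126 * E * K.
    by rewrite /q; field; rewrite !gt_eqF.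
  by have := mulr_gt0 hc k0; have := mulr_ge0 K0 (ltW k0); lra.
have [v [Hv vc uv Dv [Cv Pv]]] := trial t t0 t1; rewrite -/U in Dv.
have [Lv _] := Hv; have mv := L2_measurable Lv.
pose m := \int[leb3 R]_x (u x * v x).
pose D := \int[leb3 R]_x ((u x - v x) ^+ 2).
have D0 : 0 <= D by apply: Rintegral_ge0 => x _; exact: sqr_ge0.
have DE := Rintegral_sqrB Lu Lv; rewrite uc vc in DE.
have DK : D <= K * t ^+ 2 by [].
have Dc : D <= c by rewrite (le_trans DK)// (le_trans _ Kt)// expr2 mulrA ler_piMr// mulr_ge0// ltW.
have [m0 th1 th2 thK] := normalizing_factor hc D0 DK Dc DE.
set th := c / m in th1 th2 thK.
have th0 : 0 < th by exact: lt_le_trans th1.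
have Hd : H1 (fun x => th * v x - u x).
  have := H1_lin th (-1) Hv Hu; rewrite (_ : (fun _ => _) = (fun x => th * v x - u x))//.
  by apply/funext => x; rewrite mulN1r.
have tangent : tangent_space u (fun x => th * v x - u x).
  split => //; have Iuv := L2M Lu Lv; have Iu := L2_sqr Lu.
  transitivity (\int[leb3 R]_x (th * (u x * v x) - u x ^+ 2)).
    by apply: eq_Rintegral => x _; ring.
  have e1 := RintegralB measurableT (integrableZl measurableT th Iuv) Iu.
  by apply: (etrans e1); rewrite uc RintegralZl// -/m /th divfK ?subrr// gt_eqF.
have mw : measurable_fun [set: T3 R] (fun x => th * v x) by exact: measurable_funM.
have Cw : (coulomb (fun x => th * v x)%R <= (th ^+ 4)%:E * coulomb u)%E.
  by rewrite (coulombZ _ mv); apply: (lee_wpmul2l _ Cv); rewrite lee_fin exprn_ge0// ltW.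
have Pw : (power_integral (leb3 R) p (fun x => th * v x)%R <=
    (`|th| `^ p)%:E * power_integral (leb3 R) p u)%E.
  by rewrite (power_integralZ _ _ _ mv); apply: (lee_wpmul2l _ (Pv p p2)); rewrite lee_fin powR_ge0.
have [tC tC0 segC] := convex_functional_fine (@coulomb_ge0 R) (@coulomb_convex R) (@coulombZ R) mu_ mw Cw.
have [tP tP0 segP] := convex_functional_fine (power_integral_ge0 (leb3 R) p)
  (fun s f g => @power_integral_convex R _ (T3 R) (leb3 R) p s f g p1) (@power_integralZ R _ (T3 R) (leb3 R) p) mu_ mw Pw.
have pw6 : `|th| `^ p <= th ^+ 6.
  by rewrite (gtr0_norm th0) -(powR_mulrn _ (ltW th0)) ler_powR.
have th46 : th ^+ 4 <= th ^+ 6 by rewrite ler_weXn2l.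
have hneg := second_order_gain_lt0 t0 K0 k0 hc U0 C0 P0 th1 th2 thK th46 pw6 (erefl E) small.
(* Criticality makes this derivative 0, while the slope supplied here is negative by [hneg]. *)
have := is_derive_le (crit _ tangent) (k := 2^-1 * (th ^+ 2 * (U - k * t) - U) +
  (th ^+ 4 - 1) * C + (`|th| `^ p - 1) * P).
rewrite leNgt hneg => /(_ _)/negP; apply => //.
exists (Num.min 1 (Num.min tC tP)); first by rewrite !lt_min ltr01 tC0.
move=> s /andP[s0]; rewrite !lt_min => /and3P[s1 sC sP].
have u0 : (fun x => u x + 0 * (th * v x - u x)) = u by apply/funext => x; rewrite mul0r addr0.
have s01 : 0 < s < 1 by rewrite s0.
have C' := segC s; rewrite s0 sC in C'; have P' := segP s; rewrite s0 sP in P'.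
rewrite u0.
exact: (energy_chord_le gam0 ap0 s01 (dirichlet_segment th s01 Hu Hv) Dv (C' isT) (P' isT)).
Qed.
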